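(* Let $A\xrightarrow{f}Y\to Y\cup CA$ be a cofibration, let $\varphi\colon Y\cup CA\to Z$ be a map, let $\Omega Z\to E'\to Y\cup CA$ be the principal fibration induced by $\varphi$, and let $E$ be the pullback of $E'\to Y\cup CA$ along the inclusion $Y\to Y\cup CA$, with maps $p\colon E\to Y$ and $E\to E'$; thus $\Omega Z\to E\xrightarrow{p}Y$ is the principal fibration induced by the composite $h\colon Y\to Y\cup CA\xrightarrow{\varphi}Z$. Let $g\colon A\to E$ be the restriction to $A$ of a map of pairs $(CA,A)\to(E',E)$ whose composite with $(E',E)\to(Y\cup CA,Y)$ is the standard inclusion $(CA,A)\to (Y\cup CA,Y)$ (such a map of pairs exists). Suppose that $\Omega h\colon\Omega Y\to\Omega Z$ has a right homotopy inverse $s\colon\Omega Z\to\Omega Y$. Then there is a homotopy cofibration $$\Omega Z\ltimes A\xrightarrow{\;\overline{\Gamma}\circ(s\ltimes g)\;}E\longrightarrow E',$$ where $\overline{\Gamma}\colon\Omega Y\ltimes E\to E$ is the map associated (see context) to the principal fibration $\Omega Z\to E\xrightarrow{p}Y$.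
   Context: All given spaces are path-connected, pointed, and have the homotopy type of finite type CW-complexes; maps and homotopies are pointed. $CX=(X\times I)/\sim$ with $(x,0)\sim\ast$, $(\ast,t)\sim\ast$, and $X\subseteq CX$ via $x\mapsto(x,1)$. The standard inclusion $(CA,A)\to(Y\cup CA,Y)$ is the canonical map of the cone, restricting to $f$ on $A$. The left half-smash is $A\ltimes B=(A\times B)/\sim$ with $(a,\ast)\sim\ast$. Principal fibrations: for $h\colon B\to Z$, let $PZ=\{\omega\in Z^I\mid\omega(0)=\ast\}$, $E=\{(b,\omega)\in B\times PZ\mid\omega(1)=h(b)\}$, $p(b,\omega)=b$, $i\colon\Omega Z\to E$, $i(\gamma)=(\ast,\gamma)$. The action $a\colon\Omega Z\times E\to E$ is $a(\gamma,(b,\omega))=(b,\omega\circ\gamma)$, where $\omega\circ\gamma$ is the concatenation ''first $\gamma$, then $\omega$''; its restriction to $\Omega Z$ is taken to be $i$. The map $\overline{\Gamma}$ (here with $B=Y$): let $\theta\colon\Omega B\times E\xrightarrow{\Omega h\times1}\Omega Z\times E\xrightarrow{a}E$, and let $K\colon C\Omega B\to E$ be $K(\gamma,t)=(\gamma(t),h\circ\gamma_t)$ where $\gamma_t(s)=\gamma(st)$. Both restrict to $i\circ\Omega h$ on $\Omega B$, so they define a map $\Gamma\colon C\Omega B\cup_{\Omega B}\Omega B\times E\to E$. Collapsing the cone gives a natural homotopy equivalence $C\Omega B\cup_{\Omega B}\Omega B\times E\to\Omega B\ltimes E$; let $\epsilon$ be a natural homotopy inverse. Then $\overline{\Gamma}=\Gamma\circ\epsilon\colon\Omega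 B\ltimes E\to E$. *)

(* Defs.v *)
From HB Require Import structures.
From mathcomp Require Import all_boot all_order all_algebra generic_quotient.
From mathcomp Require Import all_classical all_reals all_analysis.
From Stdlib Require Import Relation_Operators.

Set Implicit Arguments.
Unset Strict Implicit.
Unset Printing Implicit Defensive.

Import Order.TTheory GRing.Theory Num.Theory.
Import numFieldNormedType.Exports.
Local Open Scope classical_set_scope.
Local Open Scope ring_scope.
Local Open Scope quotient_scope.
Local Obligation Tactic := idtac.

(* A space is an arbitrary ptopologicalType whose base point is [point].
   Products carry the product topology, path spaces the compact-open
   topology; no compactly generated refinement is applied. *)

HB.instance Definition _ (X Y : ptopologicalType) := Pointed.on (X * Y)%type.

Section PointedMaps.

Record pmap (X Y : ptopologicalType) := PMap {
  pfun :> X -> Y;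
  pmap_cts : continuous pfun;
  pmap_pt : pfun point = point }.

Lemma pmap_eqP (X Y : ptopologicalType) (f g : pmap X Y) : f =1 g -> f = g.
Proof.
case: f g => [f cf pf] [g cg pg] /= /funext fg; subst g.
by rewrite (Prop_irrelevance cf cg) (Prop_irrelevance pf pg).
Qed.

Lemma comp_cts (X Y Z : topologicalType) (f : X -> Y) (g : Y -> Z) :
  continuous f -> continuous g -> continuous (fun x => g (f x)).
Proof. by move=> cf cg x; apply: continuous_comp; [exact: cf|exact: cg]. Qed.

Lemma pair_cts (X Y Y' : topologicalType) (f : X -> Y) (g : X -> Y') :
  continuous f -> continuous g -> continuous (fun x => (f x, g x)).
Proof. by move=> cf cg x; apply: cvg_pair; [exact: cf|exact: cg]. Qed.

Lemma id_cts (X : topologicalType) : continuous (fun x : X => x).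
Proof. by move=> x U. Qed.

Lemma cst_cts (X Y : topologicalType) (y : Y) : continuous (fun _ : X => y).
Proof. by move=> x; exact: cvg_cst. Qed.

Lemma fst_cts (X Y : topologicalType) : continuous (@fst X Y).
Proof. by move=> x; exact: cvg_fst. Qed.

Lemma snd_cts (X Y : topologicalType) : continuous (@snd X Y).
Proof. by move=> x; exact: cvg_snd. Qed.

Definition pidm (X : ptopologicalType) : pmap X X :=
  @PMap X X id (@id_cts X) erefl.

Program Definition pcomp (X Y Z : ptopologicalType)
    (g : pmap Y Z) (f : pmap X Y) : pmap X Z :=
  @PMap X Z (fun x => g (f x)) _ _.
Next Obligation. by move=> X Y Z g f; apply: comp_cts; exact: pmap_cts. Qed.
Next Obligation. by move=> X Y Z g f /=; rewrite !pmap_pt. Qed.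

Program Definition pprod (X X' Y Y' : ptopologicalType)
    (f : pmap X Y) (g : pmap X' Y') : pmap (X * X')%type (Y * Y')%type :=
  @PMap (X * X')%type (Y * Y')%type (fun x => (f x.1, g x.2)) _ _.
Next Obligation.
move=> X X' Y Y' f g.
by apply: pair_cts; apply: comp_cts;
  [exact: fst_cts|exact: pmap_cts|exact: snd_cts|exact: pmap_cts].
Qed.
Next Obligation. by move=> X X' Y Y' f g /=; rewrite !pmap_pt. Qed.

Program Definition pinl (X Y : ptopologicalType) : pmap X (X * Y)%type :=
  @PMap X (X * Y)%type (fun x => (x, point)) _ _.
Next Obligation.
by move=> X Y; apply: pair_cts; [exact: id_cts|exact: cst_cts].
Qed.
Next Obligation. by []. Qed.

End PointedMaps.

Notation "{ 'pmap' X -> Y }" := (pmap X Y)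
  (at level 0, X at level 69, format "{ 'pmap'  X  ->  Y }") : type_scope.
Notation "g \po f" := (pcomp g f) (at level 50, left associativity).
Notation "f \px g" := (pprod f g) (at level 40, left associativity).

Section Quotients.

Section GeneratedQuotient.
Context (T : ptopologicalType) (r : T -> T -> Prop).

Let r_eqv (x y : T) : bool := `[< clos_refl_sym_trans T r x y >].

Let r_eqv_refl : reflexive r_eqv.
Proof. by move=> x; apply/asboolP; exact: rst_refl. Qed.

Let r_eqv_sym : symmetric r_eqv.
Proof.
by move=> x y; apply/idP/idP => /asboolP xy; apply/asboolP; exact: rst_sym.
Qed.

Let r_eqv_trans : transitive r_eqv.
Proof.
move=> y x z /asboolP xy /asboolP yz; apply/asboolP; exact: rst_trans xy yz.
Qed.

Definition gen_equiv := EquivRel r_eqv r_eqv_refl r_eqv_sym r_eqv_trans.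

Definition pquot : ptopologicalType := quotient_topology {eq_quot gen_equiv}.

Lemma pquotP (x y : T) :
  \pi_{eq_quot gen_equiv} x = \pi_{eq_quot gen_equiv} y <->
  clos_refl_sym_trans T r x y.
Proof. by split=> [/eqmodP/asboolP|xy]//; apply/eqmodP/asboolP. Qed.

Program Definition ppi : {pmap T -> pquot} :=
  @PMap T pquot (\pi_{eq_quot gen_equiv}) _ _.
Next Obligation. exact: pi_continuous. Qed.
Next Obligation. by []. Qed.

Lemma ppi_eq (x y : T) : r x y -> ppi x = ppi y.
Proof. by move=> rxy; apply/pquotP; exact: rst_step. Qed.

Lemma ppi_surj (q : pquot) : exists x, ppi x = q.
Proof. by exists (repr q); exact: reprK. Qed.

Section Lift.
Context (Z : ptopologicalType) (f : {pmap T -> Z}).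
Hypothesis fr : forall x y, r x y -> f x = f y.

Let fr_rst x y : clos_refl_sym_trans T r x y -> f x = f y.
Proof. by elim=> [x1 y1 /fr|x1|x1 y1 _ ->|x1 y1 z1 _ -> _ ->]. Qed.

Let lift_fun (q : {eq_quot gen_equiv}) : Z := f (repr q).

Let lift_pi x : lift_fun (\pi_{eq_quot gen_equiv} x) = f x.
Proof. by apply: fr_rst; apply/pquotP; exact: reprK. Qed.

Program Definition plift : {pmap pquot -> Z} := @PMap pquot Z lift_fun _ _.
Next Obligation.
apply/(@quotient_continuous T {eq_quot gen_equiv}).
have -> : lift_fun \o \pi_{eq_quot gen_equiv} = f.
  by apply/funext => x /=; exact: lift_pi.
exact: pmap_cts.
Qed.
Next Obligation. by rewrite -[RHS](pmap_pt f); exact: lift_pi. Qed.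

Lemma pliftE x : plift (ppi x) = f x.
Proof. exact: lift_pi. Qed.

End Lift.
End GeneratedQuotient.

Section Coproduct.
Context (X Y : ptopologicalType).

Definition coprod_open (U : set (X + Y)) :=
  open (inl @^-1` U : set X) /\ open (inr @^-1` U : set Y).

Program Definition coprod_mixin :=
  @isOpenTopological.Build (X + Y)%type coprod_open _ _ _.
Next Obligation. by split; rewrite preimage_setT; exact: openT. Qed.
Next Obligation.
by move=> A B [? ?] [? ?]; split; rewrite preimage_setI; exact: openI.
Qed.
Next Obligation.
by move=> I F oF; split; rewrite preimage_bigcup; apply: bigcup_open => i _;
  case: (oF i).
Qed.
HB.instance Definition _ := coprod_mixin.
HB.instance Definition _ := isPointed.Build (X + Y)%type (inl point).

Lemma inl_cts : continuous (@inl X Y).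
Proof. by apply/continuousP => U []. Qed.

Lemma inr_cts : continuous (@inr X Y).
Proof. by apply/continuousP => U []. Qed.

End Coproduct.

(* The pushout of A <-f- C -g-> B is the quotient of the disjoint union of A
   and B by f c ~ g c; as f and g are pointed this glues the base points. *)
Section Pushout.
Context (C A B : ptopologicalType) (f : {pmap C -> A}) (g : {pmap C -> B}).

Definition pushout_rel (u v : A + B) := exists c, u = inl (f c) /\ v = inr (g c).

Definition pushout : ptopologicalType := pquot pushout_rel.

Program Definition po_l : {pmap A -> pushout} :=
  @PMap A pushout (fun a => ppi pushout_rel (inl a)) _ _.
Next Obligation. by apply: comp_cts; [exact: inl_cts|exact: pmap_cts]. Qed.
Next Obligation. by []. Qed.

Lemma po_glue c :
  ppi pushout_rel (inl (f c)) = ppi pushout_rel (inr (g c)).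
Proof. by apply: ppi_eq; exists c. Qed.

Program Definition po_r : {pmap B -> pushout} :=
  @PMap B pushout (fun b => ppi pushout_rel (inr b)) _ _.
Next Obligation. by apply: comp_cts; [exact: inr_cts|exact: pmap_cts]. Qed.
Next Obligation.
by have := po_glue point; rewrite !pmap_pt => <-; exact: (pmap_pt (ppi _)).
Qed.

Section Copair.
Context (Z : ptopologicalType) (u : {pmap A -> Z}) (v : {pmap B -> Z}).

Program Definition pcopair : {pmap (A + B)%type -> Z} :=
  @PMap (A + B)%type Z (fun w => match w with inl a => u a | inr b => v b end)
    _ _.
Next Obligation.
apply/continuousP => U oU; split.
- by have /continuousP := @pmap_cts _ _ u; exact.
- by have /continuousP := @pmap_cts _ _ v; exact.
Qed.
Next Obligation. exact: pmap_pt. Qed.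

Hypothesis uv : forall c, u (f c) = v (g c).

Lemma pushout_compat w w' : pushout_rel w w' -> pcopair w = pcopair w'.
Proof. by move=> [c [-> ->]] /=; exact: uv. Qed.

Definition po_lift : {pmap pushout -> Z} := plift pushout_compat.

Lemma po_lift_l a : po_lift (po_l a) = u a.
Proof. exact: (pliftE pushout_compat (inl a)). Qed.

Lemma po_lift_r b : po_lift (po_r b) = v b.
Proof. exact: (pliftE pushout_compat (inr b)). Qed.

End Copair.
End Pushout.

(* left half-smash of A and B: (a, pt) ~ pt in A x B *)
Section HalfSmash.

Definition hsmash_rel (A B : ptopologicalType) (x y : A * B) :=
  x.2 = point /\ y = point.

Definition hsmash (A B : ptopologicalType) : ptopologicalType :=
  pquot (@hsmash_rel A B).

Context (A A' B B' : ptopologicalType).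

Lemma hsmash_map_compat (s : {pmap A -> A'}) (g : {pmap B -> B'}) x y :
  hsmash_rel x y ->
  (ppi (@hsmash_rel A' B') \po (s \px g)) x =
  (ppi (@hsmash_rel A' B') \po (s \px g)) y.
Proof.
move=> [x2 ->]; rewrite [RHS]pmap_pt -[RHS](pmap_pt (ppi (@hsmash_rel A' B'))).
by apply: ppi_eq; split => //=; rewrite x2 pmap_pt.
Qed.

Definition hsmash_map (s : {pmap A -> A'}) (g : {pmap B -> B'}) :
    {pmap hsmash A B -> hsmash A' B'} :=
  plift (@hsmash_map_compat s g).

End HalfSmash.
End Quotients.


Section Subspaces.
Context (T : topologicalType) (A : set T) (a : T) (Aa : A a).

Definition psub_type : Type := let _ := Aa in set_type A.
HB.instance Definition _ := Topological.copy psub_type (set_type A).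
HB.instance Definition _ :=
  isPointed.Build psub_type (exist _ a (mem_set Aa) : set_type A).

Definition psub : ptopologicalType := psub_type.

Definition psub_val (x : psub) : T := sval x.

Definition psub_in (x : T) (Ax : A x) : psub := exist _ x (mem_set Ax).

Lemma psub_valP (x : psub) : A (psub_val x).
Proof. by case: x => x /= /set_mem. Qed.

Lemma psub_val_inj : injective psub_val.
Proof. by move=> x y; exact: eq_sig_hprop. Qed.

Lemma psub_val_cts : continuous psub_val.
Proof. exact: (@initial_continuous (set_type A) T set_val). Qed.

Lemma psub_cts (S : topologicalType) (f : S -> psub) :
  continuous (fun s => psub_val (f s)) -> continuous f.
Proof. exact: (@continuous_comp_initial (set_type A) S T set_val). Qed.

End Subspaces.

Section UnitInterval.
Context (R : realType).

Lemma unitI_0 : `[0, 1]%classic (0 : R).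
Proof. by rewrite /= in_itv /= lexx ler01. Qed.

Lemma unitI_1 : `[0, 1]%classic (1 : R).
Proof. by rewrite /= in_itv /= lexx ler01. Qed.

Definition unitI : ptopologicalType := psub unitI_0.

Definition I0 : unitI := psub_in unitI_0 unitI_0.
Definition I1 : unitI := psub_in unitI_0 unitI_1.

Lemma I0E : psub_val I0 = 0. Proof. by []. Qed.

Lemma I1E : psub_val I1 = 1. Proof. by []. Qed.

Lemma clampP (x : R) : `[0, 1]%classic (Num.max 0 (Num.min 1 x)).
Proof. by rewrite /= in_itv /= le_max lexx /= ge_max ler01 ge_min lexx. Qed.

(* the nearest point of [0, 1] *)
Definition clamp (x : R) : unitI := psub_in unitI_0 (clampP x).

Lemma clampE (x : R) : 0 <= x <= 1 -> psub_val (clamp x) = x.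
Proof. by case/andP=> x0 x1; rewrite /= min_r // max_r. Qed.

Lemma clampK (t : unitI) : clamp (psub_val t) = t.
Proof.
apply: psub_val_inj; rewrite clampE //.
by have := psub_valP t; rewrite /= in_itv.
Qed.

Lemma clamp0 : clamp 0 = I0.
Proof. by apply: psub_val_inj; rewrite clampE // lexx ler01. Qed.

Lemma clamp1 : clamp 1 = I1.
Proof. by apply: psub_val_inj; rewrite clampE // lexx ler01. Qed.

Lemma clamp_cts : continuous clamp.
Proof.
apply: psub_cts => x /=.
apply: (@continuous_max R R (cst 0) (fun x => Num.min 1 x)).
- exact: cvg_cst.
- by apply: (@continuous_min R R (cst 1) id); [exact: cvg_cst|exact: cvg_id].
Qed.

Lemma unitI_compact : compact [set: unitI].
Proof.
have -> : [set: unitI] = clamp @` `[0, 1]%classic.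
  by rewrite eqEsubset; split=> // t _; exists (psub_val t);
    [exact: psub_valP|exact: clampK].
apply: continuous_compact; last exact: segment_compact.
exact/continuous_subspaceT/clamp_cts.
Qed.

Lemma unitI_hausdorff : hausdorff_space unitI.
Proof.
rewrite open_hausdorff => s t st.
have := @Rhausdorff R; rewrite open_hausdorff.
case/(_ (psub_val s) (psub_val t)).
  by apply: contra_neq st; exact: psub_val_inj.
move=> [U V] /= [Us Vt] [oU oV UV].
have /continuousP cval := @psub_val_cts _ _ _ unitI_0.
exists (@psub_val _ _ _ unitI_0 @^-1` U, @psub_val _ _ _ unitI_0 @^-1` V).
  by rewrite !inE /= in Us Vt *.
split; [exact: cval|exact: cval|].
by apply/eqP; rewrite -preimage_setI (eqP UV) preimage_set0.
Qed.

Lemma unitI_locally_compact : locally_compact [set: unitI].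
Proof.
move=> t _; exists setT; first by rewrite withinET; exact: filterT.
split; [exact: unitI_compact|exact: closedT].
Qed.

Lemma unitI_regular : regular_space unitI.
Proof.
move=> t; apply: (compact_regular unitI_hausdorff unitI_compact).
exact: filterT.
Qed.

End UnitInterval.

Section PathSpaces.
Context (R : realType).
Local Notation I := (unitI R).

Definition free_path (Z : ptopologicalType) : Type := continuousType I Z.

HB.instance Definition _ (Z : ptopologicalType) :=
  Choice.copy (free_path Z) (continuousType I Z).
HB.instance Definition _ (Z : ptopologicalType) :=
  Topological.copy (free_path Z)
    (@initial_topology (continuousType I Z) {compact-open, I -> Z}
       (fun w => w : I -> Z)).

Definition path_at (Z : ptopologicalType) (w : free_path Z) : I -> Z :=
  (w : continuousType I Z).
Coercion path_at : free_path >-> Funclass.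

Lemma path_cts (Z : ptopologicalType) (w : free_path Z) : continuous w.
Proof. exact: (@cts_fun _ _ (w : continuousType I Z)). Qed.

Lemma free_path_eq (Z : ptopologicalType) (w w' : free_path Z) :
  w =1 w' -> w = w'.
Proof. by move=> ww'; apply/continuousEP. Qed.

Definition mkpath (Z : ptopologicalType) (w : I -> Z) (cw : continuous w) :
  free_path Z := (mkcts cw : continuousType I Z).

Lemma path_eval_cts (Z : ptopologicalType) :
  continuous (fun p : free_path Z * I => p.1 p.2).
Proof.
have -> : (fun p : free_path Z * I => p.1 p.2) =
    uncurry (@path_at Z : free_path Z -> I -> Z) by apply/funext => -[].
apply: continuous_uncurry_regular.
- exact: unitI_locally_compact.
- exact: unitI_regular.
- exact: (@initial_continuous (continuousType I Z) {compact-open, I -> Z}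
    (fun w => w : I -> Z)).
- exact: path_cts.
Qed.

Lemma path_app_cts (T : topologicalType) (Z : ptopologicalType)
    (w : T -> free_path Z) (s : T -> I) :
  continuous w -> continuous s -> continuous (fun t => w t (s t)).
Proof.
move=> cw cs.
apply: (@comp_cts T (free_path Z * I)%type Z (fun t => (w t, s t))
  (fun p => p.1 p.2)); last exact: path_eval_cts.
exact: pair_cts.
Qed.

(* exponential law: a map T x I -> Z yields a map T -> Z^I *)
Section Currying.
Context (T : topologicalType) (Z : ptopologicalType) (F : T -> I -> Z).
Hypothesis cF : continuous (fun p : T * I => F p.1 p.2).

Lemma curry_path_cts t : continuous (F t).
Proof.
apply: (@comp_cts _ _ _ (fun s => (t, s)) _ _ cF).
by apply: (@pair_cts I T I (fun=> t) id); [exact: cst_cts|exact: id_cts].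
Qed.

Definition curry_path (t : T) : free_path Z := mkpath (curry_path_cts (t := t)).

Lemma curry_pathE t s : curry_path t s = F t s.
Proof. by []. Qed.

Lemma curry_pathP : continuous curry_path.
Proof.
apply: (@continuous_comp_initial (continuousType I Z) T {compact-open, I -> Z}
  (fun w => w : I -> Z)).
exact: (continuous_curry_fun cF).
Qed.

End Currying.
End PathSpaces.

Section HomotopyTheory.
Context (R : realType).
Local Notation I := (unitI R).

Definition path_connected (X : ptopologicalType) : Prop :=
  forall x y : X, exists w : free_path R X, w (I0 R) = x /\ w (I1 R) = y.

Definition phomotopic (X Y : ptopologicalType) (f g : {pmap X -> Y}) : Prop :=
  exists H : X * I -> Y,
    [/\ continuous H,
        forall x, H (x, I0 R) = f x,
        forall x, H (x, I1 R) = g x &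
        forall t, H (point, t) = point].

Definition homotopy_inverse (X Y : ptopologicalType)
    (f : {pmap X -> Y}) (g : {pmap Y -> X}) : Prop :=
  phomotopic (g \po f) (pidm X) /\ phomotopic (f \po g) (pidm Y).

Definition homotopy_equivalence (X Y : ptopologicalType)
    (f : {pmap X -> Y}) : Prop :=
  exists g : {pmap Y -> X}, homotopy_inverse f g.

(* reduced cone: (x, 0) ~ pt and (pt, t) ~ pt, with X included at t = 1 *)
Definition cone_rel (X : ptopologicalType) (x y : X * I) :=
  (x.2 = I0 R \/ x.1 = point) /\ y = point.

Definition cone (X : ptopologicalType) : ptopologicalType :=
  pquot (@cone_rel X).

Program Definition cone_in (X : ptopologicalType) : {pmap X -> cone X} :=
  @PMap X (cone X) (fun x => ppi (@cone_rel X) (x, I1 R)) _ _.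
Next Obligation.
move=> X; apply: (@comp_cts X (X * I)%type (cone X) (fun x => (x, I1 R))).
- by apply: pair_cts; [exact: id_cts|exact: cst_cts].
- exact: pmap_cts.
Qed.
Next Obligation.
move=> X; rewrite -[RHS](pmap_pt (ppi (@cone_rel X))).
by apply: ppi_eq; split => //=; right.
Qed.

Definition mapping_cone (A Y : ptopologicalType) (f : {pmap A -> Y}) :
  ptopologicalType := pushout f (cone_in A).

Definition mcone_base (A Y : ptopologicalType) (f : {pmap A -> Y}) :
  {pmap Y -> mapping_cone f} := po_l f (cone_in A).

Definition mcone_cone (A Y : ptopologicalType) (f : {pmap A -> Y}) :
  {pmap cone A -> mapping_cone f} := po_r f (cone_in A).

(* X -u-> Y -v-> W is a homotopy cofibration if, compatibly with v up to
   homotopy, W is homotopy equivalent to the mapping cone of u. *)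
Definition homotopy_cofibration (X Y W : ptopologicalType)
    (u : {pmap X -> Y}) (v : {pmap Y -> W}) : Prop :=
  exists e : {pmap mapping_cone u -> W},
    homotopy_equivalence e /\ phomotopic (e \po mcone_base u) v.

End HomotopyTheory.

Section LoopSpaces.
Context (R : realType).
Local Notation I := (unitI R).

Definition cst_path (Z : ptopologicalType) : free_path R Z :=
  mkpath (@cst_cts I Z point).

Lemma path_set_cst (Z : ptopologicalType) :
  [set w : free_path R Z | w (I0 R) = point] (cst_path Z).
Proof. by []. Qed.

Lemma loop_set_cst (Z : ptopologicalType) :
  [set w : free_path R Z | w (I0 R) = point /\ w (I1 R) = point] (cst_path Z).
Proof. by []. Qed.

Definition path_space (Z : ptopologicalType) : ptopologicalType :=
  psub (@path_set_cst Z).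

Definition loop (Z : ptopologicalType) : ptopologicalType :=
  psub (@loop_set_cst Z).

Lemma loop0 (Z : ptopologicalType) (c : loop Z) : psub_val c (I0 R) = point.
Proof. by have [] := psub_valP c. Qed.

Lemma loop1 (Z : ptopologicalType) (c : loop Z) : psub_val c (I1 R) = point.
Proof. by have [] := psub_valP c. Qed.

Program Definition loop_path (Z : ptopologicalType) :
    {pmap loop Z -> path_space Z} :=
  @PMap (loop Z) (path_space Z)
    (fun c => psub_in (@path_set_cst Z) (x := psub_val c) (loop0 c)) _ _.
Next Obligation. by move=> Z; apply: psub_cts; exact: psub_val_cts. Qed.
Next Obligation. by move=> Z; apply: psub_val_inj. Qed.

Section Maps.
Context (B Z : ptopologicalType) (h : {pmap B -> Z}).

Lemma loop_map_uncurry_cts :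
  continuous (fun p : loop B * I => h (psub_val p.1 p.2)).
Proof.
apply: (@comp_cts (loop B * I)%type B Z _ h); last exact: pmap_cts.
apply: path_app_cts; last exact: snd_cts.
by apply: comp_cts; [exact: fst_cts|exact: psub_val_cts].
Qed.

Definition loop_map_path (c : loop B) : free_path R Z :=
  curry_path (F := fun (c : loop B) s => h (psub_val c s)) loop_map_uncurry_cts c.

Lemma loop_map_loop (c : loop B) :
  loop_map_path c (I0 R) = point /\ loop_map_path c (I1 R) = point.
Proof.
split; rewrite -(pmap_pt h) /path_at /=; congr (h _); [exact: loop0|exact: loop1].
Qed.

Program Definition loop_map : {pmap loop B -> loop Z} :=
  @PMap (loop B) (loop Z)
    (fun c => psub_in (@loop_set_cst Z) (loop_map_loop c)) _ _.
Next Obligation. by apply: psub_cts; exact: curry_pathP. Qed.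
Next Obligation.
by apply: psub_val_inj; apply: free_path_eq => s; exact: (pmap_pt h).
Qed.

End Maps.

Section PrincipalFibration.
Context (B Z : ptopologicalType) (h : {pmap B -> Z}).

Lemma pfib_pt :
  [set e : B * path_space Z | psub_val e.2 (I1 R) = h e.1] point.
Proof. by rewrite /= pmap_pt. Qed.

Definition pfib : ptopologicalType := psub pfib_pt.

Definition pfib_in (b : B) (w : path_space Z) (e : psub_val w (I1 R) = h b) :
  pfib := psub_in pfib_pt (x := (b, w)) e.

Lemma pfibP (e : pfib) : psub_val (psub_val e).2 (I1 R) = h (psub_val e).1.
Proof. exact: (psub_valP e). Qed.

Program Definition pfib_proj : {pmap pfib -> B} :=
  @PMap pfib B (fun e => (psub_val e).1) _ _.
Next Obligation.
by apply: comp_cts; [exact: psub_val_cts|exact: fst_cts].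
Qed.
Next Obligation. by []. Qed.

Lemma fib_in_subproof (c : loop Z) : psub_val (loop_path Z c) (I1 R) = h point.
Proof. by rewrite pmap_pt; exact: loop1. Qed.

Program Definition fib_in : {pmap loop Z -> pfib} :=
  @PMap (loop Z) pfib (fun c => pfib_in (fib_in_subproof c)) _ _.
Next Obligation.
apply: psub_cts; apply: pair_cts; first exact: cst_cts.
by apply: psub_cts; exact: psub_val_cts.
Qed.
Next Obligation.
by apply: psub_val_inj; congr pair; exact: (pmap_pt (loop_path Z)).
Qed.

(* w o c : first c, then w *)
Definition concat_fun (p : loop Z * path_space Z) (s : I) : Z :=
  if psub_val s <= 2^-1 then psub_val p.1 (clamp (2 * psub_val s))
  else psub_val p.2 (clamp (2 * psub_val s - 1)).

Let U := ((loop Z * path_space Z) * I)%type.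

Let half_cts (a b : R) : continuous (fun p : U => clamp (a * psub_val p.2 + b)).
Proof.
apply: (@comp_cts U R I (fun p => a * psub_val p.2 + b)); last exact: clamp_cts.
have cs : continuous (fun p : U => psub_val p.2 : R).
  by apply: comp_cts; [exact: snd_cts|exact: psub_val_cts].
move=> p; apply: cvgD; last exact: cvg_cst.
by apply: cvgM; [exact: cvg_cst|exact: cs].
Qed.

Lemma concat_uncurry_cts : continuous (fun p : U => concat_fun p.1 p.2).
Proof.
pose s (p : U) : R := psub_val p.2.
have cs : continuous s.
  by apply: comp_cts; [exact: snd_cts|exact: psub_val_cts].
pose A := [set p : U | s p <= 2^-1].
pose C := [set p : U | 2^-1 <= s p].
have cA : closed A.
  by apply: (@preimage_closed _ _ s [set x | x <= 2^-1]);
    [move=> x _; exact: cs|exact: closed_le].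
have cC : closed C.
  by apply: (@preimage_closed _ _ s [set x | 2^-1 <= x]);
    [move=> x _; exact: cs|exact: closed_ge].
have AC : A `|` C = [set: U].
  by rewrite eqEsubset; split=> // p _; rewrite /A /C /=;
    case: (leP (s p) 2^-1) => [|/ltW]; [left|right].
pose f (p : U) := psub_val p.1.1 (clamp (2 * psub_val p.2 + 0)) : Z.
pose g (p : U) := psub_val p.1.2 (clamp (2 * psub_val p.2 - 1)) : Z.
have cf : continuous f.
  apply: path_app_cts; last exact: half_cts.
  apply: (@comp_cts U (loop Z * path_space Z)%type (free_path R Z) fst
    (fun x => psub_val x.1)); first exact: fst_cts.
  by apply: comp_cts; [exact: fst_cts|exact: psub_val_cts].
have cg : continuous g.
  apply: path_app_cts; last exact: half_cts.
  apply: (@comp_cts U (loop Z * path_space Z)%type (free_path R Z) fst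
    (fun x => psub_val x.2)); first exact: fst_cts.
  by apply: comp_cts; [exact: snd_cts|exact: psub_val_cts].
rewrite continuous_subspace_setT -AC.
apply: withinU_continuous => //.
- apply: (@subspace_eq_continuous _ _ _ f); last exact: continuous_subspaceT.
  by move=> p /set_mem pA; rewrite /from_subspace /f /concat_fun addr0 ifT.
- apply: (@subspace_eq_continuous _ _ _ g); last exact: continuous_subspaceT.
  move=> p /set_mem pC; rewrite /from_subspace /g /concat_fun; case: ifPn => // pA.
  have -> : psub_val p.2 = 2^-1 :> R by apply/le_anti; rewrite pA.
  rewrite divff ?pnatr_eq0 // subrr clamp0 clamp1 loop1.
  exact: (psub_valP p.1.2).
Qed.

Definition concat_path : loop Z * path_space Z -> free_path R Z :=
  curry_path concat_uncurry_cts.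

Lemma concat_path0 p : concat_path p (I0 R) = point.
Proof.
rewrite /concat_path curry_pathE /concat_fun I0E invr_ge0 ler0n mulr0 clamp0; exact: loop0.
Qed.

Lemma concat_path1 p : concat_path p (I1 R) = psub_val p.2 (I1 R).
Proof.
rewrite /concat_path curry_pathE /concat_fun I1E ifN.
  by rewrite mulr1 (_ : 2 - 1 = 1) ?clamp1 // addrK.
by rewrite -ltNge invf_lt1 ?ltr1n ?ltr0n.
Qed.

Program Definition concat : {pmap (loop Z * path_space Z)%type -> path_space Z} :=
  @PMap (loop Z * path_space Z)%type (path_space Z)
    (fun p => psub_in (@path_set_cst Z) (concat_path0 p)) _ _.
Next Obligation. by apply: psub_cts; exact: curry_pathP. Qed.
Next Obligation.
apply: psub_val_inj; apply: free_path_eq => s.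
rewrite [LHS]curry_pathE /concat_fun; by case: ifP.
Qed.

Lemma action_subproof (p : loop Z * pfib) :
  psub_val (concat (p.1, (psub_val p.2).2)) (I1 R) = h (psub_val p.2).1.
Proof. by rewrite -pfibP; exact: concat_path1. Qed.

(* (c, (b, w)) |-> (b, w o c) *)
Program Definition concat_action : {pmap (loop Z * pfib)%type -> pfib} :=
  @PMap (loop Z * pfib)%type pfib (fun p => pfib_in (action_subproof p)) _ _.
Next Obligation.
have cE : continuous (fun p : loop Z * pfib => psub_val p.2 : B * path_space Z).
  by apply: comp_cts; [exact: snd_cts|exact: psub_val_cts].
apply: psub_cts; apply: pair_cts.
  by apply: comp_cts; [exact: cE|exact: fst_cts].
apply: (@comp_cts _ (loop Z * path_space Z)%type _
  (fun p : loop Z * pfib => (p.1, (psub_val p.2).2))); last exact: pmap_cts.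
apply: pair_cts; first exact: fst_cts.
by apply: comp_cts; [exact: cE|exact: snd_cts].
Qed.
Next Obligation.
by apply: psub_val_inj; congr pair; exact: (pmap_pt concat).
Qed.

(* Concatenation satisfies a(c, pt) = i(c) only up to reparametrization.  The
   action used below is any map in the homotopy class of concat_action whose
   restriction to Omega Z is i on the nose; this is what makes theta and Kcone
   agree strictly on Omega B. *)
Record principal_action := PrincipalAction {
  paction_map :> {pmap (loop Z * pfib)%type -> pfib};
  paction_homotopic : phomotopic R paction_map concat_action;
  paction_unit : forall c, paction_map (c, point) = fib_in c }.

Definition theta (a : principal_action) : {pmap (loop B * pfib)%type -> pfib} :=
  a \po (loop_map h \px pidm pfib).

Lemma K_uncurry_cts : continuous
  (fun p : (loop B * I) * I =>
     h (psub_val p.1.1 (clamp (psub_val p.1.2 * psub_val p.2)))).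
Proof.
apply: (@comp_cts _ B Z _ h); last exact: pmap_cts.
apply: path_app_cts.
  apply: (@comp_cts _ (loop B * I)%type (free_path R B) fst
    (fun x => psub_val x.1)); first exact: fst_cts.
  by apply: comp_cts; [exact: fst_cts|exact: psub_val_cts].
apply: (@comp_cts _ R I (fun p : (loop B * I) * I =>
  psub_val p.1.2 * psub_val p.2)); last exact: clamp_cts.
move=> p; apply: cvgM.
  apply: (@comp_cts _ (loop B * I)%type R fst (fun x => psub_val x.2)).
    exact: fst_cts.
  by apply: comp_cts; [exact: snd_cts|exact: psub_val_cts].
by apply: (@comp_cts _ I R snd (@psub_val _ _ _ _));
  [exact: snd_cts|exact: psub_val_cts].
Qed.

Definition K_path : loop B * I -> free_path R Z :=
  curry_path (F := fun (p : loop B * I) s =>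
    h (psub_val p.1 (clamp (psub_val p.2 * psub_val s)))) K_uncurry_cts.

Lemma K_path0 p : K_path p (I0 R) = point.
Proof. by rewrite /K_path curry_pathE I0E mulr0 clamp0 loop0 pmap_pt. Qed.

Lemma K_path1 p :
  psub_val (psub_in (@path_set_cst Z) (K_path0 p)) (I1 R) = h (psub_val p.1 p.2).
Proof. by rewrite -[LHS]/(h (psub_val p.1 (clamp _))) I1E mulr1 clampK. Qed.

(* (c, t) |-> (c t, h o c_t) with c_t s = c (s t) *)
Program Definition Kcyl : {pmap (loop B * I)%type -> pfib} :=
  @PMap (loop B * I)%type pfib (fun p => pfib_in (K_path1 p)) _ _.
Next Obligation.
apply: psub_cts; apply: pair_cts; last by apply: psub_cts; exact: curry_pathP.
apply: path_app_cts; last exact: snd_cts.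
by apply: comp_cts; [exact: fst_cts|exact: psub_val_cts].
Qed.
Next Obligation.
apply: psub_val_inj; congr pair; apply: psub_val_inj; apply: free_path_eq => s.
exact: (pmap_pt h).
Qed.

Lemma Kcone_compat (x y : loop B * I) : @cone_rel R (loop B) x y -> Kcyl x = Kcyl y.
Proof.
case: x => c t [ct ->]; rewrite [RHS](pmap_pt Kcyl); rewrite /= in ct.
apply: psub_val_inj; congr pair; last first.
  apply: psub_val_inj; apply: free_path_eq => s;
    rewrite -[LHS]/(h (psub_val c (clamp _))).
  case: ct => /= ->; last exact: (pmap_pt h).
  by rewrite I0E mul0r clamp0 loop0 pmap_pt.
by case: ct => /= ->; first exact: loop0.
Qed.

Definition Kcone : {pmap cone R (loop B) -> pfib} := plift Kcone_compat.

Lemma Gamma_compat (a : principal_action) (c : loop B) :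
  Kcone (cone_in R (loop B) c) = theta a (pinl (loop B) pfib c).
Proof.
rewrite [LHS](pliftE Kcone_compat (c, I1 R)).
transitivity (fib_in (loop_map h c)); last exact/esym/(paction_unit a).
apply: psub_val_inj; congr pair; first exact: loop1.
apply: psub_val_inj; apply: free_path_eq => s.
by rewrite -[LHS]/(h (psub_val c (clamp _))) I1E mul1r clampK.
Qed.

(* C(Omega B) u (Omega B x E), glued along c = (c, pt) *)
Definition Gamma_dom : ptopologicalType :=
  pushout (cone_in R (loop B)) (pinl (loop B) pfib).

Definition Gamma (a : principal_action) : {pmap Gamma_dom -> pfib} :=
  po_lift (Gamma_compat a).

Program Definition pcst (X Y : ptopologicalType) : {pmap X -> Y} :=
  @PMap X Y (fun=> point) (@cst_cts X Y point) erefl.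

Lemma collapse_compat (c : loop B) :
  pcst (cone R (loop B)) (hsmash (loop B) pfib) (cone_in R (loop B) c) =
  ppi (@hsmash_rel (loop B) pfib) (pinl (loop B) pfib c).
Proof.
rewrite -[LHS](pmap_pt (ppi (@hsmash_rel (loop B) pfib))).
by apply/esym/ppi_eq; split.
Qed.

(* The cone goes to the base point; eps below stands for a pointed homotopy
   inverse of this map. *)
Definition collapse : {pmap Gamma_dom -> hsmash (loop B) pfib} :=
  po_lift collapse_compat.

Definition Gamma_bar (a : principal_action)
    (eps : {pmap hsmash (loop B) pfib -> Gamma_dom}) : {pmap hsmash (loop B) pfib -> pfib} :=
  Gamma a \po eps.

End PrincipalFibration.

Section Pullback.
Context (B B' Z : ptopologicalType) (phi : {pmap B' -> Z}) (j : {pmap B -> B'}).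

Lemma pfib_pull_subproof (e : pfib (phi \po j)) :
  psub_val (psub_val e).2 (I1 R) = phi (j (psub_val e).1).
Proof. exact: pfibP. Qed.

(* (b, w) |-> (j b, w) *)
Program Definition pfib_pull : {pmap pfib (phi \po j) -> pfib phi} :=
  @PMap (pfib (phi \po j)) (pfib phi)
    (fun e => pfib_in (pfib_pull_subproof e)) _ _.
Next Obligation.
apply: psub_cts; apply: pair_cts.
- apply: (@comp_cts _ B B' (pfib_proj (phi \po j))); exact: pmap_cts.
- by apply: comp_cts; [exact: psub_val_cts|exact: snd_cts].
Qed.
Next Obligation. by apply: psub_val_inj; congr pair; exact: (pmap_pt j). Qed.

(* The fibration induced by phi o j is the pullback along j of the one induced
   by phi, with pfib_pull as the canonical map. *)
Lemma pfib_pullback (X : ptopologicalType)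
    (u : {pmap X -> B}) (v : {pmap X -> pfib phi}) :
  (forall x, j (u x) = pfib_proj phi (v x)) ->
  exists! w : {pmap X -> pfib (phi \po j)},
    (forall x, pfib_proj (phi \po j) (w x) = u x) /\
    (forall x, pfib_pull (w x) = v x).
Proof.
move=> uv.
have wP x : psub_val (psub_val (v x)).2 (I1 R) = (phi \po j) (u x).
  by rewrite pfibP /= uv.
pose w0 x := pfib_in (wP x).
have cw : continuous w0.
  apply: psub_cts; apply: pair_cts; first exact: pmap_cts.
  apply: (@comp_cts X (B' * path_space Z)%type (path_space Z)
    (fun x => psub_val (v x))); last exact: snd_cts.
  by apply: comp_cts; [exact: pmap_cts|exact: psub_val_cts].
have w0pt : w0 point = point.
  by apply: psub_val_inj; congr pair; rewrite ?pmap_pt.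
exists (PMap cw w0pt); split.
  split=> // x; apply: psub_val_inj; apply: injective_projections => //.
  exact: uv.
move=> w' [w'u w'v]; apply: pmap_eqP => x; apply: psub_val_inj => /=.
by rewrite -w'u -w'v -surjective_pairing.
Qed.

End Pullback.

End LoopSpaces.

Section CWComplexes.
Context (R : realType).

Definition disk (n : nat) : set 'rV[R]_n := [set x | \sum_i x 0 i ^+ 2 <= 1].
Arguments disk : clear implicits.

Definition open_disk (n : nat) (x : disk n) : Prop :=
  \sum_i (set_val x) 0 i ^+ 2 < 1.

(* A CW structure with finitely many cells in each dimension, given by its
   characteristic maps; the base point is a vertex.  As W is Hausdorff and the
   boundary of a cell lies in open cells of lower dimension, injectivity on the
   open disk makes each characteristic map a homeomorphism from the open disk
   onto the open cell.  Closure finiteness is automatic. *)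
Record finite_type_CW (W : ptopologicalType) := FiniteTypeCW {
  ncell : nat -> nat;
  cw_char : forall n, 'I_(ncell n) -> disk n -> W;
  cw_hausdorff : hausdorff_space W;
  cw_char_cts : forall n (i : 'I_(ncell n)), continuous (cw_char i);
  cw_cover : forall w : W, exists n (i : 'I_(ncell n)) (x : disk n),
    open_disk x /\ cw_char i x = w;
  cw_inj : forall n (i : 'I_(ncell n)) (x : disk n)
                  m (j : 'I_(ncell m)) (y : disk m),
    open_disk x -> open_disk y -> cw_char i x = cw_char j y ->
    existT (fun k => ('I_(ncell k) * disk k)%type) n (i, x) =
    existT (fun k => ('I_(ncell k) * disk k)%type) m (j, y);
  cw_boundary : forall n (i : 'I_(ncell n)) (x : disk n), ~ open_disk x ->
    exists m (j : 'I_(ncell m)) (y : disk m),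
      [/\ (m < n)%N, open_disk y & cw_char i x = cw_char j y];
  cw_weak : forall C : set W,
    (forall n (i : 'I_(ncell n)), closed (cw_char i @^-1` C)) -> closed C;
  cw_vertex : exists (i : 'I_(ncell 0)) (x : disk 0), cw_char i x = point }.

Definition has_finite_CW_type (X : ptopologicalType) : Prop :=
  exists (W : ptopologicalType) (_ : finite_type_CW W) (e : {pmap X -> W}),
    homotopy_equivalence R e.

End CWComplexes.

(* (G, g) is a map of pairs (CA, A) -> (E', E) over (Y u_f CA, Y), lifting the
   canonical map (CA, A) -> (Y u_f CA, Y), which is f on A. *)
Definition cone_pair_lift (R : realType) (A Y Z : ptopologicalType)
    (f : {pmap A -> Y}) (phi : {pmap mapping_cone R f -> Z})
    (G : {pmap cone R A -> pfib R phi})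
    (g : {pmap A -> pfib R (phi \po mcone_base R f)}) : Prop :=
  [/\ forall x, G (cone_in R A x) = pfib_pull R phi (mcone_base R f) (g x),
      forall c, pfib_proj R phi (G c) = mcone_cone R f c &
      forall x, pfib_proj R (phi \po mcone_base R f) (g x) = f x].

(* Main.v *)
(** Write T for the loop space of Z, and let N be a mapping cone of f with a
    topology coarse enough to be covered by two open sets, one deforming to Y and
    one to the apex, whose intersection deforms to A.  Over these sets the
    homotopy fibre W of N -> Z is E, T and T x A, so W is the homotopy pushout of
    E <- T x A -> T, where the first map is (c, a) |-> g(a) o c; and W is
    equivalent to E'.  The homotopy pushout of T |x A <- T x A -> T being
    contractible, the mapping cone of any map u : T |x A -> E is the homotopy
    pushout of E <- T x A -> T along the composite of u with T x A -> T |x A.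
    For the map of the theorem this composite is homotopic to
    (c, a) |-> a(Omega h (s c), g a), hence to (c, a) |-> g(a) o c.
    The contractibility holds because the inclusion of the base point of A is a
    cofibration up to homotopy: a CW complex X has a retraction of X x I onto
    the union of X x 0 and pt x I, constructed cell by cell. *)

Require Import Defs.
From HB Require Import structures.
From mathcomp Require Import all_boot all_order all_algebra.
From mathcomp Require Import all_classical all_reals all_analysis.
From mathcomp Require Import lra.
From Stdlib Require Setoid.

Set Implicit Arguments.
Unset Strict Implicit.
Unset Printing Implicit Defensive.

Import Order.TTheory GRing.Theory Num.Theory.
Import numFieldNormedType.Exports.
Local Open Scope classical_set_scope.
Local Open Scope ring_scope.

(** * Homotopies and their groupoid laws *)

(** Products carry the plain product topology, and a quotient map times a loop space need not be a
    quotient map; so the presentation of the mapping cone as a quotient does not pass to the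
    fibration over it. Pieces over the base are therefore glued only along open sets, and homotopies
    out of a quotient are built as maps into path spaces. The reduced cone has no height function,
    as all (pt, t) are identified; this forces the unreduced [coarse_cone]. Its map [cc_collapse] to
    the mapping cone of f is an equivalence by the same [cone_recognition] that later compares the
    cone of u with W, a one-point space taking the place of T. A homotopy pushout is encoded by its
    universal property up to homotopy, which avoids choosing a model. Existence supplies the map
    from W to the cone, uniqueness one of the two inverse laws. E and W are pointed there while T x
    A and T are not: the segment of the coarse cone above the base point of A is not collapsed, so
    the comparison homotopies over T x A cannot be pointed. *)

Section Glue.
Context (R : realType).

Lemma addR_cts (X : topologicalType) (f g : X -> R) :
  continuous f -> continuous g -> continuous (fun x => f x + g x).
Proof. by move=> cf cg x; apply: cvgD; [exact: cf|exact: cg]. Qed.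

Lemma mulR_cts (X : topologicalType) (f g : X -> R) :
  continuous f -> continuous g -> continuous (fun x => f x * g x).
Proof. by move=> cf cg x; apply: cvgM; [exact: cf|exact: cg]. Qed.

Lemma oppR_cts (X : topologicalType) (f : X -> R) :
  continuous f -> continuous (fun x => - f x).
Proof. by move=> cf x; apply: cvgN; exact: cf. Qed.

Lemma subR_cts (X : topologicalType) (f g : X -> R) :
  continuous f -> continuous g -> continuous (fun x => f x - g x).
Proof. by move=> cf cg; apply: addR_cts => //; exact: oppR_cts. Qed.

Lemma maxR_cts (X : topologicalType) (f g : X -> R) :
  continuous f -> continuous g -> continuous (fun x => Num.max (f x) (g x)).
Proof. by move=> cf cg x; apply: (@continuous_max R X f g); [exact: cf|exact: cg]. Qed.

Lemma minR_cts (X : topologicalType) (f g : X -> R) :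
  continuous f -> continuous g -> continuous (fun x => Num.min (f x) (g x)).
Proof. by move=> cf cg x; apply: (@continuous_min R X f g); [exact: cf|exact: cg]. Qed.

Lemma glue_le (X S : topologicalType) (a b : X -> R) (f g : X -> S) :
  continuous a -> continuous b -> continuous f -> continuous g ->
  (forall x, a x = b x -> f x = g x) ->
  continuous (fun x => if a x <= b x then f x else g x).
Proof.
move=> ca cb cf cg fg.
have cd : continuous (fun x => b x - a x) by exact: subR_cts.
have cA : closed [set x | 0 <= b x - a x].
  by apply: (@preimage_closed _ _ (fun x => b x - a x) [set y | 0 <= y]);
    [move=> x _; exact: cd|exact: closed_ge].
have cB : closed [set x | b x - a x <= 0].
  by apply: (@preimage_closed _ _ (fun x => b x - a x) [set y | y <= 0]);
    [move=> x _; exact: cd|exact: closed_le].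
have AB : [set x | 0 <= b x - a x] `|` [set x | b x - a x <= 0] = [set: X].
  rewrite eqEsubset; split=> // x _ /=.
  by case: (leP 0 (b x - a x)) => [|/ltW]; [left|right].
rewrite continuous_subspace_setT -AB; apply: withinU_continuous => //.
- apply: (@subspace_eq_continuous _ _ _ f); last exact: continuous_subspaceT.
  by move=> x /set_mem /= xA; rewrite /from_subspace ifT // -subr_ge0.
- apply: (@subspace_eq_continuous _ _ _ g); last exact: continuous_subspaceT.
  move=> x /set_mem /= xB; rewrite /from_subspace; case: ifPn => // ab.
  by apply/esym/fg/le_anti; rewrite ab -subr_le0.
Qed.

End Glue.

Ltac cts_step :=
  lazymatch goal with
  | |- continuous (fun x => x) => exact: id_cts
  | |- continuous fst => exact: fst_cts
  | |- continuous snd => exact: snd_cts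
  | |- continuous (fun _ => ?c) => exact: cst_cts
  | |- continuous (fun x => (@?f x, @?g x)) => apply: (@pair_cts _ _ _ f g)
  | |- continuous (fun x => @GRing.add _ (@?f x) (@?g x)) => apply: (@addR_cts _ _ f g)
  | |- continuous (fun x => @GRing.mul _ (@?f x) (@?g x)) => apply: (@mulR_cts _ _ f g)
  | |- continuous (fun x => @GRing.opp _ (@?f x)) => apply: (@oppR_cts _ _ f)
  | |- continuous (fun x => @Order.max _ _ (@?f x) (@?g x)) => apply: (@maxR_cts _ _ f g)
  | |- continuous (fun x => @Order.min _ _ (@?f x) (@?g x)) => apply: (@minR_cts _ _ f g)
  | |- continuous (fun x => fst (@?f x)) =>
      apply: (@comp_cts _ _ _ f fst); last exact: fst_cts
  | |- continuous (fun x => snd (@?f x)) =>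
      apply: (@comp_cts _ _ _ f snd); last exact: snd_cts
  | |- continuous (fun x => @pfun _ _ ?g (@?f x)) =>
      apply: (@comp_cts _ _ _ f (@pfun _ _ g)); last exact: pmap_cts
  | |- continuous (fun x => ?g (@?f x)) => apply: (@comp_cts _ _ _ f g)
  | |- continuous (@pfun _ _ _) => exact: pmap_cts
  | |- continuous _ => assumption
  end.

Ltac cts := repeat cts_step.

Section Homotopies.
Context (R : realType).

(* The parameter ranges over all of [R]; a homotopy is constant outside [0, 1]
   and stationary on [D]. *)
Record htpy (X S : topologicalType) (D : set X) (f g : X -> S) := Htpy {
  hfun :> X * R -> S;
  htpy_cts : continuous hfun;
  htpy_le0 : forall x t, t <= 0 -> hfun (x, t) = f x;
  htpy_ge1 : forall x t, 1 <= t -> hfun (x, t) = g x;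
  htpy_D : forall x t, D x -> hfun (x, t) = f x }.

Section Ops.
Context (X S : topologicalType) (D : set X).
Implicit Types f g k : X -> S.

Lemma htpy_D1 f g (F : htpy D f g) x : D x -> g x = f x.
Proof. by move=> Dx; rewrite -(htpy_ge1 F x (lexx 1)) (htpy_D F). Qed.

Program Definition hcomp f g k (F : htpy D f g) (G : htpy D g k) : htpy D f k :=
  @Htpy X S D f k
    (fun z => if z.2 <= 2^-1 then F (z.1, 2 * z.2) else G (z.1, 2 * z.2 - 1))
    _ _ _ _.
Next Obligation.
move=> f g k F G; apply: glue_le; cts; try exact: htpy_cts.
move=> [x t] /= ->; rewrite htpy_ge1 ?htpy_le0 //; lra.
Qed.
Next Obligation. by move=> f g k F G x t t0 /=; rewrite ifT ?htpy_le0 //; lra. Qed.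
Next Obligation.
move=> f g k F G x t t1 /=; rewrite ifF ?htpy_ge1 //; [lra|].
by apply/negbTE; rewrite -ltNge; lra.
Qed.
Next Obligation.
move=> f g k F G x t Dx /=; case: ifP => _; rewrite htpy_D //.
exact: (htpy_D1 F).
Qed.

Lemma hcomp_l f g k (F : htpy D f g) (G : htpy D g k) x t :
  t <= 2^-1 -> hcomp F G (x, t) = F (x, 2 * t).
Proof. by move=> t2; rewrite /hcomp /= t2. Qed.

Lemma hcomp_r f g k (F : htpy D f g) (G : htpy D g k) x t :
  2^-1 < t -> hcomp F G (x, t) = G (x, 2 * t - 1).
Proof. by move=> t2; rewrite /hcomp /= leNgt t2. Qed.

Program Definition hinv f g (F : htpy D f g) : htpy D g f :=
  @Htpy X S D g f (fun z => F (z.1, 1 - z.2)) _ _ _ _.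
Next Obligation. by move=> f g F; cts; exact: htpy_cts. Qed.
Next Obligation. by move=> f g F x t t0 /=; rewrite htpy_ge1 //; lra. Qed.
Next Obligation. by move=> f g F x t t0 /=; rewrite htpy_le0 //; lra. Qed.
Next Obligation. by move=> f g F x t Dx /=; rewrite htpy_D // (htpy_D1 F). Qed.

Program Definition hid f (cf : continuous f) : htpy D f f :=
  @Htpy X S D f f (fun z => f z.1) _ _ _ _.
Next Obligation. by move=> f cf; cts. Qed.
Next Obligation. by []. Qed.
Next Obligation. by []. Qed.
Next Obligation. by []. Qed.

Program Definition hcast f g f' g' (F : htpy D f g) (ff : f =1 f') (gg : g =1 g') :
  htpy D f' g' := @Htpy X S D f' g' F _ _ _ _.
Next Obligation. by move=> f g f' g' F _ _; exact: htpy_cts. Qed.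
Next Obligation. by move=> f g f' g' F ff _ x t t0; rewrite htpy_le0 // ff. Qed.
Next Obligation. by move=> f g f' g' F _ gg x t t0; rewrite htpy_ge1 // gg. Qed.
Next Obligation. by move=> f g f' g' F ff _ x t t0; rewrite htpy_D // ff. Qed.

Lemma htpy_src_cts f g (F : htpy D f g) : continuous f.
Proof.
have -> : f = fun x => F (x, 0) by apply/funext => x; rewrite htpy_le0.
by cts; exact: htpy_cts.
Qed.

Lemma htpy_tgt_cts f g (F : htpy D f g) : continuous g.
Proof.
have -> : g = fun x => F (x, 1) by apply/funext => x; rewrite htpy_ge1.
by cts; exact: htpy_cts.
Qed.

(** Where a homotopy of homotopies must be stationary; whole half-lines occur because time ranges
    over all of [R]. *)
Definition ends : set (X * R) := [set z | z.2 <= 0 \/ 1 <= z.2 \/ D z.1].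

End Ops.

(** Both sides are bare functions, so homotopies whose end maps agree only propositionally can be
    compared. *)
Definition heq (X S : topologicalType) (D : set X) (F G : X * R -> S) : Prop :=
  inhabited (htpy (ends D) F G).

Section Laws.
Context (X S : topologicalType) (D : set X).
Implicit Types f g k : X -> S.
Local Notation "F ~~ G" := (heq D F G) (at level 70).

Lemma heq_refl (F : X * R -> S) : continuous F -> F ~~ F.
Proof. by move=> cF; constructor; exact: hid. Qed.

Lemma heq_sym (F G : X * R -> S) : F ~~ G -> G ~~ F.
Proof. by move=> [L]; constructor; exact: hinv. Qed.

Lemma heq_trans (G F K : X * R -> S) : F ~~ G -> G ~~ K -> F ~~ K.
Proof. by move=> [L] [M]; constructor; exact: hcomp L M. Qed.

Lemma heq_eq (F G : X * R -> S) : continuous F -> F =1 G -> F ~~ G.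
Proof. by move=> cF /funext <-; exact: heq_refl. Qed.

Let cl (s : R) := Num.max 0 (Num.min 1 s).

Let cl_le0 s : s <= 0 -> cl s = 0.
Proof. by move=> s0; rewrite /cl min_r ?max_l //; lra. Qed.

Let cl_ge1 s : 1 <= s -> cl s = 1.
Proof. by move=> s0; rewrite /cl min_l ?max_r //; lra. Qed.

Let cl_01 s : 0 <= cl s <= 1.
Proof. by rewrite /cl le_max lexx ge_max ler01 ge_min lexx. Qed.

(** [F] and [G] follow two tracks in the parameter plane of one map [Phi]; the homotopy moves along
    the straight segment between the tracks. *)
Lemma heq_convex2 (Phi : X * (R * R) -> S) (p1 p2 q1 q2 : X * R -> R)
    (F G : X * R -> S) :
  continuous Phi -> continuous p1 -> continuous p2 -> continuous q1 ->
  continuous q2 -> (forall z, F z = Phi (z.1, (p1 z, p2 z))) ->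
  (forall z, G z = Phi (z.1, (q1 z, q2 z))) ->
  (forall z s, ends D z -> 0 <= s <= 1 ->
     Phi (z.1, ((1 - s) * p1 z + s * q1 z, (1 - s) * p2 z + s * q2 z)) = F z) ->
  F ~~ G.
Proof.
move=> cPhi cp1 cp2 cq1 cq2 FE GE FD; constructor.
have ccl : continuous cl by rewrite /cl; cts.
exists (fun z => Phi (z.1.1,
  ((1 - cl z.2) * p1 z.1 + cl z.2 * q1 z.1, (1 - cl z.2) * p2 z.1 + cl z.2 * q2 z.1))).
- by cts.
- by move=> z s s0; rewrite FE /= cl_le0 // subr0 !mul1r !mul0r !addr0.
- by move=> z s s0; rewrite GE /= cl_ge1 // subrr !mul1r !mul0r !add0r.
- by move=> z s Dz; rewrite FD.
Qed.

Lemma heq_convex (Phi : X * R -> S) (p q : X * R -> R) (F G : X * R -> S) :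
  continuous Phi -> continuous p -> continuous q ->
  (forall z, F z = Phi (z.1, p z)) -> (forall z, G z = Phi (z.1, q z)) ->
  (forall z s, ends D z -> 0 <= s <= 1 ->
     Phi (z.1, (1 - s) * p z + s * q z) = F z) ->
  F ~~ G.
Proof.
move=> cPhi cp cq FE GE FD.
apply: (@heq_convex2 (fun z => Phi (z.1, z.2.1)) p p q q) => //.
by cts.
Qed.

(** [K] is constant on each of the convex rays beyond 0 and 1, so it suffices that [p] and [q] send
    each end into the same ray. *)
Lemma heq_reparam f g (K : htpy D f g) (p q : R -> R) (F G : X * R -> S) :
  continuous p -> continuous q ->
  (forall x t, F (x, t) = K (x, p t)) -> (forall x t, G (x, t) = K (x, q t)) ->
  (forall t, t <= 0 -> (p t <= 0 /\ q t <= 0) \/ (1 <= p t /\ 1 <= q t)) ->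
  (forall t, 1 <= t -> (p t <= 0 /\ q t <= 0) \/ (1 <= p t /\ 1 <= q t)) ->
  F ~~ G.
Proof.
move=> cp cq FE GE h0 h1.
apply: (@heq_convex K (fun z => p z.2) (fun z => q z.2)).
- exact: htpy_cts.
- by cts.
- by cts.
- by case.
- by case.
- move=> [x t] s /= e s01; rewrite FE.
  have pq : (p t <= 0 /\ q t <= 0) \/ (1 <= p t /\ 1 <= q t) \/ D x.
    case: e => /= [/h0|[/h1|]]; tauto.
  case: pq => [[pt qt]|[[pt qt]|Dx]]; last by rewrite !htpy_D.
    by rewrite !htpy_le0 //; nra.
  by rewrite !htpy_ge1 //; nra.
Qed.

Definition heqh f g (F G : htpy D f g) : Prop := heq D F G.

Local Notation "F =h G" := (heqh F G) (at level 70).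

Lemma hcompA f g k l (F : htpy D f g) (G : htpy D g k) (H : htpy D k l) :
  hcomp (hcomp F G) H =h hcomp F (hcomp G H).
Proof.
(* The piecewise linear map with slopes 1/2, 1, 2 carries the breakpoints 1/2, 3/4 of the right side
   to the breakpoints 1/4, 1/2 of the left side. It is convex, hence the maximum of its three
   pieces. *)
apply: (@heq_reparam _ _ (hcomp (hcomp F G) H) id
  (fun t => Num.max (t / 2) (Num.max (t - 4^-1) (2 * t - 1)))); first exact: id_cts.
- by cts.
- by [].
- move=> x t /=; case: (leP t 2^-1) => t2.
    have -> : Num.max (t / 2) (Num.max (t - 4^-1) (2 * t - 1)) = t / 2.
      by apply/max_l; rewrite ge_max; lra.
    by rewrite !ifT; [congr (F (_, _)); lra|lra|lra].
  have -> : Num.max (t / 2) (Num.max (t - 4^-1) (2 * t - 1)) =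
      Num.max (t - 4^-1) (2 * t - 1) by apply/max_r; rewrite le_max; lra.
  case: (leP (2 * t - 1) 2^-1) => t3.
    have -> : Num.max (t - 4^-1) (2 * t - 1) = t - 4^-1 by apply/max_l; lra.
    rewrite ifT; last by lra.
    by rewrite ifF; [congr (G (_, _)); lra|lra].
  have -> : Num.max (t - 4^-1) (2 * t - 1) = 2 * t - 1 by apply/max_r; lra.
  by rewrite ifF //; lra.
- by move=> t t0; left; rewrite !ge_max; lra.
- by move=> t t1; right; rewrite !le_max; lra.
Qed.

Lemma hcomp_idl f g (F : htpy D f g) (cf : continuous f) :
  hcomp (hid D cf) F =h F.
Proof.
apply: (@heq_reparam _ _ F (fun t => 2 * t - 1) id).
- by cts.
- by cts.
- by move=> x t /=; case: ifP => // t2; rewrite htpy_le0 //; lra.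
- by [].
- by move=> t t0; left; lra.
- by move=> t t0; right; lra.
Qed.

Lemma hcomp_idr f g (F : htpy D f g) (cg : continuous g) :
  hcomp F (hid D cg) =h F.
Proof.
apply: (@heq_reparam _ _ F (fun t => 2 * t) id).
- by cts.
- by cts.
- by move=> x t /=; case: ifP => // t2; rewrite htpy_ge1 //; lra.
- by [].
- by move=> t t0; left; lra.
- by move=> t t0; right; lra.
Qed.

Lemma hcomp_invr f g (F : htpy D f g) (cf : continuous f) :
  hcomp F (hinv F) =h hid D cf.
Proof.
(* The parameter runs up to 1 and back; for t outside [0, 1] it is at most 0, where [F] rests at
   [f]. *)
apply: (@heq_reparam _ _ F (fun t => Num.min (2 * t) (2 - 2 * t)) (fun=> 0)).
- by cts.
- by cts.
- move=> x t /=; case: leP => t2.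
    by rewrite min_l //; lra.
  by rewrite min_r; [congr (F (_, _)); lra|lra].
- by move=> x t /=; rewrite htpy_le0.
- by move=> t t0; left; rewrite ge_min; lra.
- by move=> t t0; left; rewrite ge_min; lra.
Qed.

Lemma hcomp_invl f g (F : htpy D f g) (cg : continuous g) :
  hcomp (hinv F) F =h hid D cg.
Proof.
apply: (@heq_reparam _ _ F (fun t => Num.max (1 - 2 * t) (2 * t - 1)) (fun=> 1)).
- by cts.
- by cts.
- move=> x t /=; case: leP => t2.
    by rewrite max_l //; lra.
  by rewrite max_r; [congr (F (_, _)); lra|lra].
- by move=> x t /=; rewrite htpy_ge1.
- by move=> t t0; right; rewrite le_max; lra.
- by move=> t t0; right; rewrite le_max; lra.
Qed.

Lemma hcomp_congr f g k (F F' : htpy D f g) (G G' : htpy D g k) :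
  F =h F' -> G =h G' -> hcomp F G =h hcomp F' G'.
Proof.
move=> [L] [M]; constructor.
exists (fun z => if z.1.2 <= 2^-1 then L ((z.1.1, 2 * z.1.2), z.2)
                 else M ((z.1.1, 2 * z.1.2 - 1), z.2)).
- apply: glue_le; cts; try exact: htpy_cts.
  move=> [[x t] s] /= ->; rewrite (htpy_D L); last by right; left => /=; lra.
  rewrite (htpy_D M); last by left => /=; lra.
  by rewrite htpy_ge1 ?htpy_le0 //; lra.
- by move=> [x t] s s0 /=; case: ifP => _; rewrite htpy_le0.
- by move=> [x t] s s0 /=; case: ifP => _; rewrite htpy_ge1.
- move=> [x t] s e /=; rewrite /ends /= in e; case: leP => t2; [rewrite (htpy_D L)|rewrite (htpy_D M)] => //; rewrite /ends /=.
    by case: e => [?|[?|?]]; [left; lra|right; left; lra|by right; right].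
  by case: e => [?|[?|?]]; [left; lra|right; left; lra|by right; right].
Qed.

Lemma hinv_congr f g (F F' : htpy D f g) : F =h F' -> hinv F =h hinv F'.
Proof.
move=> [L]; constructor; exists (fun z => L ((z.1.1, 1 - z.1.2), z.2)).
- by cts; exact: htpy_cts.
- by move=> [x t] s s0 /=; rewrite htpy_le0.
- by move=> [x t] s s0 /=; rewrite htpy_ge1.
- move=> [x t] s e /=; rewrite (htpy_D L) //.
  rewrite /ends /= in e *.
  by case: e => [?|[?|?]]; [right; left; lra|left; lra|by right; right].
Qed.

Lemma heqh_refl f g (F : htpy D f g) : F =h F.
Proof. by apply: heq_refl; exact: htpy_cts. Qed.
Hint Resolve heqh_refl : core.

#[global] Instance heqh_equiv f g : RelationClasses.Equivalence (@heqh f g).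
Proof.
split; first exact: heqh_refl.
  by move=> F G; exact: heq_sym.
by move=> F G K; exact: heq_trans.
Qed.

#[global] Instance hcomp_proper f g k :
  Morphisms.Proper (Morphisms.respectful (@heqh f g)
    (Morphisms.respectful (@heqh g k) (@heqh f k))) (@hcomp X S D f g k).
Proof. by move=> F F' FF G G' GG; exact: hcomp_congr. Qed.

#[global] Instance hinv_proper f g :
  Morphisms.Proper (Morphisms.respectful (@heqh f g) (@heqh g f)) (@hinv X S D f g).
Proof. by move=> F F'; exact: hinv_congr. Qed.

Lemma heqh_eq f g (F G : htpy D f g) : F =1 G -> F =h G.
Proof. by apply: heq_eq; exact: htpy_cts. Qed.

Lemma hcompKl f g k (F : htpy D f g) (G : htpy D g k) :
  hcomp (hinv F) (hcomp F G) =h G.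
Proof. by rewrite -hcompA (hcomp_invl F (htpy_tgt_cts F)) hcomp_idl. Qed.

Lemma hcompVKl f g k (F : htpy D g f) (G : htpy D g k) :
  hcomp F (hcomp (hinv F) G) =h G.
Proof. by rewrite -hcompA (hcomp_invr F (htpy_src_cts F)) hcomp_idl. Qed.

Lemma hcompK f g k (F : htpy D f g) (G : htpy D g k) :
  hcomp (hcomp F G) (hinv G) =h F.
Proof. by rewrite hcompA (hcomp_invr G (htpy_src_cts G)) hcomp_idr. Qed.

Lemma hcompVK f g k (F : htpy D f g) (G : htpy D k g) :
  hcomp (hcomp F (hinv G)) G =h F.
Proof. by rewrite hcompA (hcomp_invl G (htpy_tgt_cts G)) hcomp_idr. Qed.

Lemma hcompIl f g k (F : htpy D f g) (G G' : htpy D g k) :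
  hcomp F G =h hcomp F G' -> G =h G'.
Proof. by move=> e; rewrite -(hcompKl F G) e hcompKl. Qed.

Lemma hcompIr f g k (F F' : htpy D f g) (G : htpy D g k) :
  hcomp F G =h hcomp F' G -> F =h F'.
Proof. by move=> e; rewrite -(hcompK F G) e hcompK. Qed.

End Laws.

Section Whisker.
Context (X' X S S' : topologicalType) (D' : set X') (D : set X).

Program Definition hpre (f g : X -> S) (F : htpy D f g) (q : X' -> X)
    (cq : continuous q) (qD : forall x, D' x -> D (q x)) :
    htpy D' (fun x => f (q x)) (fun x => g (q x)) :=
  @Htpy X' S D' _ _ (fun z => F (q z.1, z.2)) _ _ _ _.
Next Obligation. by move=> f g F q cq qD; cts; exact: htpy_cts. Qed.
Next Obligation. by move=> f g F q cq qD x t t0; rewrite /= htpy_le0. Qed.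
Next Obligation. by move=> f g F q cq qD x t t0; rewrite /= htpy_ge1. Qed.
Next Obligation. by move=> f g F q cq qD x t Dx; rewrite /= htpy_D //; exact: qD. Qed.

Program Definition hpost (f g : X -> S) (tau : S -> S') (ctau : continuous tau)
    (F : htpy D f g) : htpy D (fun x => tau (f x)) (fun x => tau (g x)) :=
  @Htpy X S' D _ _ (fun z => tau (F z)) _ _ _ _.
Next Obligation. by move=> f g tau ctau F; cts; exact: htpy_cts. Qed.
Next Obligation. by move=> f g tau ctau F x t t0; rewrite /= htpy_le0. Qed.
Next Obligation. by move=> f g tau ctau F x t t0; rewrite /= htpy_ge1. Qed.
Next Obligation. by move=> f g tau ctau F x t t0; rewrite /= htpy_D. Qed.

Lemma hpre_congr (f g : X -> S) (F G : htpy D f g) (q : X' -> X)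
    (cq : continuous q) (qD : forall x, D' x -> D (q x)) :
  heqh F G -> heqh (hpre F cq qD) (hpre G cq qD).
Proof.
move=> [L]; constructor; exists (fun z => L ((q z.1.1, z.1.2), z.2)).
- by cts; exact: htpy_cts.
- by move=> [x t] s s0 /=; rewrite htpy_le0.
- by move=> [x t] s s0 /=; rewrite htpy_ge1.
- move=> [x t] s e /=; rewrite (htpy_D L) //; rewrite /ends /= in e *.
  by case: e => [?|[?|/qD ?]]; [left|right; left|right; right].
Qed.

Lemma hpost_congr (f g : X -> S) (F G : htpy D f g) (tau : S -> S')
    (ctau : continuous tau) :
  heqh F G -> heqh (hpost ctau F) (hpost ctau G).
Proof.
move=> [L]; constructor; exists (fun z => tau (L z)).
- by cts; exact: htpy_cts.
- by move=> [x t] s s0 /=; rewrite htpy_le0.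
- by move=> [x t] s s0 /=; rewrite htpy_ge1.
- by move=> [x t] s e /=; rewrite (htpy_D L).
Qed.

Lemma hpre_comp (f g k : X -> S) (F : htpy D f g) (G : htpy D g k) (q : X' -> X)
    (cq : continuous q) (qD : forall x, D' x -> D (q x)) :
  heqh (hpre (hcomp F G) cq qD) (hcomp (hpre F cq qD) (hpre G cq qD)).
Proof. exact: heqh_eq. Qed.

Lemma hpost_comp (f g k : X -> S) (F : htpy D f g) (G : htpy D g k) (tau : S -> S')
    (ctau : continuous tau) :
  heqh (hpost ctau (hcomp F G)) (hcomp (hpost ctau F) (hpost ctau G)).
Proof. by apply: heqh_eq => z /=; case: ifP. Qed.

Lemma hpost_inv (f g : X -> S) (F : htpy D f g) (tau : S -> S')
    (ctau : continuous tau) :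
  heqh (hpost ctau (hinv F)) (hinv (hpost ctau F)).
Proof. exact: heqh_eq. Qed.

End Whisker.

(** Both composites follow two sides of the square (s, t) |-> F (B (x, t), s) from (0, 0) to (1, 1),
    and tracks in the plane with the same ends are joined by segments. *)
Lemma hnat (X' X S : topologicalType) (D' : set X') (D : set X)
    (f g : X -> S) (cf : continuous f) (cg : continuous g)
    (F : htpy D f g) (q q' : X' -> X) (cq : continuous q)
    (cq' : continuous q') (qD : forall x, D' x -> D (q x))
    (qD' : forall x, D' x -> D (q' x)) (B : htpy D' q q') :
  heqh (hcomp (hpre F cq qD) (hpost cg B)) (hcomp (hpost cf B) (hpre F cq' qD')).
Proof.
(* The coordinates 2 t and 2 t - 1 leave [0, 1], where [F] and [B] rest: one coordinate waits while
   the other moves. *)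
apply: (@heq_convex2 _ _ _ (fun y => F (B (y.1, y.2.2), y.2.1))
  (fun z => 2 * z.2) (fun z => 2 * z.2 - 1) (fun z => 2 * z.2 - 1) (fun z => 2 * z.2)).
- by cts; exact: htpy_cts.
- by cts.
- by cts.
- by cts.
- by cts.
- move=> [x t] /=; case: leP => t2.
    by rewrite (@htpy_le0 _ _ _ _ _ B) //; lra.
  by rewrite (@htpy_ge1 _ _ _ _ _ F) //; lra.
- move=> [x t] /=; case: leP => t2.
    by rewrite (@htpy_le0 _ _ _ _ _ F) //; lra.
  by rewrite (@htpy_ge1 _ _ _ _ _ B) //; lra.
- move=> [x t] s /= e s01; case: e => /= [t0|[t1|Dx]].
  + rewrite ifT; last by lra.
    rewrite [RHS](@htpy_le0 _ _ _ _ _ F); last by lra.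
    by rewrite (@htpy_le0 _ _ _ _ _ B) ?(@htpy_le0 _ _ _ _ _ F) //; nra.
  + rewrite ifF; last by lra.
    rewrite [X in _ = g X](@htpy_ge1 _ _ _ _ _ B); last by lra.
    by rewrite (@htpy_ge1 _ _ _ _ _ B) ?(@htpy_ge1 _ _ _ _ _ F) //; nra.
  + rewrite !(@htpy_D _ _ _ _ _ B) // !(@htpy_D _ _ _ _ _ F); try exact: qD.
    by case: ifP => // _; rewrite (htpy_D1 F) //; exact: qD.
Qed.

End Homotopies.

Notation "F =h G" := (heqh F G) (at level 70).
#[global] Hint Resolve heqh_refl : core.

(** * Homotopy equivalences and the transfer of homotopies along them *)

Section Equivalences.
Context (R : realType).

Lemma hpre_id (X S : topologicalType) (D : set X) (f g : X -> S)
    (F : htpy R D f g) (c : continuous (fun x : X => x)) (d : forall x, D x -> D x) :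
  hpre F c d =h F.
Proof. by apply: heqh_eq => -[]. Qed.

Definition hforget (X S : topologicalType) (D D' : set X) (f g : X -> S)
    (F : htpy R D f g) (DD : forall x, D' x -> D x) : htpy R D' f g :=
  Htpy (htpy_cts (h := F)) (htpy_le0 F) (htpy_ge1 F)
    (fun x t Dx => htpy_D F t (DD x Dx)).

(** Naturality along [B] expresses precomposition with [q'] as precomposition with [q], conjugated
    by the tracks of [B] under [f] and [g]; these tracks are the same for [F] and [G]. *)
Lemma htpy_faithful (X S : topologicalType) (D : set X) (q q' : X -> X)
    (cq : continuous q) (qD : forall x, D x -> D (q x))
    (cq' : continuous q') (qD' : forall x, D x -> D (q' x))
    (B : htpy R D q q') (f g : X -> S) (F G : htpy R D f g) :
  hpre F cq qD =h hpre G cq qD -> hpre F cq' qD' =h hpre G cq' qD'.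
Proof.
move=> e; apply: (hcompIl (F := hpost (htpy_src_cts F) B)).
rewrite -(hnat (htpy_src_cts F) (htpy_tgt_cts F) F cq cq' qD qD').
by rewrite -(hnat (htpy_src_cts F) (htpy_tgt_cts F) G cq cq' qD qD') e.
Qed.

(** The sets are base points or empty in the applications, so that pointed and free equivalences are
    treated together. The two homotopies are data without a triangle identity. *)
Record heqv (X V : topologicalType) (DX : set X) (DV : set V) (i : X -> V) := Heqv {
  hq_inv : V -> X;
  hq_cts : continuous i;
  hq_inv_cts : continuous hq_inv;
  hq_D : forall x, DX x -> DV (i x);
  hq_inv_D : forall x, DV x -> DX (hq_inv x);
  hq_unit : htpy R DV id (fun v => i (hq_inv v));
  hq_counit : htpy R DX (fun x => hq_inv (i x)) id }.

Arguments hq_inv {X V DX DV i} _.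
Arguments hq_cts {X V DX DV i} _.
Arguments hq_inv_cts {X V DX DV i} _.
Arguments hq_D {X V DX DV i} _ {x} _.
Arguments hq_inv_D {X V DX DV i} _ {x} _.
Arguments hq_unit {X V DX DV i} _.
Arguments hq_counit {X V DX DV i} _.

Section Full.
Context (X V S : topologicalType) (DX : set X) (DV : set V) (i : X -> V).
Context (E : heqv DX DV i).
Let ci := hq_cts E.
Let iD : forall x, DX x -> DV (i x) := @hq_D _ _ _ _ _ E.

(** Precomposing with [i] and then with its inverse is precomposing with a self-map of [V] homotopic
    to the identity, and [htpy_faithful] removes such a self-map. *)
Lemma heqv_faithful (f g : V -> S) (F G : htpy R DV f g) :
  hpre F ci iD =h hpre G ci iD -> F =h G.
Proof.
move=> e; have := @htpy_faithful _ _ _ (fun v => i (hq_inv E v)) id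
  (comp_cts (hq_inv_cts E) ci) (fun v Dv => @iD _ (hq_inv_D E Dv))
  (@id_cts V) (fun v Dv => Dv) (hinv (hq_unit E)) _ _ F G.
rewrite !hpre_id; apply; exact: (hpre_congr (hq_inv_cts E) (@hq_inv_D _ _ _ _ _ E) e).
Qed.

(** [F] is [G] after the inverse, conjugated by the unit. In the absence of a triangle identity its
    restriction to [X] is compared with [G] only after precomposition with [k i]; this is enough
    because [k i] is homotopic to the identity. *)
Lemma heqv_full (f g : V -> S) (cf : continuous f) (cg : continuous g)
    (G : htpy R DX (fun x => f (i x)) (fun x => g (i x))) :
  exists F : htpy R DV f g, hpre F ci iD =h G.
Proof.
pose k := hq_inv E; pose ck := hq_inv_cts E; pose kD := @hq_inv_D _ _ _ _ _ E.
pose F : htpy R DV f g :=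
  hcomp (hpost cf (hq_unit E)) (hcomp (hpre G ck kD) (hinv (hpost cg (hq_unit E)))).
exists F.
have := @htpy_faithful _ _ _ (fun x => k (i x)) id
  (comp_cts ci ck) (fun v Dv => @kD _ (@iD _ Dv))
  (@id_cts X) (fun v Dv => Dv) (hq_counit E) _ _ (hpre F ci iD) G.
rewrite !hpre_id; apply; apply: (hpre_congr ci iD (F := hpre F (comp_cts ck ci) (fun v Dv => @iD _ (kD v Dv)))
  (G := hpre G ck kD)).
have := hnat cf cg F (@id_cts V) (comp_cts ck ci) (fun v Dv => Dv)
  (fun v Dv => @iD _ (kD v Dv)) (hq_unit E).
by rewrite hpre_id {1}/F hcompA hcompVK => /hcompIl ->.
Qed.

End Full.

Lemma phomotopicP (X Y : ptopologicalType) (f g : {pmap X -> Y}) :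
  phomotopic R f g <-> inhabited (htpy R [set point] f g).
Proof.
split=> [[H [cH H0 H1 Hp]]|[F]].
  constructor; exists (fun z => H (z.1, clamp z.2)).
  - by cts; exact: clamp_cts.
  - move=> x t t0; rewrite /= -H0; congr (H (_, _)); apply: psub_val_inj.
    by rewrite /= min_r ?max_l //; lra.
  - move=> x t t0; rewrite /= -H1; congr (H (_, _)); apply: psub_val_inj.
    by rewrite /= min_l ?max_r //; lra.
  - by move=> x t ->; rewrite Hp pmap_pt.
exists (fun z => F (z.1, psub_val z.2)); split.
- by cts; [exact: psub_val_cts|exact: htpy_cts].
- by move=> x; rewrite htpy_le0.
- by move=> x; rewrite htpy_ge1.
- by move=> t; rewrite htpy_D // pmap_pt.
Qed.

End Equivalences.

Arguments hq_inv {R X V DX DV i} _.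
Arguments hq_cts {R X V DX DV i} _.
Arguments hq_inv_cts {R X V DX DV i} _.
Arguments hq_D {R X V DX DV i} _ {x} _.
Arguments hq_inv_D {R X V DX DV i} _ {x} _.
Arguments hq_unit {R X V DX DV i} _.
Arguments hq_counit {R X V DX DV i} _.

(** * Path spaces and the exponential law *)

HB.instance Definition _ (R : realType) (Z : ptopologicalType) :=
  isPointed.Build (free_path R Z) (cst_path R Z).

Section Curry.
Context (R : realType).

Lemma clamp_le0 (t : R) : t <= 0 -> clamp t = I0 R.
Proof. by move=> t0; apply: psub_val_inj; rewrite /= min_r ?max_l //; lra. Qed.

Lemma clamp_ge1 (t : R) : 1 <= t -> clamp t = I1 R.
Proof. by move=> t0; apply: psub_val_inj; rewrite /= min_l ?max_r //; lra. Qed.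

Lemma htpy_clamp (X S : topologicalType) (D : set X) (f g : X -> S)
    (F : htpy R D f g) x t : F (x, psub_val (clamp t)) = F (x, t).
Proof.
case: (leP t 0) => t0; first by rewrite clamp_le0 // !htpy_le0.
case: (leP 1 t) => t1; first by rewrite clamp_ge1 // !htpy_ge1.
by rewrite clampE //; lra.
Qed.

(** A homotopy out of a mapping cone is obtained as a pointed map into this space, so the universal
    property of the quotient applies directly and cylinders on quotients do not occur. *)
Definition pfp (Z : ptopologicalType) : ptopologicalType := free_path R Z.

Lemma uncurry_cts (T : topologicalType) (Z : ptopologicalType) (w : T -> pfp Z) :
  continuous w -> continuous (fun z : T * R => w z.1 (clamp z.2)).
Proof.
move=> cw; apply: (@path_app_cts R (T * R)%type Z (fun z => w z.1) (fun z => clamp z.2)).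
  by cts.
by cts; exact: clamp_cts.
Qed.

Lemma curryR_cts (T : topologicalType) (Z : ptopologicalType) (F : T * R -> Z) :
  continuous F -> continuous (fun p : T * unitI R => F (p.1, psub_val p.2)).
Proof. by move=> cF; cts; exact: psub_val_cts. Qed.

Definition fpath_of (T : topologicalType) (Z : ptopologicalType) (F : T * R -> Z)
    (cF : continuous F) : T -> pfp Z :=
  curry_path (F := fun t s => F (t, psub_val s)) (curryR_cts cF).

Lemma fpath_of_cts (T : topologicalType) (Z : ptopologicalType) (F : T * R -> Z)
    (cF : continuous F) : continuous (fpath_of cF).
Proof. exact: curry_pathP. Qed.

End Curry.

Arguments fpath_of_cts {R T Z F} cF _ _ _.

Arguments mcone_base : simpl never.
Arguments mcone_cone : simpl never.
Arguments ppi : simpl never.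
Arguments plift : simpl never.
Arguments po_lift : simpl never.
Arguments po_l : simpl never.
Arguments po_r : simpl never.
Arguments cone_in : simpl never.
(** * Mapping cones and homotopy pushouts *)

Section MappingCone.
Context (R : realType) (B Y : ptopologicalType) (u : {pmap B -> Y}).
Local Notation C := (mapping_cone R u).
Local Notation base := (mcone_base R u).

Definition cone_pt (z : B * R) : C :=
  mcone_cone R u (ppi (@cone_rel R B) (z.1, clamp z.2)).

Lemma cone_rel_pt (x : B * unitI R) : x.2 = I0 R \/ x.1 = point ->
  ppi (@cone_rel R B) x = point.
Proof. by move=> h; rewrite -[RHS](pmap_pt (ppi (@cone_rel R B))); apply: ppi_eq. Qed.

Program Definition cone_htpy : htpy R [set point] (fun=> point) (fun b => base (u b)) :=
  @Htpy R B C _ _ _ cone_pt _ _ _ _.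
Next Obligation. by rewrite /cone_pt; cts; exact: clamp_cts. Qed.
Next Obligation.
move=> b t t0; rewrite /cone_pt -[(b, t).2]/t clamp_le0 //.
by rewrite cone_rel_pt ?pmap_pt //; left.
Qed.
Next Obligation. move=> b t t0; rewrite /cone_pt -[(b, t).2]/t clamp_ge1 //.
exact/esym/(po_glue u (cone_in R B)). Qed.
Next Obligation.
by move=> b t ->; rewrite /cone_pt cone_rel_pt ?pmap_pt //; right.
Qed.

Section Lift.
Context (S : ptopologicalType) (phi : {pmap Y -> S}).
Context (k : htpy R [set point] (fun=> point) (fun b => phi (u b))).

Program Definition cyl_map : {pmap (B * unitI R)%type -> S} :=
  @PMap (B * unitI R)%type S (fun z => k (z.1, psub_val z.2)) _ _.
Next Obligation. by cts; [exact: psub_val_cts|exact: htpy_cts]. Qed.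
Next Obligation. by rewrite /= htpy_D. Qed.

Lemma cyl_map_compat (x y : B * unitI R) : @cone_rel R B x y -> cyl_map x = cyl_map y.
Proof.
move=> [x0 ->]; rewrite pmap_pt /=.
by case: x0 => ->; [rewrite htpy_le0|rewrite htpy_D].
Qed.

Lemma mc_lift_compat b : phi (u b) = plift cyl_map_compat (cone_in R B b).
Proof.
by rewrite [RHS](pliftE cyl_map_compat (b, I1 R)) /= htpy_ge1.
Qed.

Definition mc_lift : {pmap C -> S} := po_lift mc_lift_compat.

Lemma mc_lift_base y : mc_lift (base y) = phi y.
Proof. exact: po_lift_l. Qed.

Lemma mc_lift_cone z : mc_lift (cone_pt z) = k (z.1, psub_val (clamp z.2)).
Proof.
rewrite [LHS](po_lift_r mc_lift_compat).
exact: (pliftE cyl_map_compat (z.1, clamp z.2)).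
Qed.

Lemma mc_lift_htpy z : mc_lift (cone_pt z) = k z.
Proof.
by case: z => b t; rewrite mc_lift_cone htpy_clamp.
Qed.

End Lift.

Lemma mc_surj (P : C -> Prop) :
  (forall y, P (base y)) -> (forall z, P (cone_pt z)) -> forall c, P c.
Proof.
move=> Py Pz c; have [[y|d] <-] := ppi_surj c; first exact: Py.
have [[b t] <-] := ppi_surj d.
by have := Pz (b, psub_val t); rewrite /cone_pt clampK.
Qed.

(** The hypothesis says that [P] is compatible with the null homotopies which [t1] and [t2] induce
    on [B], but only up to a homotopy [L]; this correction is absorbed in the cone coordinate. *)
Lemma mc_htpy (S : ptopologicalType) (t1 t2 : {pmap C -> S})
    (P : htpy R [set point] (fun y => t1 (base y)) (fun y => t2 (base y))) :
  hcomp (hpost (@pmap_cts _ _ t1) cone_htpy)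
    (hpre P (@pmap_cts _ _ u) (fun b (e : [set point] b) =>
       etrans (congr1 u e) (pmap_pt u))) =h
  hcast (hpost (@pmap_cts _ _ t2) cone_htpy)
    (fun=> etrans (pmap_pt t2) (esym (pmap_pt t1))) (fun=> erefl) ->
  inhabited (htpy R [set point] t1 t2).
Proof.
set K := hcomp _ _; set K' := hcast _ _ _.
have Kl b t : t <= 2^-1 -> K (b, t) = t1 (cone_pt (b, 2 * t)).
  by move=> tl; rewrite /K hcomp_l.
have Kr b t : 2^-1 < t -> K (b, t) = P (u b, 2 * t - 1).
  by move=> tl; rewrite /K hcomp_r.
have K'E z : K' z = t2 (cone_pt z) by [].
clearbody K K' => -[L].
(* First slide from [t1 k] to the composite of [t1 k] and [P], then follow [L]. *)
pose F (z : (B * R) * R) := if z.2 <= 2^-1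
  then K (z.1.1, Num.min 1 z.1.2 * Num.max 2^-1 (2^-1 + z.2))
  else L (z.1, 2 * z.2 - 1).
have KE b t : K (b, Num.min 1 t) = K (b, t).
  by case: (leP 1 t) => t1'; rewrite // !htpy_ge1.
have cF : continuous F.
  apply: glue_le; cts; try exact: htpy_cts.
  move=> [[b t] s].
  rewrite /fst.
  rewrite /snd.
  move=> ->.
  rewrite [RHS](htpy_le0 L).
  2: lra.
  by rewrite -[RHS]KE; congr (K (_, _)); rewrite max_r; lra.
(* At t = 1 the slide traverses [P] while s is in [0, 1/2] and then rests, so on the base [P] has to
   run at double speed. *)
have cP : continuous (fun z : Y * R => P (z.1, 2 * z.2)) by cts; exact: htpy_cts.
have Fl b t s : s <= 2^-1 ->
    F ((b, t), s) = K (b, Num.min 1 t * Num.max 2^-1 (2^-1 + s)).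
  by move=> s2; rewrite /F -[(b, t, s).2]/s s2.
have Fr b t s : 2^-1 < s -> F ((b, t), s) = L ((b, t), 2 * s - 1).
  by move=> s2; rewrite /F -[(b, t, s).2]/s leNgt s2.
have LD z s : ends [set point] z -> L (z, s) = K z by exact: (htpy_D L).
have L1 z s : 1 <= s -> L (z, s) = t2 (cone_pt z).
  by move=> s1; rewrite (htpy_ge1 L) // K'E.
have K_le0 b t : t <= 0 -> K (b, t) = point.
  by move=> t0; rewrite (htpy_le0 K) // pmap_pt.
have K_ge1 b t : 1 <= t -> K (b, t) = P (u b, 1).
  by move=> t0; rewrite (htpy_ge1 K) // (htpy_ge1 P).
have K_D t : K (point, t) = point by rewrite (htpy_D K) // pmap_pt.
clearbody F.
have F_le0 b t s : t <= 0 -> F ((b, t), s) = point.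
  move=> t0; case: (leP s 2^-1) => s2.
    rewrite Fl // K_le0 // min_r; last by lra.
    by rewrite mulr_le0_ge0 // le_max; lra.
  by rewrite Fr // LD ?K_le0 //; left.
have F_ge1 b t s : 1 <= t -> F ((b, t), s) = P (u b, 2 * s).
  move=> t1'; case: (leP s 2^-1) => s2.
    rewrite Fl // min_l // mul1r; case: (leP s 0) => s0.
      rewrite max_l; last by lra.
      rewrite Kl // (htpy_le0 P); last by lra.
      by congr (t1 _); rewrite -[LHS]/(cone_htpy _) (htpy_ge1 cone_htpy) //; lra.
    rewrite max_r; last by lra.
    by rewrite Kr; [congr (P (_, _)); lra|lra].
  rewrite Fr // LD; last by right; left.
  by rewrite K_ge1 // !(htpy_ge1 P) //; lra.
have F_D t s : F ((point, t), s) = point.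
  case: (leP s 2^-1) => s2; first by rewrite Fl // K_D.
  by rewrite Fr // LD ?K_D //; right; right.
have phi_pt : fpath_of cP point = point.
  apply: free_path_eq => s; rewrite -[LHS]/(P (point, 2 * psub_val s)).
  by rewrite (htpy_D P) // !pmap_pt.
pose phi := @PMap Y (pfp R S) (fpath_of cP) (fpath_of_cts cP) phi_pt.
have k_le0 b t : t <= 0 -> fpath_of cF (b, t) = point.
  by move=> t0; apply: free_path_eq => s; rewrite -[LHS]/(F ((_, t), psub_val s)) F_le0.
have k_ge1 b t : 1 <= t -> fpath_of cF (b, t) = phi (u b).
  by move=> t1'; apply: free_path_eq => s; rewrite -[LHS]/(F ((_, t), psub_val s)) F_ge1.
have k_D b t : [set point] b -> fpath_of cF (b, t) = point.
  by move=> ->; apply: free_path_eq => s; rewrite -[LHS]/(F ((_, t), psub_val s)) F_D.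
pose Om := mc_lift (@Htpy R B (pfp R S) [set point] (fun=> point)
  (fun b => phi (u b)) _ (fpath_of_cts cF) k_le0 k_ge1 k_D).
constructor; exists (fun z => Om z.1 (clamp z.2)).
- by apply: (@uncurry_cts R _ S Om); exact: pmap_cts.
- move=> c t t0; rewrite -[(c, t).1]/c -[(c, t).2]/t clamp_le0 //; move: c.
  apply: mc_surj => [y|[b t']].
    rewrite mc_lift_base -[LHS]/(P (y, 2 * 0)).
    by rewrite (htpy_le0 P) ?mulr0.
  rewrite mc_lift_htpy -[LHS]/(F ((b, t'), 0)) Fl ?invr_ge0 ?ler0n // addr0 maxxx.
  rewrite Kl; last by rewrite -[leRHS]mul1r ler_pM2r ?invr_gt0 ?ltr0n // ge_min lexx.
  rewrite (_ : 2 * _ = Num.min 1 t'); last by lra.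
  rewrite -![cone_pt _]/(cone_htpy _).
  by congr (t1 _); case: (leP 1 t') => t1'; rewrite // !(htpy_ge1 cone_htpy).
- move=> c t t0; rewrite -[(c, t).1]/c -[(c, t).2]/t clamp_ge1 //; move: c.
  apply: mc_surj => [y|[b t']].
    rewrite mc_lift_base -[LHS]/(P (y, 2 * 1)).
    by rewrite (htpy_ge1 P) //; lra.
  by rewrite mc_lift_htpy -[LHS]/(F ((b, t'), 1)) Fr ?L1 //; lra.
- by move=> c t ->; rewrite pmap_pt (pmap_pt Om).
Qed.

End MappingCone.

Section Casts.
Context (R : realType) (X S : topologicalType) (D : set X).

Lemma heqh_ext (f g f' g' : X -> S) (F G : htpy R D f g) (F' G' : htpy R D f' g') :
  F =1 F' -> G =1 G' -> F =h G -> F' =h G'.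
Proof. by move=> /funext FF /funext GG; rewrite /heqh FF GG. Qed.

Lemma hcomp_ext (f g k f' g' k' : X -> S) (F : htpy R D f g) (G : htpy R D g k)
    (F' : htpy R D f' g') (G' : htpy R D g' k') :
  F =1 F' -> G =1 G' -> hcomp F G =1 hcomp F' G'.
Proof.
by move=> FF GG [x t]; case: (leP t 2^-1) => t2;
  [rewrite !hcomp_l|rewrite !hcomp_r].
Qed.

End Casts.

Lemma no_set0 (X : Type) (P : X -> Prop) x : (set0 : set X) x -> P x.
Proof. by []. Qed.
Arguments no_set0 {X P} x _.

(** * Null squares and the recognition of mapping cones *)

Section Split.
Context (R : realType) (X K : topologicalType) (B : ptopologicalType).
Context (pi : X -> B) (cpi : continuous pi) (p : X -> K) (cp : continuous p).

(* Equivalently, the homotopy pushout of [B <- X -> K] is contractible. *)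
Definition null_square : Prop :=
  forall (S : ptopologicalType) (b : {pmap B -> S}) (psi : K -> S)
    (H : htpy R set0 (fun x => b (pi x)) (fun x => psi (p x))),
  exists (P : htpy R [set point] (fun=> point) b) (Q : htpy R set0 (fun=> point) psi),
    hcomp (hpre P cpi (@no_set0 _ _)) H =h hpre Q cp (@no_set0 _ _).

Definition as_loop (T : topologicalType) (D : set T) (S : ptopologicalType)
    (L : htpy R D (fun=> point) (fun=> point : S)) (t : T) : loop R S :=
  @psub_in _ _ _ (@loop_set_cst R S) (fpath_of (htpy_cts (h:=L)) t)
    (conj (htpy_le0 L t (lexx 0)) (htpy_ge1 L t (lexx 1))).

Lemma as_loop_cts (T : topologicalType) (D : set T) (S : ptopologicalType)
    (L : htpy R D (fun=> point) (fun=> point : S)) : continuous (as_loop L).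
Proof.
apply: psub_cts; exact: (@fpath_of_cts R T S L (htpy_cts (h:=L))).
Qed.

(** A homotopy from the constant map to itself is a map into the loop space. Read in this way [L] is
    a map on [B], and [M] with its two parameters exchanged is a homotopy over [X] from it to a map
    on [K]; the null homotopy that the square provides on [B] contracts [L]. *)
Lemma null_square_loop (S : ptopologicalType)
    (L : htpy R [set point : B] (fun=> point) (fun=> point : S))
    (Q : htpy R (set0 : set K) (fun=> point) (fun=> point)) :
  null_square -> hpre L cpi (@no_set0 _ _) =h hpre Q cp (@no_set0 _ _) ->
  L =h hid R [set point] (@cst_cts B S point).
Proof.
move=> sq [M].
have L_pt : as_loop L point = point.
  apply: psub_val_inj; apply: free_path_eq => s.
  by rewrite -[LHS]/(L (point, psub_val s)) (htpy_D L).
pose b := PMap (as_loop_cts (L := L)) L_pt.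
pose F (z : (X * R) * R) := M ((z.1.1, z.2), z.1.2).
have cF : continuous F by rewrite /F; cts; exact: htpy_cts.
have F0 z : fpath_of cF z (I0 R) = point.
  rewrite -[LHS]/(M ((z.1, 0), z.2)) (htpy_D M); last by left.
  by rewrite -[LHS]/(L (_, 0)) (htpy_le0 L).
have F1 z : fpath_of cF z (I1 R) = point.
  rewrite -[LHS]/(M ((z.1, 1), z.2)) (htpy_D M); last by right; left.
  by rewrite -[LHS]/(L (_, 1)) (htpy_ge1 L).
pose H0 z : loop R S := @psub_in _ _ _ (@loop_set_cst R S) _ (conj (F0 z) (F1 z)).
have cH0 : continuous H0 by apply: psub_cts; exact: (fpath_of_cts cF).
have H_le0 x t : t <= 0 -> H0 (x, t) = b (pi x).
  by move=> t0; apply: psub_val_inj; apply: free_path_eq => s;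
    rewrite -[LHS]/(M ((x, psub_val s), t)) (htpy_le0 M).
have H_ge1 x t : 1 <= t -> H0 (x, t) = as_loop Q (p x).
  by move=> t0; apply: psub_val_inj; apply: free_path_eq => s;
    rewrite -[LHS]/(M ((x, psub_val s), t)) (htpy_ge1 M).
have H_D x t : (set0 : set X) x -> H0 (x, t) = b (pi x) by [].
have [P [_ _]] := sq _ b (as_loop Q) (Htpy cH0 H_le0 H_ge1 H_D).
apply: heq_sym; constructor.
exists (fun z => psub_val (P (z.1.1, z.2)) (clamp z.1.2)).
- apply: path_app_cts; last by cts; exact: clamp_cts.
  apply: (@comp_cts _ (loop R S)); last exact: psub_val_cts.
  by cts; exact: htpy_cts.
- by move=> [x t] s s0; rewrite (htpy_le0 P).
- by move=> [x t] s s0; rewrite (htpy_ge1 P) // -[RHS]htpy_clamp.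
- move=> [x t] s [t0|[t1|xD]].
  + by rewrite -[(x, t, s).1.2]/t clamp_le0 // loop0.
  + by rewrite -[(x, t, s).1.2]/t clamp_ge1 // loop1.
  + by rewrite (htpy_D P).
Qed.

End Split.

Section Recognition.
Context (R : realType) (X K : topologicalType) (B Y W : ptopologicalType).
Context (w : X -> Y) (cw : continuous w) (p : X -> K) (cp : continuous p).
Context (jY : {pmap Y -> W}) (jK : K -> W).
Context (h : htpy R set0 (fun x => jY (w x)) (fun x => jK (p x))).
Local Notation cpm f := (@pmap_cts _ _ f).

(* Uniqueness in the universal property of a homotopy pushout of
   [Y <- X -> K]: [Y] and [W] are pointed, [X] and [K] are not. *)
Definition hpo_uniq : Prop :=
  forall (S : ptopologicalType) (t1 t2 : {pmap W -> S})
    (P : htpy R [set point] (fun y => t1 (jY y)) (fun y => t2 (jY y)))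
    (Q : htpy R set0 (fun k => t1 (jK k)) (fun k => t2 (jK k))),
  hcomp (hpost (cpm t1) h) (hpre Q cp (@no_set0 _ _)) =h
  hcomp (hpre P cw (@no_set0 _ _)) (hpost (cpm t2) h) ->
  inhabited (htpy R [set point] t1 t2).

Definition hpo_exist : Prop :=
  forall (S : ptopologicalType) (phi : {pmap Y -> S}) (psi : K -> S)
    (H : htpy R set0 (fun x => phi (w x)) (fun x => psi (p x))),
  continuous psi ->
  exists (t : {pmap W -> S}) (P : htpy R [set point] (fun y => t (jY y)) phi)
    (Q : htpy R set0 (fun k => t (jK k)) psi),
  hcomp (hpost (cpm t) h) (hpre Q cp (@no_set0 _ _)) =h
  hcomp (hpre P cw (@no_set0 _ _)) H.

End Recognition.

Section ConeRecognition.
Context (R : realType) (X K : topologicalType) (B Y W : ptopologicalType).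
Context (pi : X -> B) (cpi : continuous pi) (p : X -> K) (cp : continuous p).
Context (u : {pmap B -> Y}) (cw : continuous (fun x => u (pi x))).
Context (jY : {pmap Y -> W}) (jK : K -> W).
Context (h : htpy R set0 (fun x => jY (u (pi x))) (fun x => jK (p x))).
Local Notation cpm f := (@pmap_cts _ _ f).
Local Notation C := (mapping_cone R u).
Local Notation base := (mcone_base R u).
Local Notation ch := (cone_htpy R u).
Local Notation u_pt := (fun b (e : [set point] b) => etrans (congr1 u e) (pmap_pt u)).

(* The null square makes the outer square of [X -> B -> Y] over [K -> * -> C] a
   homotopy pushout, so that both [C] and [W] are homotopy pushouts of
   [Y <- X -> K]. *)
Theorem cone_recognition (rho : {pmap W -> C})
    (P : htpy R [set point] (fun y => rho (jY y)) base)
    (Q : htpy R set0 (fun k => rho (jK k)) (fun=> point)) :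
  null_square R cpi cp -> hpo_uniq cw cp h ->
  hcomp (hpost (cpm rho) h) (hpre Q cp (@no_set0 _ _)) =h
  hcomp (hpre P cw (@no_set0 _ _)) (hinv (hpre ch cpi (@no_set0 _ _))) ->
  exists e : {pmap C -> W}, homotopy_inverse R e rho /\ forall y, e (base y) = jY y.
Proof.
move=> sq uni rel.
(* [P1] is a null homotopy of [jY u] on [B], hence extends [jY] over the cone. *)
have [P1 [Q1 e1]] := sq _ (jY \po u) jK h.
pose e := @mc_lift R B Y u W jY P1.
have eb y : e (base y) = jY y by exact: mc_lift_base.
have ec z : e (ch z) = P1 z by exact: mc_lift_htpy.
exists e; split=> //.
pose hQ1 := hcast (hpost (cpm rho) Q1) (fun=> pmap_pt rho) (fun=> erefl).
pose hP1 := hcast (hpost (cpm rho) P1) (fun=> pmap_pt rho) (fun=> erefl).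
have step : hcomp (hpre hP1 cpi (@no_set0 _ _))
    (hcomp (hpre P cw (@no_set0 _ _)) (hinv (hpre ch cpi (@no_set0 _ _)))) =h
  hpre (hcomp hQ1 Q) cp (@no_set0 _ _).
  rewrite -rel -hcompA hpre_comp; apply: hcomp_congr => //.
  have := hpost_congr (cpm rho) e1; rewrite hpost_comp => e1'.
  apply: heqh_ext e1' => //; exact: hcomp_ext.
(* This self-homotopy of the constant map is the discrepancy on [B] between the image of the cone
   under [rho e] and the cone itself. Over [X] it factors through [K], so [null_square_loop] makes
   it trivial. *)
have loop0 : hcomp hP1 (hcomp (hpre P (cpm u) u_pt) (hinv ch)) =h
    hid R [set point] (@cst_cts B C point).
  apply: (null_square_loop sq (Q := hcomp hQ1 Q)).
  by rewrite -step; apply: heqh_eq.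
have slide : hcomp hP1 (hpre P (cpm u) u_pt) =h ch.
  apply: (hcompIr (G := hinv ch)).
  by rewrite hcompA loop0 (hcomp_invr ch (@cst_cts B C point)).
split; apply/phomotopicP.
  pose P' := hcast P (fun y => congr1 rho (esym (eb y))) (fun=> erefl).
  apply: (@mc_htpy R B Y u C (rho \po e) (pidm C) P').
  apply: heqh_ext slide => //; apply: hcomp_ext => // z.
  by rewrite -[RHS]/(rho (e (ch z))) ec.
(* For [e rho] the homotopy on [K] passes through the base point, by [Q] under [e] and then [Q1].
   Its compatibility with the one on [Y] is [e] applied to [rel], with the image of the cone
   homotopy rewritten by [e1]. *)
pose P' := hcast (hpost (cpm e) P) (fun=> erefl) eb.
pose Q' := hcomp (hpost (cpm e) Q) (hcast Q1 (fun=> esym (pmap_pt e)) (fun=> erefl)).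
apply: (uni W (e \po rho) (pidm W) P' Q').
pose hx := hcast h (fun x => esym (eb (u (pi x)))) (fun=> erefl).
pose q1 := hcast (hpre Q1 cp (@no_set0 _ _)) (fun=> esym (pmap_pt e)) (fun=> erefl).
have e2 : hcomp (hpost (cpm e) (hpre ch cpi (@no_set0 _ _))) hx =h q1.
  apply: heqh_ext e1 => //; apply: hcomp_ext => // z.
  by rewrite -[RHS]/(e (ch (pi z.1, z.2))) ec.
have e3 := hpost_congr (cpm e) rel.
rewrite !hpost_comp hpost_inv in e3.
have e4 : hcomp (hpost (cpm e) (hpost (cpm rho) h))
    (hcomp (hpost (cpm e) (hpre Q cp (@no_set0 _ _))) q1) =h
  hcomp (hpost (cpm e) (hpre P cw (@no_set0 _ _))) hx.
  by rewrite -hcompA e3 -e2 hcompA hcompKl.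
apply: heqh_ext e4.
  by apply: hcomp_ext.
by apply: hcomp_ext.
Qed.

End ConeRecognition.

(* A neighbourhood of the base point can be deformed to it; unlike
   well-pointedness this is invariant under pointed homotopy equivalence. *)
Definition h_well_pointed (R : realType) (A : ptopologicalType) : Prop :=
  exists (u : A -> R) (d : A -> A) (_ : htpy R [set point] d id),
    [/\ continuous u, u point = 0 & forall a, u a <= 1 -> d a = point].

(** * The null square of a half-smash product *)

Section HalfSmashSquare.
Context (R : realType) (T : topologicalType) (A B : ptopologicalType).
Context (pi : T * A -> B) (cpi : continuous pi).
Hypothesis pi_pt : forall c, pi (c, point) = point.
Hypothesis pi_surj : forall b, exists z, pi z = b.
Hypothesis pi_lift : forall (S : ptopologicalType) (F : T * A -> S),
  continuous F -> (forall c, F (c, point) = point) ->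
  exists G : {pmap B -> S}, forall z, G (pi z) = F z.

Let D : set (T * A) := [set z | z.2 = point].

(** The natural null homotopy at (c, a) runs along [H (c, point)] and back along [H (c, a)]. At the
    base point of [A] this goes out and back without being constant, so it does not descend to [B].
    The function [u] supplies a turning time that vanishes there; where [u a < 1] the paths from
    [d a] and from the base point coincide, which permits the early turn. Keeping [pi] abstract
    covers the half-smash as well as the projection of a one-point space times [A] onto [A]. *)
Lemma halfsmash_null_square :
  h_well_pointed R A -> null_square R cpi (@fst_cts T A).
Proof.
move=> [u [d [Dd [cu u_pt ud]]]] S b psi H.
have cd := htpy_src_cts Dd.
have d_pt : d point = point by rewrite (htpy_D1 (hinv Dd)).
pose cl (r : R) := Num.max 0 (Num.min 1 r).
have cl_cts : continuous cl by rewrite /cl; cts.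
have cl_le0 r : r <= 0 -> cl r = 0.
  by move=> ?; rewrite /cl min_r ?max_l //; lra.
have cl_ge1 r : 1 <= r -> cl r = 1.
  by move=> ?; rewrite /cl min_l ?max_r //; lra.
have cl_ge0 r : 0 <= cl r by rewrite /cl le_max lexx.
have cl_le1 r : cl r <= 1 by rewrite /cl ge_max ler01 ge_min lexx.
pose q (z : T * A) := (z.1, d z.2).
have cq : continuous q by rewrite /q; cts.
pose Hq := hpre H cq (@no_set0 _ _).
have cqp : continuous (fun c : T => (c, point : A)) by cts.
pose Q1 : htpy R (set0 : set T) (fun=> point) psi :=
  hcast (hpre H cqp (@no_set0 _ _))
    (fun c => etrans (congr1 b (pi_pt c)) (pmap_pt b)) (fun=> erefl).
have Q1E c s : Q1 (c, s) = H ((c, point), s) by [].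
have HqE c a s : Hq ((c, a), s) = H ((c, d a), s) by [].
(* The turning time, cut down by [u] for r = 0 and full for r = 1. The two paths meet at this time,
   either because [d a] is the base point or because the end of [H] depends on [c] alone. *)
pose m (r : R) (a : A) := Num.max (cl r) (cl (u a)).
have m_ge0 r a : 0 <= m r a by rewrite /m le_max cl_ge0.
have m_le1 r a : m r a <= 1 by rewrite /m ge_max !cl_le1.
have m_match r c a : Q1 (c, m r a) = Hq ((c, a), m r a).
  rewrite Q1E HqE; case: (leP (u a) 1) => [/ud -> //|/ltW ua].
  have -> : m r a = 1 by rewrite /m (cl_ge1 _ ua) max_r.
  by rewrite !(htpy_ge1 H).
have cm : continuous (fun z : R * A => m z.1 z.2) by rewrite /m; cts.
have cm0 : continuous (m 0) by rewrite /m; cts.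
have m0 a : m 0 a = cl (u a) by rewrite /m cl_le0 // max_r.

(* Follow [Q1 c = H (c, point)] up to the time [m 0 a], go back along
   [H (c, d a)], then along [b (c, -)] from [d a] to [a]: this is constant for
   [a = point], so it descends to [B]. *)
pose trQ_fun (z : (T * A) * R) := Q1 (z.1.1, m 0 z.1.2 * Num.min 1 z.2).
have trQ_cts : continuous trQ_fun.
  by rewrite /trQ_fun; cts; exact: htpy_cts.
have trQ_le0 x t : t <= 0 -> trQ_fun (x, t) = point.
  move=> t0; rewrite /trQ_fun (htpy_le0 Q1) //.
  by rewrite mulr_ge0_le0 ?m_ge0 // ge_min t0 orbT.
have trQ_ge1 x t : 1 <= t -> trQ_fun (x, t) = Q1 (x.1, m 0 x.2).
  by move=> t1; rewrite /trQ_fun -[(x, t).2]/t min_l // mulr1.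
have trQ_D x t : D x -> trQ_fun (x, t) = point.
  move=> x2; rewrite /trQ_fun x2 m0 u_pt cl_le0 // mul0r.
  by rewrite (htpy_le0 Q1).
pose trQ := Htpy trQ_cts trQ_le0 trQ_ge1 trQ_D.
pose trH_fun (z : (T * A) * R) := Hq (z.1, m 0 z.1.2 * Num.min 1 z.2).
have trH_cts : continuous trH_fun.
  by rewrite /trH_fun; cts; exact: htpy_cts.
have trH_le0 x t : t <= 0 -> trH_fun (x, t) = b (pi (q x)).
  move=> t0; rewrite /trH_fun (htpy_le0 Hq) //.
  by rewrite mulr_ge0_le0 ?m_ge0 // ge_min t0 orbT.
have trH_ge1 x t : 1 <= t -> trH_fun (x, t) = Q1 (x.1, m 0 x.2).
  move=> t1; rewrite /trH_fun -[(x, t).2]/t min_l // mulr1.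
  by case: x => c a; rewrite -m_match.
have trH_D x t : D x -> trH_fun (x, t) = b (pi (q x)).
  move=> x2; rewrite /trH_fun x2 m0 u_pt cl_le0 // mul0r.
  by rewrite (htpy_le0 Hq).
pose trH := Htpy trH_cts trH_le0 trH_ge1 trH_D.
pose Bf (z : (T * A) * R) := (z.1.1, Dd (z.1.2, z.2)).
have Bf_cts : continuous Bf by rewrite /Bf; cts; exact: htpy_cts.
have Bf_le0 x t : t <= 0 -> Bf (x, t) = q x by move=> t0; rewrite /Bf (htpy_le0 Dd).
have Bf_ge1 x t : 1 <= t -> Bf (x, t) = x.
  by move=> t1; rewrite /Bf (htpy_ge1 Dd) //; case: x.
have Bf_D x t : D x -> Bf (x, t) = q x by move=> Dx; rewrite /Bf (htpy_D Dd).
pose Bh := Htpy Bf_cts Bf_le0 Bf_ge1 Bf_D.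
have cbpi : continuous (fun x => b (pi x)) by cts.
have cpsi := htpy_tgt_cts Q1.
pose alpha := hcomp trQ (hcomp (hinv trH) (hpost cbpi Bh)).
have alpha_pt c t : alpha ((c, point), t) = point by rewrite (htpy_D alpha).
have [G GE] : exists G : {pmap B -> pfp R S}, forall z, G (pi z) = fpath_of (htpy_cts (h := alpha)) z.
  apply: pi_lift; first exact: fpath_of_cts.
  move=> c; apply: free_path_eq => s.
  by rewrite -[LHS]/(alpha ((c, point), psub_val s)) alpha_pt.
have GpiE z t : G (pi z) (clamp t) = alpha (z, t).
  by rewrite GE -[RHS]htpy_clamp.
have P_cts := @uncurry_cts R B S G (@pmap_cts _ _ G).
have P_le0 x t : t <= 0 -> G x (clamp t) = point.
  by move=> t0; have [z <-] := pi_surj x; rewrite GpiE (htpy_le0 alpha).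
have P_ge1 x t : 1 <= t -> G x (clamp t) = b x.
  by move=> t1; have [z <-] := pi_surj x; rewrite GpiE (htpy_ge1 alpha).
have P_D x t : [set point] x -> G x (clamp t) = point.
  by move=> ->; rewrite pmap_pt.
pose P := @Htpy R B S [set point] (fun=> point) b _ P_cts P_le0 P_ge1 P_D.
exists P, Q1.

pose fB := hpost cbpi (hforget Bh (@no_set0 _ D)).
pose fH := hforget trH (@no_set0 _ D).
pose fQ := hforget trQ (@no_set0 _ D).
(* The end of [H] is independent of the second coordinate, so the naturality square along [Bh] has a
   constant side. *)
have natH : hcomp fB H =h Hq.
  have := hnat cbpi (htpy_tgt_cts H) H cq (@id_cts (T * A)%type)
    (@no_set0 _ (fun x => set0 (q x))) (@no_set0 _ set0)
    (hforget Bh (@no_set0 _ D)).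
  rewrite hpre_id -/fB => e; rewrite -e.
  rewrite -[X in _ =h X](hcomp_idr Hq (htpy_tgt_cts Hq)).
  by apply: hcomp_congr => //; apply: heqh_eq.
(* Raising r from 0 to 1 postpones the turn to the end of the paths. *)
have slide : hcomp fQ (hinv fH) =h
    hcomp (hpre Q1 (@fst_cts T A) (@no_set0 _ (fun x => set0 x.1))) (hinv Hq).
  constructor.
  pose N (z : ((T * A) * R) * R) := if z.1.2 <= 2^-1
    then Q1 (z.1.1.1, m z.2 z.1.1.2 * Num.min 1 (2 * z.1.2))
    else Hq (z.1.1, m z.2 z.1.1.2 * Num.min 1 (1 - (2 * z.1.2 - 1))).
  have cmz : continuous (fun z : ((T * A) * R) * R => m z.2 z.1.1.2).
    by apply: (@comp_cts _ _ _ (fun z : ((T * A) * R) * R => (z.2, z.1.1.2))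
      (fun z => m z.1 z.2)); cts.
  have cN : continuous N.
    apply: glue_le.
    - by cts.
    - by cts.
    - apply: (@comp_cts _ _ _ (fun z : ((T * A) * R) * R =>
        (z.1.1.1, m z.2 z.1.1.2 * Num.min 1 (2 * z.1.2))) Q1); last exact: htpy_cts.
      by apply: pair_cts; [cts|apply: mulR_cts; [exact: cmz|cts]].
    - apply: (@comp_cts _ _ _ (fun z : ((T * A) * R) * R =>
        (z.1.1, m z.2 z.1.1.2 * Num.min 1 (1 - (2 * z.1.2 - 1)))) Hq); last exact: htpy_cts.
      by apply: pair_cts; [cts|apply: mulR_cts; [exact: cmz|cts]].
    - move=> [[[c a] t] r] /= ->.
      rewrite (_ : Num.min 1 (2 * _) = 1); last by rewrite min_l; lra.
      rewrite (_ : Num.min 1 _ = 1); last by rewrite min_l; lra.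
      by rewrite mulr1; exact: m_match.
  have NE c a t r : N (((c, a), t), r) = if t <= 2^-1
    then Q1 (c, m r a * Num.min 1 (2 * t))
    else Hq ((c, a), m r a * Num.min 1 (1 - (2 * t - 1))) by [].
  clearbody N.
  have N_D z r : ends (set0 : set (T * A)) z -> N (z, r) =
      hcomp fQ (hinv fH) z.
    case: z => -[c a] t [t0|[t1|[]]].
      rewrite NE; rewrite /= in t0; rewrite ifT ?hcomp_l; [|by lra|by lra].
      rewrite (htpy_le0 fQ); last by lra.
      rewrite (htpy_le0 Q1) //.
      by rewrite mulr_ge0_le0 ?m_ge0 // ge_min; lra.
    rewrite NE; rewrite /= in t1; rewrite ifF ?hcomp_r; [|by lra|by lra].
    rewrite (htpy_ge1 (hinv fH)); last by lra.
    rewrite (htpy_le0 Hq) //.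
    by rewrite mulr_ge0_le0 ?m_ge0 // ge_min; lra.
  exists N => //.
  + move=> [[c a] t] r r0; rewrite NE; have -> : m r a = m 0 a by rewrite /m (cl_le0 _ r0) (cl_le0 _ (lexx 0)).
    case: (leP t 2^-1) => t2.
      rewrite hcomp_l //.
    rewrite hcomp_r //.
  + move=> [[c a] t] r r0; rewrite NE.
    have -> : m r a = 1 by rewrite /m (cl_ge1 _ r0) max_l.
    rewrite !mul1r; case: leP => t2; [rewrite hcomp_l //|rewrite hcomp_r //].
      by rewrite min_r //; lra.
    by rewrite min_r //; lra.
apply: (RelationClasses.transitivity (y := hcomp (hcomp fQ (hcomp (hinv fH) fB)) H)).
  apply: hcomp_congr => //; apply: heqh_eq => -[x t].
  exact: (GpiE x t).
by rewrite !hcompA natH -hcompA slide hcompVK.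
Qed.
End HalfSmashSquare.

(** * Homotopy pushouts from open covers *)

Section PartialMaps.

Lemma open_local (W S : topologicalType) (U : set W) (f : W -> S) :
  open U -> continuous (fun x : set_type U => f (set_val x)) ->
  forall w, U w -> {for w, continuous f}.
Proof.
move=> oU cf w Uw; have : {within U, continuous f}.
  exact/subspace_sigL_continuousP.
by rewrite continuous_open_subspace // => /(_ w); apply; exact/mem_set.
Qed.

Lemma near_eq_for (W S : topologicalType) (f g : W -> S) (U : set W) (w : W) :
  open U -> U w -> (forall x, U x -> f x = g x) ->
  {for w, continuous g} -> {for w, continuous f}.
Proof.
move=> oU Uw fg cg; rewrite /prop_for /continuous_at (fg _ Uw).
apply: cvg_trans cg; apply: near_eq_cvg.
by apply: filterS (open_nbhs_nbhs (conj oU Uw)) => x Ux; rewrite fg.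
Qed.

Context (W : topologicalType) (A : set W) (oA : open A) (a : W) (Aa : A a).
Context (V : topologicalType) (S : ptopologicalType).

(** Extension by the base point makes a map on an open subspace total; continuity is claimed only at
    points over [A]. *)
Definition pext (g : psub Aa * V -> S) (z : W * V) : S :=
  if pselect (A z.1) is left p then g (psub_in Aa p, z.2) else point.

Lemma pextE g w v (p : A w) : pext g (w, v) = g (psub_in Aa p, v).
Proof.
rewrite /pext; case: pselect => // p'.
by congr (g (_, _)); exact: psub_val_inj.
Qed.

Lemma pext_cts g : continuous g ->
  forall z, A z.1 -> {for z, continuous (pext g)}.
Proof.
move=> cg z Az; pose U := [set z : W * V | A z.1].
have oU : open U.
  by apply: (@open_comp _ _ fst) => // x _; exact: fst_cts.
apply: (open_local oU) => //.
have UA (x : set_type U) : A (set_val x).1 by exact: (set_mem (svalP x)).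
have -> : (fun x : set_type U => pext g (set_val x)) =
    fun x => g (psub_in Aa (UA x), (set_val x).2).
  by apply/funext => x; rewrite -pextE -surjective_pairing.
have cv : continuous (@set_val _ U) by exact: (@initial_continuous (set_type U) _ set_val).
apply: (@comp_cts _ (psub Aa * V)%type _ (fun x => (psub_in Aa (UA x), (set_val x).2))) => //.
apply: (@pair_cts _ (psub Aa) V).
  by apply: psub_cts; apply: comp_cts cv _; exact: fst_cts.
by apply: comp_cts cv _; exact: snd_cts.
Qed.

End PartialMaps.

Section Glue3.
Context (R : realType) (W S : topologicalType) (t : W -> R) (ct : continuous t).
Context (F0 F1 : W -> S) (F : W * R -> S).
Hypothesis F0_cts : forall w, 0 < t w -> {for w, continuous F0}.
Hypothesis F1_cts : forall w, t w < 1 -> {for w, continuous F1}.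
Hypothesis F_cts : forall z, 0 < t z.1 < 1 -> {for z, continuous F}.
Hypothesis F_le0 : forall w s, 0 < t w < 1 -> s <= 0 -> F (w, s) = F0 w.
Hypothesis F_ge1 : forall w s, 0 < t w < 1 -> 1 <= s -> F (w, s) = F1 w.

(** The homotopy is spent on the middle third: 2 - 3 t runs from 0 at t = 2/3 to 1 at t = 1/3. Thus
    the map is [F0] above 2/3 and [F1] below 1/3, and near each point it equals, on an open set, a
    single map continuous there. *)
Definition glue3 (w : W) : S :=
  if 1 <= t w then F0 w else if t w <= 0 then F1 w else F (w, 2 - 3 * t w).

Lemma glue3_ge1 w : 1 <= t w -> glue3 w = F0 w.
Proof. by rewrite /glue3 => ->. Qed.

Lemma glue3_le0 w : t w <= 0 -> glue3 w = F1 w.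
Proof. by move=> t0; rewrite /glue3 t0 ifF //; lra. Qed.

Lemma glue3_mid w : 0 < t w < 1 -> glue3 w = F (w, 2 - 3 * t w).
Proof. by move=> /andP[t0 t1]; rewrite /glue3 leNgt t1 /= leNgt t0. Qed.

Lemma glue3_0 w : 2 / 3 <= t w -> glue3 w = F0 w.
Proof.
move=> t0; case: (leP 1 (t w)) => t1; first by rewrite /glue3 t1.
have tw : 0 < t w < 1 by lra.
by rewrite glue3_mid // F_le0 //; lra.
Qed.

Lemma glue3_1 w : t w <= 1 / 3 -> glue3 w = F1 w.
Proof.
move=> t0; case: (leP (t w) 0) => t1; first by rewrite /glue3 t1 ifF //; lra.
have tw : 0 < t w < 1 by lra.
by rewrite glue3_mid // F_ge1 //; lra.
Qed.

Lemma glue3_cts : continuous glue3.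
Proof.
have o_gt (c : R) : open [set w | c < t w].
  by apply: (@open_comp _ _ t [set y | c < y]) => [w _|]; [exact: ct|exact: open_gt].
have o_lt (c : R) : open [set w | t w < c].
  by apply: (@open_comp _ _ t [set y | y < c]) => [w _|]; [exact: ct|exact: open_lt].
move=> w; case: (ltP (2 / 3) (t w)) => t0.
  apply: (near_eq_for (o_gt (2 / 3)) t0) => [x /= /ltW|]; first exact: glue3_0.
  by apply: F0_cts; lra.
case: (ltP (t w) (1 / 3)) => t1.
  apply: (near_eq_for (o_lt (1 / 3)) t1) => [x /= /ltW|]; first exact: glue3_1.
  by apply: F1_cts; lra.
have tw : 0 < t w < 1 by lra.
apply: (@near_eq_for _ _ _ (fun w => F (w, 2 - 3 * t w)) ([set w | 0 < t w] `&` [set w | t w < 1])).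
- by apply: openI.
- by case/andP: tw.
- by move=> x [x0 x1]; rewrite glue3_mid //; apply/andP.
- apply: (@continuous_comp _ _ _ (fun w => (w, 2 - 3 * t w)) F w).
    suff c : continuous (fun w => (w, 2 - 3 * t w)) by exact: c.
    by cts.
  exact: F_cts.
Qed.

End Glue3.

Section Cover.
Context (R : realType) (W : ptopologicalType) (t : W -> R) (ct : continuous t).
Context (tp : [set w | 0 < t w] point) (t_pt : 1 <= t point).
Context (w1 : W) (tw1 : [set w | t w < 1] w1).
Context (w01 : W) (tw01 : [set w | 0 < t w < 1] w01).

Let W0 := psub tp.
Let W1 := psub tw1.
Let W01 := psub tw01.

Lemma gt0_open (c : R) : open [set w | c < t w].
Proof. by apply: (@open_comp _ _ t [set y | c < y]) => [w _|]; [exact: ct|exact: open_gt]. Qed.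

Lemma lt1_open (c : R) : open [set w | t w < c].
Proof. by apply: (@open_comp _ _ t [set y | y < c]) => [w _|]; [exact: ct|exact: open_lt]. Qed.

Lemma mid_open : open [set w | 0 < t w < 1].
Proof.
rewrite (_ : [set w | _] = [set w | 0 < t w] `&` [set w | t w < 1]).
  by apply: openI; [exact: gt0_open|exact: lt1_open].
by apply/seteqP; split => w /=; [move=> /andP[]|move=> [-> ->]].
Qed.

Lemma mid_gt0 (z : W01) : [set w | 0 < t w] (psub_val z).
Proof. by have /andP[] := psub_valP z. Qed.

Lemma mid_lt1 (z : W01) : [set w | t w < 1] (psub_val z).
Proof. by have /andP[] := psub_valP z. Qed.

Definition mid_in0 (z : W01) : W0 := psub_in tp (mid_gt0 z).
Definition mid_in1 (z : W01) : W1 := psub_in tw1 (mid_lt1 z).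

Lemma mid_in0_cts : continuous mid_in0.
Proof. by apply: psub_cts; exact: psub_val_cts. Qed.

Lemma mid_in1_cts : continuous mid_in1.
Proof. by apply: psub_cts; exact: psub_val_cts. Qed.

Lemma cover_ind (P : W -> Prop) :
  (forall z : W0, 2 / 3 <= t (psub_val z) -> P (psub_val z)) ->
  (forall z : W1, t (psub_val z) <= 1 / 3 -> P (psub_val z)) ->
  (forall z : W01, P (psub_val z)) -> forall w, P w.
Proof.
move=> P0 P1 P01 w; case: (leP 1 (t w)) => t1'.
  have p : [set w | 0 < t w] w by rewrite /=; lra.
  by apply: (P0 (psub_in tp p)); rewrite /=; lra.
case: (leP (t w) 0) => t0'.
  have p : [set w | t w < 1] w by rewrite /=; lra.
  by apply: (P1 (psub_in tw1 p)); rewrite /=; lra.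
have p : [set w | 0 < t w < 1] w by rewrite /=; lra.
exact: (P01 (psub_in tw01 p)).
Qed.

Definition val0 : {pmap W0 -> W} := @PMap W0 W (@psub_val _ _ _ tp) (@psub_val_cts _ _ _ tp) erefl.

Section CoverGlue.
Context (S : ptopologicalType) (F0 : W0 -> S) (F1 : W1 -> S).
Context (cF0 : continuous F0) (cF1 : continuous F1).
Context (F : htpy R set0 (fun z => F0 (mid_in0 z)) (fun z => F1 (mid_in1 z))).

Let f0 (w : W) : S := pext (Aa := tp) (fun z : W0 * R => F0 z.1) (w, 0).
Let f1 (w : W) : S := pext (Aa := tw1) (fun z : W1 * R => F1 z.1) (w, 0).
Let f (z : W * R) : S := pext (Aa := tw01) F z.

Let cinc (w : W) : {for w, continuous (fun w : W => (w, 0 : R))}.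
Proof.
suff c : continuous (fun w : W => (w, 0 : R)) by exact: c.
by cts.
Qed.

Let f0_cts w : 0 < t w -> {for w, continuous f0}.
Proof.
move=> w0; apply: (@continuous_comp _ _ _ (fun w => (w, 0 : R))); first exact: cinc.
apply: (@pext_cts W _ (gt0_open 0) _ tp R S) => //.
by cts.
Qed.

Let f1_cts w : t w < 1 -> {for w, continuous f1}.
Proof.
move=> w0; apply: (@continuous_comp _ _ _ (fun w => (w, 0 : R))); first exact: cinc.
apply: (@pext_cts W _ (lt1_open 1) _ tw1 R S) => //.
by cts.
Qed.

Let f_cts z : 0 < t z.1 < 1 -> {for z, continuous f}.
Proof.
move=> z0; apply: (@pext_cts W _ mid_open _ tw01 R S) => //.
exact: htpy_cts.
Qed.

Let f0E w (p : 0 < t w) : f0 w = F0 (psub_in tp p).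
Proof. exact: (@pextE _ _ _ tp). Qed.

Let f1E w (p : t w < 1) : f1 w = F1 (psub_in tw1 p).
Proof. exact: (@pextE _ _ _ tw1). Qed.

Let fE w s (p : 0 < t w < 1) : f (w, s) = F (psub_in tw01 p, s).
Proof. exact: (@pextE _ _ _ tw01). Qed.

Let f_le0 w s : 0 < t w < 1 -> s <= 0 -> f (w, s) = f0 w.
Proof.
move=> p s0; rewrite fE (htpy_le0 F) //; have /andP[p0 _] := p.
by rewrite (f0E p0); congr F0; exact: psub_val_inj.
Qed.

Let f_ge1 w s : 0 < t w < 1 -> 1 <= s -> f (w, s) = f1 w.
Proof.
move=> p s0; rewrite fE (htpy_ge1 F) //; have /andP[_ p1] := p.
by rewrite (f1E p1); congr F1; exact: psub_val_inj.
Qed.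

Definition cover_glue : W -> S := glue3 t f0 f1 f.

Lemma cover_glue_cts : continuous cover_glue.
Proof. exact: glue3_cts. Qed.

Lemma cover_glue0 (z : W0) : 2 / 3 <= t (psub_val z) -> cover_glue (psub_val z) = F0 z.
Proof.
move=> tz; rewrite /cover_glue glue3_0 // (f0E (psub_valP z)).
by congr F0; exact: psub_val_inj.
Qed.

Lemma cover_glue1 (z : W1) : t (psub_val z) <= 1 / 3 -> cover_glue (psub_val z) = F1 z.
Proof.
move=> tz; rewrite /cover_glue glue3_1 // (f1E (psub_valP z)).
by congr F1; exact: psub_val_inj.
Qed.

Lemma cover_glue01 (z : W01) :
  cover_glue (psub_val z) = F (z, 2 - 3 * t (psub_val z)).
Proof.
rewrite /cover_glue glue3_mid; last exact: (psub_valP z).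
by rewrite (fE _ (psub_valP z)); congr (F (_, _)); exact: psub_val_inj.
Qed.

(* Raising the cutting function to 1, resp. lowering it to 0, shows that the
   glued map restricts to [F0], resp. [F1], up to homotopy. *)
Let t0 (z : W0 * R) : R := Num.max (t (psub_val z.1)) (Num.min 1 z.2).
Let t1 (z : W1 * R) : R := Num.min (t (psub_val z.1)) (1 - z.2).

Let slide0_fun : W0 * R -> S :=
  glue3 t0 (fun z : W0 * R => f0 (psub_val z.1)) (fun z : W0 * R => f1 (psub_val z.1))
    (fun z : (W0 * R) * R => f (psub_val z.1.1, z.2)).

Let slide1_fun : W1 * R -> S :=
  glue3 t1 (fun z : W1 * R => f0 (psub_val z.1)) (fun z : W1 * R => f1 (psub_val z.1))
    (fun z : (W1 * R) * R => f (psub_val z.1.1, z.2)).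

Let v0_cts : continuous (fun z : W0 * R => psub_val z.1).
Proof. by apply: (comp_cts (@fst_cts W0 R)); exact: psub_val_cts. Qed.

Let v1_cts : continuous (fun z : W1 * R => psub_val z.1).
Proof. by apply: (comp_cts (@fst_cts W1 R)); exact: psub_val_cts. Qed.

Let slide0_cts : continuous slide0_fun.
Proof.
have t0_lt z : t0 z < 1 -> 0 < t (psub_val z.1) < 1.
  move=> z1; have p := psub_valP z.1; apply/andP; split=> //.
  by move: z1; rewrite /t0 gt_max => /andP[].
apply: glue3_cts.
- by apply: maxR_cts; [exact: comp_cts v0_cts ct|cts].
- move=> z _; apply: (@continuous_comp _ _ _ (fun z : W0 * R => psub_val z.1)).
    exact: v0_cts.
  exact/f0_cts/(psub_valP z.1).
- move=> z /t0_lt/andP[_ z1]; apply: (@continuous_comp _ _ _ (fun z : W0 * R => psub_val z.1)).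
    exact: v0_cts.
  exact/f1_cts.
- move=> z /andP[_ /t0_lt z1].
  apply: (@continuous_comp _ _ _ (fun z : (W0 * R) * R => (psub_val z.1.1, z.2))); last exact: f_cts.
  suff c : continuous (fun z : (W0 * R) * R => (psub_val z.1.1, z.2)) by exact: c.
  by apply: pair_cts; [apply: (comp_cts _ v0_cts)|]; cts.
- by move=> z r /andP[_ /t0_lt z1] r0; exact: f_le0.
- by move=> z r /andP[_ /t0_lt z1] r0; exact: f_ge1.
Qed.

Let slide1_cts : continuous slide1_fun.
Proof.
have t1_gt z : 0 < t1 z -> 0 < t (psub_val z.1) < 1.
  move=> z1; have p := psub_valP z.1; apply/andP; split=> //.
  by move: z1; rewrite /t1 lt_min => /andP[].
apply: glue3_cts.
- by apply: minR_cts; [exact: comp_cts v1_cts ct|cts].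
- move=> z /t1_gt/andP[z1 _]; apply: (@continuous_comp _ _ _ (fun z : W1 * R => psub_val z.1)).
    exact: v1_cts.
  exact/f0_cts.
- move=> z _; apply: (@continuous_comp _ _ _ (fun z : W1 * R => psub_val z.1)).
    exact: v1_cts.
  exact/f1_cts/(psub_valP z.1).
- move=> z /andP[/t1_gt z1 _].
  apply: (@continuous_comp _ _ _ (fun z : (W1 * R) * R => (psub_val z.1.1, z.2))); last exact: f_cts.
  suff c : continuous (fun z : (W1 * R) * R => (psub_val z.1.1, z.2)) by exact: c.
  by apply: pair_cts; [apply: (comp_cts _ v1_cts)|]; cts.
- by move=> z r /andP[/t1_gt z1 _] r0; exact: f_le0.
- by move=> z r /andP[/t1_gt z1 _] r0; exact: f_ge1.
Qed.

Let slide0_le0 x r : r <= 0 -> slide0_fun (x, r) = cover_glue (psub_val x).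
Proof.
move=> r0; have p : 0 < t (psub_val x) by exact: (psub_valP x).
have e : t0 (x, r) = t (psub_val x).
  by rewrite /t0 max_l // ge_min; apply/orP; right; exact: le_trans r0 (ltW p).
by rewrite /slide0_fun /cover_glue /glue3 e.
Qed.

Let slide0_ge1 x r : 1 <= r -> slide0_fun (x, r) = F0 x.
Proof.
move=> r1; rewrite /slide0_fun glue3_0; last 2 first.
- by move=> z s /andP[_ z1] s0; apply: f_le0 => //; move: z1; rewrite /t0 gt_max =>
    /andP[-> _]; rewrite andbT; exact: (psub_valP z.1).
- by rewrite /t0 le_max; apply/orP; right; rewrite [X in _ <= X]min_l //; lra.
by rewrite (f0E (psub_valP x)); congr F0; exact: psub_val_inj.
Qed.

Let slide0_D x r : [set x : W0 | 1 <= t (psub_val x)] x ->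
  slide0_fun (x, r) = cover_glue (psub_val x).
Proof.
move=> /= x1; rewrite /slide0_fun /cover_glue /glue3 x1 ifT //.
by rewrite /t0 le_max x1.
Qed.

Definition cover_slide0 :
    htpy R [set x : W0 | 1 <= t (psub_val x)] (fun x => cover_glue (psub_val x)) F0 :=
  Htpy slide0_cts slide0_le0 slide0_ge1 slide0_D.

Let slide1_le0 x r : r <= 0 -> slide1_fun (x, r) = cover_glue (psub_val x).
Proof.
move=> r0; have p : t (psub_val x) < 1 by exact: (psub_valP x).
have e : t1 (x, r) = t (psub_val x) by rewrite /t1 min_l //= ; lra.
by rewrite /slide1_fun /cover_glue /glue3 e.
Qed.

Let slide1_ge1 x r : 1 <= r -> slide1_fun (x, r) = F1 x.
Proof.
move=> r1; rewrite /slide1_fun glue3_1; last 2 first.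
- by move=> z s /andP[z1 _] s0; apply: f_ge1 => //; move: z1; rewrite /t1 lt_min =>
    /andP[-> _]; exact: (psub_valP z.1).
- by rewrite /t1 ge_min; apply/orP; right => /=; lra.
by rewrite (f1E (psub_valP x)); congr F1; exact: psub_val_inj.
Qed.

Let slide1_D x r : (set0 : set W1) x -> slide1_fun (x, r) = cover_glue (psub_val x).
Proof. by []. Qed.

Definition cover_slide1 : htpy R set0 (fun x : W1 => cover_glue (psub_val x)) F1 :=
  Htpy slide1_cts slide1_le0 slide1_ge1 slide1_D.

Let slide0E z r : cover_slide0 (mid_in0 z, r) =
  F (z, 2 - 3 * Num.max (t (psub_val z)) (Num.min 1 r)).
Proof.
have zp := psub_valP z; have /andP[z0 z1] := zp.
have e s : f (psub_val z, s) = F (z, s).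
  by rewrite (fE _ zp); congr (F (_, _)); exact: psub_val_inj.
rewrite -[LHS]/(slide0_fun _) /slide0_fun /glue3 -[t0 _]/(Num.max (t (psub_val z)) (Num.min 1 r)).
set m := Num.max _ _.
have m0 : 0 < m by rewrite /m lt_max z0.
rewrite [m <= 0]leNgt m0 /=; case: leP => m1.
  rewrite -[LHS]/(f0 (psub_val z)) -(f_le0 zp (lexx 0)) e !(htpy_le0 F) //; lra.
exact: e.
Qed.

Let slide1E z r : cover_slide1 (mid_in1 z, r) =
  F (z, 2 - 3 * Num.min (t (psub_val z)) (1 - r)).
Proof.
have zp := psub_valP z; have /andP[z0 z1] := zp.
have e s : f (psub_val z, s) = F (z, s).
  by rewrite (fE _ zp); congr (F (_, _)); exact: psub_val_inj.
rewrite -[LHS]/(slide1_fun _) /slide1_fun /glue3 -[t1 _]/(Num.min (t (psub_val z)) (1 - r)).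
set m := Num.min _ _.
have m0 : m < 1 by rewrite /m gt_min z1.
rewrite [1 <= m]leNgt m0 /=; case: leP => m1.
  rewrite -[LHS]/(f1 (psub_val z)) -(f_ge1 zp (lexx 1)) e !(htpy_ge1 F) //; lra.
exact: e.
Qed.

(** Over a fixed point of the intersection both sides only move the parameter of [F], so the two
    reparametrisations can be joined linearly. *)
Lemma cover_slideE :
  hcomp (hpre cover_slide0 mid_in0_cts (@no_set0 _ _)) F =h
  hpre cover_slide1 mid_in1_cts (@no_set0 _ _).
Proof.
(* On the left, raising the cutting function to 1 first lowers 2 - 3 t to -1, then [F] is traversed
   with parameter 2 s - 1. One maximum describes both phases because [F] rests at parameters below
   0. *)
apply: (@heq_convex _ _ _ _ F
  (fun z => Num.max (2 - 3 * Num.max (t (psub_val z.1)) (Num.min 1 (2 * z.2))) (2 * z.2 - 1))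
  (fun z => 2 - 3 * Num.min (t (psub_val z.1)) (1 - z.2))).
- exact: htpy_cts.
- have cv : continuous (fun z : W01 * R => t (psub_val z.1)).
    by apply: comp_cts ct; apply: (comp_cts (@fst_cts W01 R)); exact: psub_val_cts.
  by apply: maxR_cts; [apply: subR_cts; [cts|apply: mulR_cts; [cts|apply: maxR_cts; [exact: cv|cts]]]|cts].
- have cv : continuous (fun z : W01 * R => t (psub_val z.1)).
    by apply: comp_cts ct; apply: (comp_cts (@fst_cts W01 R)); exact: psub_val_cts.
  by apply: subR_cts; [cts|apply: mulR_cts; [cts|apply: minR_cts; [exact: cv|cts]]].
- move=> [z s]; rewrite -[(z, s).1]/z -[(z, s).2]/s.
  have /andP[z0 z1] := psub_valP z; set a := t _ in z0 z1 *.
  case: (leP s 2^-1) => s2.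
    rewrite hcomp_l // [LHS]slide0E -/a; set b := 2 - _.
    case: (leP b 0) => b0; last by rewrite max_l //; lra.
    by rewrite !(htpy_le0 F) // ge_max b0; lra.
  have -> : Num.max a (Num.min 1 (2 * s)) = 1.
    by rewrite min_l ?max_r //; [exact: ltW|lra].
  by rewrite hcomp_r // max_r //; lra.
- by move=> [z s]; exact: slide1E.
- move=> [z s] r e r01.
  rewrite -[(z, s).1]/z -[(z, s).2]/s; rewrite /ends /= in e.
  have /andP[z0 z1] := psub_valP z; set a := t _ in z0 z1 *.
  case: e => [s0|[s1|[]]].
    have -> : Num.max a (Num.min 1 (2 * s)) = a.
      by apply/max_l; rewrite ge_min; lra.
    have -> : Num.min a (1 - s) = a by apply/min_l; lra.
    rewrite hcomp_l; last by lra.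
    rewrite [RHS]slide0E -/a (_ : Num.max a (Num.min 1 (2 * s)) = a); last first.
      by apply/max_l; rewrite ge_min; lra.
    case: (leP (2 - 3 * a) 0) => b0.
      rewrite !(htpy_le0 F) //.
      have : Num.max (2 - 3 * a) (2 * s - 1) <= 0 by rewrite ge_max b0; lra.
      by move=> c0; nra.
    by rewrite max_l; [congr (F (_, _)); lra|lra].
  rewrite hcomp_r; last by lra.
  have -> : Num.max a (Num.min 1 (2 * s)) = 1.
    by rewrite min_l ?max_r //; [exact: ltW|lra].
  rewrite max_r; last by lra.
  have -> : Num.min a (1 - s) = 1 - s by apply/min_r; lra.
  by rewrite !(htpy_ge1 F) //; nra.
Qed.

End CoverGlue.
End Cover.

Section CoverHpo.
Context (R : realType) (W : ptopologicalType) (t : W -> R) (ct : continuous t).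
Context (tp : [set w | 0 < t w] point) (t_pt : 1 <= t point).
Context (w1 : W) (tw1 : [set w | t w < 1] w1).
Context (w01 : W) (tw01 : [set w | 0 < t w < 1] w01).
Local Notation W0 := (psub tp).
Local Notation W1 := (psub tw1).
Local Notation W01 := (psub tw01).
Local Notation i0 := (@mid_in0 R W t tp w01 tw01).
Local Notation i1 := (@mid_in1 R W t w1 tw1 w01 tw01).
Local Notation ci0 := (@mid_in0_cts R W t tp w01 tw01).
Local Notation ci1 := (@mid_in1_cts R W t w1 tw1 w01 tw01).
Local Notation no := (@no_set0 _ _).

Context (Y : ptopologicalType) (X K : topologicalType).
Context (w : X -> Y) (cw : continuous w) (p : X -> K) (cp : continuous p).
Context (v : {pmap Y -> W0}) (k : K -> W1) (i : X -> W01).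
Context (Ev : heqv R [set point] [set point] v) (Ek : heqv R set0 set0 k).
Context (Ei : heqv R set0 set0 i).
Context (h0 : htpy R set0 (fun x => i0 (i x)) (fun x => v (w x))).
Context (h1 : htpy R set0 (fun x => i1 (i x)) (fun x => k (p x))).

Let ci := hq_cts Ei.
Let ck := hq_cts Ek.
Let cval0 : continuous (fun x : W0 => psub_val x) := @psub_val_cts _ _ _ tp.
Let cval1 : continuous (fun x : W1 => psub_val x) := @psub_val_cts _ _ _ tw1.

Definition cover_base : {pmap Y -> W} := val0 tp \po v.
Definition cover_top (c : K) : W := psub_val (k c).
Definition cover_htpy : htpy R set0 (fun x => cover_base (w x)) (fun x => cover_top (p x)) :=
  hcomp (hinv (hpost cval0 h0)) (hpost cval1 h1).

(** Precomposition with the equivalences [v] and [k] is full, which extends [P] and [Q] to the two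
    open sets; precomposition with [i] is faithful, which makes the extensions agree on the
    intersection up to homotopy. They are then glued as maps into the path space of [S]. *)
Theorem cover_hpo_uniq : hpo_uniq cw cp cover_htpy.
Proof.
move=> S t1 t2 P Q e.
have ct1 := @pmap_cts _ _ t1; have ct2 := @pmap_cts _ _ t2.
have c10 := comp_cts cval0 ct1; have c20 := comp_cts cval0 ct2.
have c11 := comp_cts cval1 ct1; have c21 := comp_cts cval1 ct2.
have [P0 P0E] := heqv_full Ev c10 c20 P.
have [Q0 Q0E] := heqv_full Ek c11 c21 Q.
have cv := @pmap_cts _ _ v.
have nP := hnat c10 c20 P0 (comp_cts ci ci0) (comp_cts cw cv) no no h0.
have nQ := hnat c11 c21 Q0 (comp_cts ci ci1) (comp_cts cp ck) no no h1.
pose a1 := hpost ct1 (hpost cval0 h0); pose a2 := hpost ct2 (hpost cval0 h0).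
pose b1 := hpost ct1 (hpost cval1 h1); pose b2 := hpost ct2 (hpost cval1 h1).
pose Pw := hpre P cw (@no_set0 _ (fun x => [set point] (w x))).
pose Qp := hpre Q cp (@no_set0 _ (fun x => set0 (p x))).
pose Pi := hpre P0 (comp_cts ci ci0) (@no_set0 _ (fun x => [set point] (i0 (i x)))).
pose Qi := hpre Q0 (comp_cts ci ci1) (@no_set0 _ (fun x => set0 (i1 (i x)))).
have {}nP : hcomp Pi a2 =h hcomp a1 Pw.
  apply: (heq_trans nP); apply: (hcomp_congr (F := a1)) => //.
  exact: (hpre_congr cw (@no_set0 _ (fun x => [set point] (w x))) P0E).
have {}nQ : hcomp Qi b2 =h hcomp b1 Qp.
  apply: (heq_trans nQ); apply: (hcomp_congr (F := b1)) => //.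
  exact: (hpre_congr cp (@no_set0 _ (fun x => set0 (p x))) Q0E).
have {}e : hcomp (hcomp (hinv a1) b1) Qp =h hcomp Pw (hcomp (hinv a2) b2).
  have e1 := hpost_comp (hinv (hpost cval0 h0)) (hpost cval1 h1) ct1.
  have e2 := hpost_comp (hinv (hpost cval0 h0)) (hpost cval1 h1) ct2.
  apply: (heq_trans (hcomp_congr (heq_sym e1) (heqh_refl Qp))).
  by apply: (heq_trans e); exact: (hcomp_congr (heqh_refl Pw) e2).
have PQi : Pi =h Qi.
  apply: (hcompIr (G := b2)); rewrite nQ -(hcompVKl a1 (hcomp b1 Qp)).
  rewrite -(hcompA (hinv a1) b1 Qp) e -(hcompA a1 Pw) -nP (hcompA Pi a2).
  by rewrite hcompVKl.
have PQ : hpre P0 ci0 (@no_set0 _ (fun x => [set point] (i0 x))) =h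
    hpre Q0 ci1 (@no_set0 _ (fun x => set0 (i1 x))).
  exact: (heqv_faithful (E := Ei)).
have [M] := PQ.
pose F0 := fpath_of (htpy_cts (h := P0)); pose F1 := fpath_of (htpy_cts (h := Q0)).
have cF0 : continuous F0 := fpath_of_cts (htpy_cts (h := P0)).
have cF1 : continuous F1 := fpath_of_cts (htpy_cts (h := Q0)).
(* With its parameters exchanged [M] becomes a homotopy, over the intersection, between two maps
   into the path space. *)
pose N (z : (W01 * R) * R) := M ((z.1.1, z.2), z.1.2).
have cN : continuous N by rewrite /N; cts; exact: htpy_cts.
have N_le0 x s : s <= 0 -> fpath_of cN (x, s) = F0 (i0 x).
  by move=> s0; apply: free_path_eq => r;
    rewrite -[LHS]/(M ((x, psub_val r), s)) (htpy_le0 M).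
have N_ge1 x s : 1 <= s -> fpath_of cN (x, s) = F1 (i1 x).
  by move=> s0; apply: free_path_eq => r;
    rewrite -[LHS]/(M ((x, psub_val r), s)) (htpy_ge1 M).
have N_D x s : (set0 : set W01) x -> fpath_of cN (x, s) = F0 (i0 x) by [].
pose Nh := Htpy (fpath_of_cts cN) N_le0 N_ge1 N_D.
pose tau : W -> pfp R S := cover_glue (tw01 := tw01) Nh.
have ctau : continuous tau by exact: cover_glue_cts.
(* At the times 0 and 1 [M] is stationary, so the gluing does not disturb the end maps. *)
have tauE r g : (forall z, P0 (z, psub_val r) = g (psub_val z)) ->
    (forall z, Q0 (z, psub_val r) = g (psub_val z)) ->
    (psub_val r = 0 \/ psub_val r = 1) -> forall x, tau x r = g x.
  move=> P0r Q0r r01; apply: (@cover_ind _ _ t tp w1 tw1 w01 tw01 (fun x => tau x r = g x)) => z.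
  - by move=> z0; rewrite /tau cover_glue0 // -[RHS]P0r.
  - by move=> z0; rewrite /tau cover_glue1 // -[RHS]Q0r.
  rewrite /tau cover_glue01 -[LHS]/(M ((z, psub_val r), _)) (htpy_D M).
    exact: (P0r (i0 z)).
  by case: r01 => ->; [left|right; left] => /=.
constructor; exists (fun z => tau z.1 (clamp z.2)).
- exact: (@uncurry_cts R W S tau).
- move=> x s s0; rewrite -[(x, s).1]/x -[(x, s).2]/s clamp_le0 //; move: x.
  apply: tauE; [| |by left].
    by move=> z; rewrite (htpy_le0 P0).
  by move=> z; rewrite (htpy_le0 Q0).
- move=> x s s0; rewrite -[(x, s).1]/x -[(x, s).2]/s clamp_ge1 //; move: x.
  apply: tauE; [| |by right].
    by move=> z; rewrite (htpy_ge1 P0).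
  by move=> z; rewrite (htpy_ge1 Q0).
- move=> x s ->; rewrite -[(point, s).1]/point.
  have -> : tau point = F0 point.
    have t23 : 2 / 3 <= t point by apply: le_trans t_pt; lra.
    exact: (@cover_glue0 _ _ _ tp _ _ _ _ _ _ _ _ (point : W0) t23).
  by rewrite -[LHS]/(P0 (point, psub_val (clamp s))) (htpy_D P0).
Qed.

(** On the open sets take [phi] and [psi] after the homotopy inverses of [v] and [k]. Conjugating
    [H] by [h0], [h1] and the counits gives a homotopy over [X] between them, and fullness of
    precomposition with [i] carries it to the intersection, where it glues the two maps. The slides
    provide [P] and [Q]. *)
Theorem cover_hpo_exist : hpo_exist cw cp cover_htpy.
Proof.
move=> S phi psi H cpsi.
pose r := hq_inv Ev; pose cr : continuous r := hq_inv_cts Ev.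
pose c := hq_inv Ek; pose cc : continuous c := hq_inv_cts Ek.
have cphi := @pmap_cts _ _ phi.
have cphr := comp_cts cr cphi; have cpsc := comp_cts cc cpsi.
have r_pt : r point = point by exact: (hq_inv_D Ev erefl).
pose phr := hpost cphr h0; pose psc := hpost cpsc h1.
pose eph := hpre (hpost cphi (hq_counit Ev)) cw (@no_set0 _ (fun x => [set point] (w x))).
pose eps := hpre (hpost cpsi (hq_counit Ek)) cp (@no_set0 _ (fun x => set0 (p x))).
pose H0 := hcomp phr (hcomp eph (hcomp H (hcomp (hinv eps) (hinv psc)))).
have [H1 H1E] := heqv_full Ei (comp_cts ci0 cphr) (comp_cts ci1 cpsc) H0.
pose F0 (x : W0) := phi (r x); pose F1 (x : W1) := psi (c x).
pose Hm : htpy R set0 (fun z => F0 (i0 z)) (fun z => F1 (i1 z)) := H1.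
pose tau0 : W -> S := cover_glue (tw01 := tw01) (F0 := F0) (F1 := F1) Hm.
have ctau0 : continuous tau0.
  by apply: cover_glue_cts; [exact: ct|exact: cphr|exact: cpsc].
have tau0_pt : tau0 point = point.
  have t23 : 2 / 3 <= t point by apply: le_trans t_pt; lra.
  apply: (eq_trans (@cover_glue0 _ _ _ tp _ _ _ _ _ _ _ _ (point : W0) t23)).
  by rewrite /F0 r_pt pmap_pt.
pose tau := PMap ctau0 tau0_pt.
pose sl0 := cover_slide0 ct cphr cpsc Hm.
pose sl1 := cover_slide1 ct cphr cpsc Hm.
have cv := @pmap_cts _ _ v.
have sl0D (x : W0) : [set point] x -> [set x : W0 | 1 <= t (psub_val x)] x.
  by move=> ->; exact: t_pt.
pose sl0' : htpy R [set point] (fun x : W0 => tau (psub_val x)) (fun x => phi (r x)) :=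
  hforget sl0 sl0D.
pose P : htpy R [set point] (fun y => tau (cover_base y)) phi :=
  hcomp (hpre sl0' cv (fun y (e : [set point] y) => etrans (congr1 v e) (pmap_pt v)))
    (hpost cphi (hq_counit Ev)).
pose Q : htpy R set0 (fun y => tau (cover_top y)) psi :=
  hcomp (hpre sl1 ck (@no_set0 _ (fun x => set0 (k x)))) (hpost cpsi (hq_counit Ek)).
exists tau, P, Q.
have nP := hnat (comp_cts cval0 ctau0) cphr sl0' (comp_cts ci ci0) (comp_cts cw cv) no no h0.
have nQ := hnat (comp_cts cval1 ctau0) cpsc sl1 (comp_cts ci ci1) (comp_cts cp ck) no no h1.
pose Pi := hpre sl0' (comp_cts ci ci0) (@no_set0 _ (fun x => [set point] (i0 (i x)))).
pose Qi := hpre sl1 (comp_cts ci ci1) (@no_set0 _ (fun x => set0 (i1 (i x)))).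
pose Pv := hpre sl0' (comp_cts cw cv) (@no_set0 _ (fun x => [set point] (v (w x)))).
pose Qk := hpre sl1 (comp_cts cp ck) (@no_set0 _ (fun x => set0 (k (p x)))).
pose a := hpost ctau0 (hpost cval0 h0); pose b := hpost ctau0 (hpost cval1 h1).
have {}nP : hcomp Pi phr =h hcomp a Pv by exact: nP.
have {}nQ : hcomp Qi psc =h hcomp b Qk by exact: nQ.
have slE : hcomp Pi H0 =h Qi.
  have e := hpre_congr ci (@no_set0 _ (fun x => set0 (i x))) (cover_slideE ct cphr cpsc Hm).
  apply: heq_trans e; apply: (heq_trans (hcomp_congr (heqh_refl Pi) (heq_sym H1E))).
  exact: heqh_refl.
suff e : hcomp (hcomp (hinv a) b) (hcomp Qk eps) =h hcomp (hcomp Pv eph) H.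
  have e1 := hpost_comp (hinv (hpost cval0 h0)) (hpost cval1 h1) ctau0.
  apply: (heq_trans (hcomp_congr e1 (heqh_refl _))).
  by apply: (heq_trans e); exact: heqh_refl.
have nP' : hcomp (hinv a) Pi =h hcomp Pv (hinv phr).
  by apply: (hcompIr (G := phr)); rewrite hcompVK hcompA nP hcompKl.
have H0E : hcomp (hcomp H0 psc) eps =h hcomp phr (hcomp eph H).
  rewrite /H0 !hcompA (hcompKl psc eps) (hcomp_invl eps (htpy_tgt_cts eps)).
  by rewrite hcomp_idr.
rewrite hcompA -(hcompA b Qk eps) -nQ -slE (hcompA Pi H0 psc) (hcompA Pi) H0E.
by rewrite -(hcompA (hinv a) Pi) nP' (hcompA Pv (hinv phr)) hcompKl hcompA.
Qed.
End CoverHpo.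

(** * Homotopy fibres *)

Section PointedHomotopy.
Context (R : realType).
Local Notation "f ~h g" := (phomotopic R f g) (at level 70).

Lemma ph_refl (X Y : ptopologicalType) (f : {pmap X -> Y}) : f ~h f.
Proof. by apply/phomotopicP; constructor; exact: (hid R [set point] (@pmap_cts _ _ f)). Qed.

Lemma ph_sym (X Y : ptopologicalType) (f g : {pmap X -> Y}) : f ~h g -> g ~h f.
Proof. by move=> /phomotopicP[F]; apply/phomotopicP; constructor; exact: (hinv F). Qed.

Lemma ph_trans (X Y : ptopologicalType) (g f h : {pmap X -> Y}) :
  f ~h g -> g ~h h -> f ~h h.
Proof.
move=> /phomotopicP[F] /phomotopicP[G]; apply/phomotopicP; constructor.
exact: (hcomp F G).
Qed.

Lemma ph_postcomp (X Y Z : ptopologicalType) (f g : {pmap X -> Y}) (k : {pmap Y -> Z}) :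
  f ~h g -> k \po f ~h k \po g.
Proof.
move=> /phomotopicP[F]; apply/phomotopicP; constructor.
exact: (hpost (@pmap_cts _ _ k) F).
Qed.

Lemma ph_precomp (X Y Z : ptopologicalType) (f g : {pmap Y -> Z}) (k : {pmap X -> Y}) :
  f ~h g -> f \po k ~h g \po k.
Proof.
move=> /phomotopicP[F]; apply/phomotopicP; constructor.
by apply: (hpre F (@pmap_cts _ _ k)) => x ->; exact: pmap_pt.
Qed.

Lemma pcompA (X Y Z W : ptopologicalType) (f : {pmap X -> Y}) (g : {pmap Y -> Z})
    (h : {pmap Z -> W}) : h \po (g \po f) = h \po g \po f.
Proof. exact: pmap_eqP. Qed.

Lemma pcomp_idl (X Y : ptopologicalType) (f : {pmap X -> Y}) : pidm Y \po f = f.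
Proof. exact: pmap_eqP. Qed.

Lemma pcomp_idr (X Y : ptopologicalType) (f : {pmap X -> Y}) : f \po pidm X = f.
Proof. exact: pmap_eqP. Qed.

Lemma heq_inverse_sym (X Y : ptopologicalType) (f : {pmap X -> Y}) (g : {pmap Y -> X}) :
  homotopy_inverse R f g -> homotopy_inverse R g f.
Proof. by case. Qed.

Lemma heq_of_inverses (X Y : ptopologicalType) (f : {pmap X -> Y}) (g g' : {pmap Y -> X}) :
  g \po f ~h pidm X -> f \po g' ~h pidm Y -> homotopy_equivalence R f.
Proof.
move=> gf fg; exists g; split=> //.
apply: (ph_trans _ fg); apply: (ph_trans (g := f \po g \po (f \po g'))).
  rewrite -[X in phomotopic R X _]pcomp_idr; apply: ph_postcomp; exact: ph_sym.
rewrite (_ : _ \po _ = f \po (g \po f) \po g'); last by rewrite !pcompA.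
apply: ph_precomp; rewrite -[X in _ ~h X]pcomp_idr; exact: ph_postcomp.
Qed.

Lemma heq_comp (X Y Z : ptopologicalType) (f : {pmap X -> Y}) (g : {pmap Y -> Z}) :
  homotopy_equivalence R f -> homotopy_equivalence R g ->
  homotopy_equivalence R (g \po f).
Proof.
move=> [f' [f1 f2]] [g' [g1 g2]]; exists (f' \po g'); split.
  apply: (ph_trans _ f1); rewrite -pcompA (pcompA f g g') -[X in _ ~h f' \po X]pcomp_idl.
  by apply: ph_postcomp; apply: ph_precomp.
apply: (ph_trans _ g2); rewrite -pcompA (pcompA g' f' f) -[X in _ ~h g \po X]pcomp_idl.
by apply: ph_postcomp; apply: ph_precomp.
Qed.

Lemma heq_phomotopic (X Y : ptopologicalType) (f f' : {pmap X -> Y}) :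
  f ~h f' -> homotopy_equivalence R f -> homotopy_equivalence R f'.
Proof.
move=> ff [g [g1 g2]]; exists g; split.
  by apply: (ph_trans _ g1); apply: ph_postcomp; exact: ph_sym.
by apply: (ph_trans _ g2); apply: ph_precomp; exact: ph_sym.
Qed.

(** [g] has a left and a right homotopy inverse, hence an inverse [c], and [h] is homotopic to
    [h g c]. *)
Lemma heq_two_of_six (X Y Z W : ptopologicalType) (f : {pmap X -> Y})
    (g : {pmap Y -> Z}) (h : {pmap Z -> W}) :
  homotopy_equivalence R (g \po f) -> homotopy_equivalence R (h \po g) ->
  homotopy_equivalence R h.
Proof.
move=> [a [a1 a2]] [b [b1 b2]].
have hg : homotopy_equivalence R g.
  by apply: (heq_of_inverses (g := b \po h) (g' := f \po a)); rewrite -?pcompA // pcompA.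
have [c [c1 c2]] := hg.
have hc : homotopy_equivalence R c by exists g.
apply: (heq_phomotopic (f := h \po g \po c)).
  by rewrite -pcompA -[X in _ ~h X]pcomp_idr; exact: ph_postcomp.
by apply: heq_comp => //; exists b.
Qed.

End PointedHomotopy.

Section Fibrations.
Context (R : realType) (Z : ptopologicalType).

Section Family.
Context (N : ptopologicalType) (th : {pmap N -> Z}).

Definition pev (e : pfib R th * R) : Z := psub_val (psub_val e.1).2 (clamp e.2).

Lemma pev_cts : continuous pev.
Proof.
apply: path_app_cts; last by cts; exact: clamp_cts.
apply: (@comp_cts _ (pfib R th) _ fst (fun x => psub_val (psub_val x).2)).
  exact: fst_cts.
apply: (@comp_cts _ (N * path_space R Z)%type _ (fun x : pfib R th => psub_val x)
  (fun x => psub_val x.2)); first exact: psub_val_cts.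
by apply: (@comp_cts _ (path_space R Z) _ snd); [exact: snd_cts|exact: psub_val_cts].
Qed.

Lemma pev0 e s : s <= 0 -> pev (e, s) = point.
Proof.
move=> s0; rewrite /pev -[(e, s).2]/s clamp_le0 //.
exact: (psub_valP (psub_val e).2).
Qed.

Lemma pev1 e s : 1 <= s -> pev (e, s) = th (pfib_proj R th e).
Proof. by move=> s1; rewrite /pev -[(e, s).2]/s clamp_ge1 //; exact: pfibP. Qed.

Lemma pev_pt s : pev (point, s) = point.
Proof. by []. Qed.

Lemma pfib_eq (e e' : pfib R th) :
  pfib_proj R th e = pfib_proj R th e' ->
  (forall s : R, 0 <= s <= 1 -> pev (e, s) = pev (e', s)) -> e = e'.
Proof.
move=> ee ev; apply: psub_val_inj; apply: injective_projections => //.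
apply: psub_val_inj; apply: free_path_eq => s.
have := ev (psub_val s); rewrite /pev /= clampK; apply.
by have := psub_valP s; rewrite /= in_itv.
Qed.

Section Fam.
Context (V : topologicalType) (m : V -> N) (cm : continuous m).
Context (F : V * R -> Z) (cF : continuous F).
Hypothesis F0 : forall v, F (v, 0) = point.
Hypothesis F1 : forall v, F (v, 1) = th (m v).

Definition pfam_path v : path_space R Z :=
  psub_in (@path_set_cst R Z) (x := fpath_of cF v) (F0 v).

Definition pfam (v : V) : pfib R th := @pfib_in R N Z th (m v) (pfam_path v) (F1 v).

Lemma pfam_cts : continuous pfam.
Proof.
apply: psub_cts; apply: pair_cts => //; apply: psub_cts; exact: (fpath_of_cts cF).
Qed.

Lemma pfam_proj v : pfib_proj R th (pfam v) = m v.
Proof. by []. Qed.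

Lemma pfam_pev v s : 0 <= s <= 1 -> pev (pfam v, s) = F (v, s).
Proof.
by move=> s01; rewrite /pev -[LHS]/(F (v, psub_val (clamp s))) clampE.
Qed.

End Fam.

(** The equations are imposed for parameters in [0, 1] only, so that piecewise linear formulas need
    no control outside. *)
Lemma pfam_htpy (V : ptopologicalType) (f g : {pmap V -> pfib R th})
    (m : V * R -> N) (F : (V * R) * R -> Z) :
  continuous m -> continuous F ->
  (forall v s, 0 <= s <= 1 -> F ((v, s), 0) = point) ->
  (forall v s, 0 <= s <= 1 -> F ((v, s), 1) = th (m (v, s))) ->
  (forall v, m (v, 0) = pfib_proj R th (f v)) ->
  (forall v, m (v, 1) = pfib_proj R th (g v)) ->
  (forall v x, 0 <= x <= 1 -> F ((v, 0), x) = pev (f v, x)) ->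
  (forall v x, 0 <= x <= 1 -> F ((v, 1), x) = pev (g v, x)) ->
  (forall s, 0 <= s <= 1 -> m (point, s) = point) ->
  (forall s x, 0 <= s <= 1 -> 0 <= x <= 1 -> F ((point, s), x) = point) ->
  phomotopic R f g.
Proof.
move=> cm cF F0 F1 m0 m1 Ff Fg m_pt F_pt.
have I01 (s : unitI R) : 0 <= psub_val s <= 1.
  by have := psub_valP s; rewrite /= in_itv.
pose M (z : V * unitI R) := m (z.1, psub_val z.2).
pose G (z : (V * unitI R) * R) := F ((z.1.1, psub_val z.1.2), z.2).
have cM : continuous M by rewrite /M; cts; exact: psub_val_cts.
have cG : continuous G by rewrite /G; cts; exact: psub_val_cts.
have G0 z : G (z, 0) = point by apply: F0.
have G1 z : G (z, 1) = th (M z) by apply: F1.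
exists (pfam cG G0 G1); split.
- exact: pfam_cts.
- move=> v; apply: pfib_eq; first exact: m0.
  by move=> s s01; rewrite pfam_pev // -Ff.
- move=> v; apply: pfib_eq; first exact: m1.
  by move=> s s01; rewrite pfam_pev // -Fg.
- move=> t; apply: pfib_eq; first exact: m_pt.
  by move=> s s01; rewrite pfam_pev // pev_pt; exact: F_pt.
Qed.

End Family.

Section Transport.
Context (N : ptopologicalType) (th th' : {pmap N -> Z}) (Th : htpy R [set point] th th').

(** The path of the point followed by the track of [Th], of total length 2; [transport] rescales it
    to length 1. *)
Definition pext_path (z : pfib R th * R) : Z :=
  if z.2 <= 1 then pev z else Th (pfib_proj R th z.1, z.2 - 1).

Lemma pext_path_cts : continuous pext_path.
Proof.
apply: glue_le; first by cts.
- by cts.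
- exact: pev_cts.
- by cts; exact: htpy_cts.
- by move=> [e s] /= ->; rewrite pev1 // htpy_le0 // subrr.
Qed.

Lemma pext_path_le e s : s <= 1 -> pext_path (e, s) = pev (e, s).
Proof. by move=> s1; rewrite /pext_path -[(e, s).2]/s s1. Qed.

Lemma pext_path_ge e s : 1 <= s -> pext_path (e, s) = Th (pfib_proj R th e, s - 1).
Proof.
move=> s1; rewrite /pext_path -[(e, s).2]/s; case: leP => // s1'.
by rewrite pev1 // htpy_le0 //; lra.
Qed.

Lemma pext_path_pt s : pext_path (point, s) = point.
Proof. by rewrite /pext_path; case: ifP => _; rewrite ?pev_pt // htpy_D // pmap_pt. Qed.

Let F (z : pfib R th * R) : Z := pext_path (z.1, 2 * z.2).

Let cF : continuous F.
Proof. by rewrite /F; cts; exact: pext_path_cts. Qed.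

Let F0 e : F (e, 0) = point.
Proof. by rewrite /F pext_path_le ?mulr0 //= ?pev0 //; lra. Qed.

Let F1 e : F (e, 1) = th' (pfib_proj R th e).
Proof. by rewrite /F pext_path_ge ?htpy_ge1 //=; lra. Qed.

Lemma transport_pt : pfam (m := pfib_proj R th) cF F0 F1 point = point.
Proof.
by apply: pfib_eq => // s s01; rewrite pfam_pev // pev_pt /F pext_path_pt.
Qed.

Lemma transport_cts : continuous (pfam (m := pfib_proj R th) cF F0 F1).
Proof. by apply: pfam_cts; exact: pmap_cts. Qed.

(* (m, w) |-> (m, w . Th m) *)
Definition transport : {pmap pfib R th -> pfib R th'} := PMap transport_cts transport_pt.

Lemma transport_pev e s : 0 <= s <= 1 -> pev (transport e, s) = pext_path (e, 2 * s).
Proof. by move=> s01; rewrite /transport pfam_pev. Qed.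

End Transport.

Lemma transportK (N : ptopologicalType) (th th' : {pmap N -> Z})
    (Th : htpy R [set point] th th') (Th' : htpy R [set point] th' th) :
  (forall x s, Th' (x, s) = Th (x, 1 - s)) ->
  phomotopic R (transport Th' \po transport Th) (pidm (pfib R th)).
Proof.
move=> ThE.
(* The composite follows the extended path up to 2 and returns to 1, with parameter min (4 x, 3 - 2
   x); the spur is retracted by interpolating linearly with x. *)
apply: (@pfam_htpy _ _ _ _ _ (fun z => pfib_proj R th z.1)
  (fun z => pext_path Th (z.1.1,
    (1 - z.1.2) * Num.min (4 * z.2) (3 - 2 * z.2) + z.1.2 * z.2))).
- by cts.
- by cts; exact: pext_path_cts.
- move=> e s s01; rewrite -[(e, s, 0).2]/0 min_l; last by lra.
  by rewrite !mulr0 addr0 pext_path_le ?pev0.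
- move=> e s s01; rewrite -[(e, s, 1).2]/1 -[(e, s, 1).1.2]/s min_r; last by lra.
  rewrite (_ : _ + _ = 1); last by lra.
  by rewrite pext_path_le ?pev1.
- by [].
- by [].
- move=> e x x01; rewrite -[(e, 0, x).2]/x -[(e, 0, x).1.2]/0 mul0r addr0 subr0 mul1r.
  rewrite transport_pev //; case: (leP x 2^-1) => x2.
    rewrite min_l; last by lra.
    rewrite [RHS]pext_path_le; last by lra.
    rewrite transport_pev; last by lra.
    by congr (pext_path _ (_, _)); lra.
  rewrite min_r; last by lra.
  rewrite pext_path_ge; last by lra.
  rewrite pext_path_ge; last by lra.
  by rewrite ThE; congr (Th (_, _)); lra.
- move=> e x x01; rewrite -[(e, 1, x).2]/x -[(e, 1, x).1.2]/1 subrr mul0r add0r mul1r.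
  by rewrite pext_path_le //; lra.
- by [].
- by move=> s x _ _; rewrite pext_path_pt.
Qed.

Lemma transport_heq (N : ptopologicalType) (th th' : {pmap N -> Z})
    (Th : htpy R [set point] th th') : homotopy_equivalence R (transport Th).
Proof.
exists (transport (hinv Th)); split; apply: transportK => // x s /=.
by congr (Th (_, _)); lra.
Qed.

Section PfibMap.
Context (N' N : ptopologicalType) (k : {pmap N' -> N}).
Context (th' : {pmap N' -> Z}) (th : {pmap N -> Z}) (kE : forall x, th' x = th (k x)).

Let F1 (e : pfib R th') : pev (e, 1) = th (k (pfib_proj R th' e)).
Proof. by rewrite pev1 // kE. Qed.

Let F0 (e : pfib R th') : pev (e, 0) = point.
Proof. exact: pev0. Qed.

Lemma pf_map_pt : pfam (m := fun e => k (pfib_proj R th' e)) (@pev_cts N' th') F0 F1 point = point.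
Proof.
apply: pfib_eq => [|s s01]; first exact: (pmap_pt k).
by rewrite pfam_pev // !pev_pt.
Qed.

Lemma pf_map_cts : continuous (pfam (m := fun e => k (pfib_proj R th' e)) (@pev_cts N' th') F0 F1).
Proof. by apply: pfam_cts; cts. Qed.

Definition pf_map : {pmap pfib R th' -> pfib R th} := PMap pf_map_cts pf_map_pt.

Lemma pf_map_pev e s : 0 <= s <= 1 -> pev (pf_map e, s) = pev (e, s).
Proof. by move=> s01; rewrite /pf_map pfam_pev. Qed.

End PfibMap.

(** While [Q] moves q m to m in the base, the track of [Q] under [th], as far as it has been
    traversed, is appended to the path. The result is the transport along this track, which is an
    equivalence. *)
Lemma pf_map_homotopic_id (N : ptopologicalType) (q : {pmap N -> N})
    (th' th : {pmap N -> Z}) (qE : forall x, th' x = th (q x)) :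
  phomotopic R q (pidm N) -> homotopy_equivalence R (pf_map qE).
Proof.
move=> /phomotopicP[Q].
pose Th : htpy R [set point] th' th :=
  hcast (hpost (@pmap_cts _ _ th) Q) (fun x => esym (qE x)) (fun x => erefl).
apply: heq_phomotopic (transport_heq Th); apply: ph_sym.
apply: (@pfam_htpy _ _ _ _ _ (fun z => Q (pfib_proj R th' z.1, z.2))
  (fun z => pext_path Th (z.1.1, (1 + z.1.2) * z.2))).
- by cts; exact: htpy_cts.
- by cts; exact: pext_path_cts.
- by move=> e s s01; rewrite mulr0 pext_path_le ?pev0.
- move=> e s s01; rewrite mulr1 -[(e, s, 1).1.2]/s pext_path_ge; last by lra.
  by congr (th (Q (_, _))) => /=; lra.
- by move=> e; rewrite htpy_le0.
- by move=> e; rewrite htpy_ge1.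
- move=> e x x01; rewrite addr0 mul1r pf_map_pev // pext_path_le //.
  by case/andP: x01.
- by move=> e x x01; rewrite transport_pev.
- by move=> s s01; rewrite htpy_D // pmap_pt.
- by move=> s x _ _; rewrite pext_path_pt.
Qed.

Lemma pf_map_comp (N1 N2 N3 : ptopologicalType) (k : {pmap N1 -> N2}) (l : {pmap N2 -> N3})
    (th1 : {pmap N1 -> Z}) (th2 : {pmap N2 -> Z}) (th3 : {pmap N3 -> Z})
    (kE : forall x, th1 x = th2 (k x)) (lE : forall x, th2 x = th3 (l x))
    (klE : forall x, th1 x = th3 ((l \po k) x)) :
  pf_map lE \po pf_map kE = pf_map klE.
Proof.
by apply: pmap_eqP => e; apply: pfib_eq => // s s01; rewrite !pf_map_pev.
Qed.

(** Two of six for the maps induced by [k], [l], [k]: both composites are induced by self-maps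
    homotopic to the identity. *)
Theorem pf_map_heq (N' N : ptopologicalType) (k : {pmap N' -> N})
    (th' : {pmap N' -> Z}) (th : {pmap N -> Z}) (kE : forall x, th' x = th (k x)) :
  homotopy_equivalence R k -> homotopy_equivalence R (pf_map kE).
Proof.
move=> [l [lk kl]].
have lE x : (th' \po l) x = th' (l x) by [].
have kE' x : (th' \po l \po k) x = (th' \po l) (k x) by [].
apply: (@heq_two_of_six R _ _ _ _ (pf_map kE') (pf_map lE)).
  have lkE x : (th' \po l \po k) x = th' ((l \po k) x) by [].
  by rewrite (pf_map_comp _ _ lkE); exact: pf_map_homotopic_id.
have klE x : (th' \po l) x = th ((k \po l) x) by exact: kE.
rewrite (pf_map_comp _ _ klE); exact: pf_map_homotopic_id.
Qed.

End Fibrations.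

(** * The coarse mapping cone *)

Section CoarseCone.
Context (R : realType) (A Y : ptopologicalType) (f : {pmap A -> Y}).

(* The unreduced mapping cone with a topology coarser than the quotient
   topology: near the end t = 1 a neighbourhood is given by an open set of Y,
   near t = 0 it only depends on t.  A point (a, 1) is topologically
   indistinguishable from f a, and all points (a, 0) are from each other. *)
Definition coarse_cone : Type := let _ := f in (Y + A * unitI R)%type.

Definition cc_ht (p : coarse_cone) : R :=
  match p with inl _ => 1 | inr x => psub_val x.2 end.

Definition cc_base (p : coarse_cone) : Y :=
  match p with inl y => y | inr x => f x.1 end.

Definition cc_side (p : coarse_cone) : A :=
  match p with inl _ => point | inr x => x.1 end.

Lemma cc_ht01 p : 0 <= cc_ht p <= 1.
Proof.
case: p => [y|[a t]] /=; first by rewrite ler01 lexx.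
by have := psub_valP t; rewrite /= in_itv.
Qed.

Lemma cc_base_mid p : cc_ht p < 1 -> cc_base p = f (cc_side p).
Proof. by case: p => [y|//] /=; rewrite ltxx. Qed.

Definition cc_open (U : set coarse_cone) : Prop := forall p, U p ->
  [/\ cc_ht p = 1 -> exists (Ou : set Y) (e : R), [/\ open Ou, Ou (cc_base p), 0 < e &
        forall q, 1 - e < cc_ht q -> Ou (cc_base q) -> U q],
      cc_ht p = 0 -> exists e : R, 0 < e /\ forall q, cc_ht q < e -> U q &
      0 < cc_ht p < 1 -> exists (Ou : set A) (e : R), [/\ open Ou, Ou (cc_side p), 0 < e &
        forall q, `|cc_ht q - cc_ht p| < e -> 0 < cc_ht q < 1 -> Ou (cc_side q) -> U q]].

Lemma cc_openT : cc_open setT.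
Proof.
move=> p _; split=> _.
- by exists setT, 1; split=> //; exact: openT.
- by exists 1.
- by exists setT, 1; split=> //; exact: openT.
Qed.

Lemma cc_openI (U V : set coarse_cone) : cc_open U -> cc_open V -> cc_open (U `&` V).
Proof.
move=> oU oV p [Up Vp]; have [U1 U2 U3] := oU _ Up; have [V1 V2 V3] := oV _ Vp.
split=> hp.
- have [Ou [e [oO Op egt H]]] := U1 hp; have [Ou' [e' [oO' Op' egt' H']]] := V1 hp.
  exists (Ou `&` Ou'), (Num.min e e'); split=> //; first exact: openI.
    by rewrite lt_min egt.
  move=> q q1 [Oq Oq']; split; [apply: H => //|apply: H' => //].
    by apply: le_lt_trans q1; rewrite lerD2l lerN2 ge_min lexx.
  by apply: le_lt_trans q1; rewrite lerD2l lerN2 ge_min lexx orbT.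
- have [e [egt H]] := U2 hp; have [e' [egt' H']] := V2 hp.
  exists (Num.min e e'); split; first by rewrite lt_min egt.
  by move=> q; rewrite lt_min => /andP[? ?]; split; [exact: H|exact: H'].
- have [Ou [e [oO Op egt H]]] := U3 hp; have [Ou' [e' [oO' Op' egt' H']]] := V3 hp.
  exists (Ou `&` Ou'), (Num.min e e'); split=> //; first exact: openI.
    by rewrite lt_min egt.
  move=> q; rewrite lt_min => /andP[? ?] q01 [Oq Oq'].
  by split; [exact: H|exact: H'].
Qed.

Lemma cc_open_bigU (I : Type) (g : I -> set coarse_cone) :
  (forall i, cc_open (g i)) -> cc_open (\bigcup_i g i).
Proof.
move=> og p [i _ gp]; have [U1 U2 U3] := og i _ gp; split=> hp.
- have [Ou [e [oO Op egt H]]] := U1 hp; exists Ou, e; split=> // q q1 Oq.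
  by exists i => //; exact: H.
- have [e [egt H]] := U2 hp; exists e; split=> // q qe; exists i => //; exact: H.
- have [Ou [e [oO Op egt H]]] := U3 hp; exists Ou, e; split=> // q q1 q2 Oq.
  by exists i => //; exact: H.
Qed.

HB.instance Definition _ := Choice.on coarse_cone.
HB.instance Definition _ :=
  @isOpenTopological.Build coarse_cone cc_open cc_openT cc_openI cc_open_bigU.
HB.instance Definition _ := isPointed.Build coarse_cone (inl point).

Lemma cc_gt_open (c : R) : open [set p | c < cc_ht p].
Proof.
move=> p /= cp; split=> hp.
- exists setT, (1 - c); split=> //; [exact: openT|lra|].
  by move=> q /=; lra.
- by exists 1; split=> // q _ /=; have := cc_ht01 q; lra.
- exists setT, (cc_ht p - c); split=> //; [exact: openT|lra|].
  by move=> q /=; rewrite ltr_distl => /andP[]; lra.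
Qed.

Lemma cc_lt_open (c : R) : open [set p | cc_ht p < c].
Proof.
move=> p /= cp; split=> hp.
- exists setT, 1; split=> //; [exact: openT|].
  by move=> q _ _ /=; have := cc_ht01 q; lra.
- by exists c; split=> //; lra.
- exists setT, (c - cc_ht p); split=> //; [exact: openT|lra|].
  by move=> q /=; rewrite ltr_distl => /andP[]; lra.
Qed.

Lemma cc_ht_cts : continuous cc_ht.
Proof.
move=> p U; rewrite /= => /nbhs_ballP[e /= egt eU].
apply: (@filterS _ (nbhs p) _
    ([set q : coarse_cone | cc_ht p - e < cc_ht q] `&` [set q | cc_ht q < cc_ht p + e])).
  by move=> q /= [q1 q2]; apply: eU; rewrite -ball_normE /= ltr_distlC q1 q2.
apply: open_nbhs_nbhs; split; last by split=> /=; lra.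
by apply: openI; [exact: cc_gt_open|exact: cc_lt_open].
Qed.

Lemma cc_base_cts p : 0 < cc_ht p -> {for p, continuous cc_base}.
Proof.
move=> p0 Ou; rewrite /= nbhsE => -[Ou' [oO' Ou'p] OO].
apply: (@filterS _ _ _ [set q | 0 < cc_ht q /\ Ou' (cc_base q)]).
  by move=> q [_ /OO].
apply: open_nbhs_nbhs; split=> //.
move=> q /= [q0 qO]; split=> hq.
- by exists Ou', 1; split=> // r; rewrite subrr.
- by move: q0; rewrite hq ltxx.
- exists (f @^-1` Ou'), 1; split=> //.
  + by move/continuousP: (@pmap_cts _ _ f); apply.
  + by rewrite /= -cc_base_mid //; case/andP: hq.
  + by move=> r _ /andP[r0 r1] /=; rewrite -cc_base_mid.
Qed.

Lemma cc_side_cts p : 0 < cc_ht p < 1 -> {for p, continuous cc_side}.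
Proof.
move=> p0 Ou; rewrite /= nbhsE => -[Ou' [oO' Ou'p] OO].
apply: (@filterS _ _ _ [set q | 0 < cc_ht q < 1 /\ Ou' (cc_side q)]).
  by move=> q [_ /OO].
apply: open_nbhs_nbhs; split=> //.
move=> q /= [q0 qO]; split=> hq.
- by move: q0; rewrite hq ltxx andbF.
- by move: q0; rewrite hq ltxx.
- by exists Ou', 1; split.
Qed.

(** The purpose of the coarse topology: a map into the cone is tested on its height, on the point of
    [Y] away from the apex, and on the point of [A] strictly between the ends. A quotient topology
    is adapted to maps out of it instead. *)
Lemma cc_cts (V : topologicalType) (F : V -> coarse_cone) :
  continuous (fun v => cc_ht (F v)) ->
  (forall v, 0 < cc_ht (F v) -> {for v, continuous (fun v => cc_base (F v))}) ->
  (forall v, 0 < cc_ht (F v) < 1 -> {for v, continuous (fun v => cc_side (F v))}) ->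
  continuous F.
Proof.
move=> ch cb cs v U; rewrite nbhsE => -[U' [oU' U'p] UU].
have [U1 U2 U3] := oU' _ U'p.
apply: (@filterS _ (nbhs v) _ (F @^-1` U')); first by move=> x /= /UU.
have gt c : c < cc_ht (F v) -> \forall x \near v, c < cc_ht (F x).
  move=> cv; apply: (ch v [set y | c < y]).
  by apply: open_nbhs_nbhs; split; [exact: open_gt|].
have lt c : cc_ht (F v) < c -> \forall x \near v, cc_ht (F x) < c.
  move=> cv; apply: (ch v [set y | y < c]).
  by apply: open_nbhs_nbhs; split; [exact: open_lt|].
have := cc_ht01 (F v); rewrite le_eqVlt => /andP[/orP[/eqP h0|h0]].
  have [e [egt H]] := U2 (esym h0).
  by move=> _; near=> x; apply: H; near: x; apply: lt; rewrite -h0.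
rewrite le_eqVlt => /orP[/eqP h1|h1].
  have [Ou [e [oO Op egt H]]] := U1 h1.
  near=> x; apply: H; near: x; first by apply: gt; rewrite h1; lra.
  by apply: (cb v h0); apply: open_nbhs_nbhs; split.
have h01 : 0 < cc_ht (F v) < 1 by rewrite h0 h1.
have [Ou [e [oO Op egt H]]] := U3 h01.
near=> x; apply: H; near: x.
- near=> x; rewrite ltr_distl; apply/andP; split; near: x; [apply: gt|apply: lt]; lra.
- near=> x; apply/andP; split; near: x; [exact: gt|exact: lt].
- by apply: (cs v h01); apply: open_nbhs_nbhs; split.
Unshelve. all: by end_near. Qed.

End CoarseCone.

Section CoarseConeMaps.
Context (R : realType) (A Y : ptopologicalType) (f : {pmap A -> Y}).
Local Notation N := (coarse_cone R f).
Local Notation ht := (@cc_ht R A Y f).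

Definition cc_apex : N := inr (point, I0 R).

(** At the ends one representative is chosen among topologically indistinguishable points, so that
    height 1 factors through [f] and height 0 is a single point on the nose. *)
Definition cc_node (z : A * R) : N :=
  if 1 <= z.2 then inl (f z.1) else if z.2 <= 0 then cc_apex
  else inr (z.1, clamp z.2).

Lemma cc_node_ht z : ht (cc_node z) = psub_val (clamp z.2).
Proof.
rewrite /cc_node; case: ifP => [h|_]; first by rewrite clamp_ge1.
by case: ifP => [h|_] //; rewrite clamp_le0.
Qed.

Lemma clamp_gt0 (y : R) : (0 < psub_val (clamp y)) = (0 < y).
Proof. by rewrite /= lt_max ltxx /= lt_min ltr01. Qed.

Lemma clamp_lt1 (y : R) : (psub_val (clamp y) < 1) = (y < 1).
Proof. by rewrite /= gt_max ltr01 /= gt_min ltxx. Qed.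

Lemma cc_node_base z : 0 < z.2 -> cc_base (cc_node z) = f z.1.
Proof. by move=> z0; rewrite /cc_node; case: ifP => // _; rewrite leNgt z0. Qed.

Lemma cc_node_side z : 0 < z.2 < 1 -> cc_side (cc_node z) = z.1.
Proof. by move=> /andP[z0 z1]; rewrite /cc_node leNgt z1 /= leNgt z0. Qed.

Lemma open_gt_snd (V : topologicalType) (c : R) : open [set z : V * R | c < z.2].
Proof.
by apply: (@open_comp _ _ snd [set y | c < y]) => [w _|]; [exact: snd_cts|exact: open_gt].
Qed.

Lemma open_lt_snd (V : topologicalType) (c : R) : open [set z : V * R | z.2 < c].
Proof.
by apply: (@open_comp _ _ snd [set y | y < c]) => [w _|]; [exact: snd_cts|exact: open_lt].
Qed.

Lemma cc_node_cts : continuous cc_node.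
Proof.
apply: cc_cts.
- have -> : (fun z => ht (cc_node z)) = fun z => psub_val (clamp z.2).
    by apply/funext => z; rewrite cc_node_ht.
  by cts; [exact: clamp_cts|exact: psub_val_cts].
- move=> z; rewrite cc_node_ht clamp_gt0 => z0.
  apply: (@near_eq_for _ _ _ (fun z => f z.1) _ _ (@open_gt_snd A 0)) => //.
    by move=> x /=; exact: cc_node_base.
  suff c : continuous (fun z : A * R => f z.1) by exact: c.
  by cts.
- move=> z; rewrite cc_node_ht clamp_gt0 clamp_lt1 => /andP[z0 z1].
  apply: (@near_eq_for _ _ _ (fun z => z.1) _ _ (openI (@open_gt_snd A 0) (@open_lt_snd A 1))) => //.
    by move=> x [x0 x1]; apply: cc_node_side; rewrite x0.
  exact: fst_cts.
Qed.

Definition cc_move (z : N * R) : N :=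
  match z.1 with inl y => inl y | inr x => inr (x.1, clamp z.2) end.

Lemma cc_move_ht (p : N) : cc_move (p, ht p) = p.
Proof. by case: p => [//|[a t]]; rewrite /cc_move /= clampK. Qed.

Lemma cc_base_move z : cc_base (cc_move z) = cc_base z.1.
Proof. by case: z => [[y|[a t]] s]. Qed.

Lemma cc_side_move z : cc_side (cc_move z) = cc_side z.1.
Proof. by case: z => [[y|[a t]] s]. Qed.

Lemma cc_tp : [set p : N | 0 < ht p] point. Proof. exact: ltr01. Qed.

Lemma cc_t1 : [set p : N | ht p < 1] cc_apex. Proof. exact: ltr01. Qed.

Lemma cc_t01 : [set p : N | 0 < ht p < 1] (cc_node (point, 2^-1)).
Proof. by rewrite /= cc_node_ht clamp_gt0 clamp_lt1 /=; lra. Qed.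

Let N0 := psub cc_tp.
Let N1 := psub cc_t1.
Let N01 := psub cc_t01.

Let v0_cts : continuous (fun y : Y => psub_in cc_tp (x := inl y) (ltr01 : [set p : N | 0 < ht p] (inl y))).
Proof.
apply: psub_cts; apply: cc_cts => /=.
- exact: cst_cts.
- by move=> y _; exact: id_cts.
- by move=> y; rewrite ltxx andbF.
Qed.

Let v0_pt : psub_in cc_tp (x := inl point) (ltr01 : [set p : N | 0 < ht p] (inl point)) = point.
Proof. exact: psub_val_inj. Qed.

Definition cc_in0 : {pmap Y -> N0} := @PMap Y N0 _ v0_cts v0_pt.

Let r_cts : continuous (fun p : N0 => cc_base (psub_val p)).
Proof.
move=> p; apply: (@continuous_comp _ _ _ (fun p : N0 => psub_val p) (@cc_base R A Y f) p).
  exact: psub_val_cts.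
exact: (cc_base_cts (psub_valP p)).
Qed.

Definition cc_ret0 : {pmap N0 -> Y} := @PMap N0 Y _ r_cts erefl.

Lemma cc_in0_heq : homotopy_equivalence R cc_in0.
Proof.
exists cc_ret0; split.
  by rewrite (_ : _ \po _ = pidm Y); [exact: ph_refl|exact: pmap_eqP].
(* Heights are raised to 1 as the time decreases to 0. At time 0 the value is taken in [Y] itself;
   the jump from (a, 1) to f a is invisible to the topology. *)
pose H (z : N0 * unitI R) : N := if psub_val z.2 <= 0 then inl (cc_base (psub_val z.1))
  else cc_move (psub_val z.1, ht (psub_val z.1) + (1 - psub_val z.2)).
have hH z : ht (H z) = Num.min 1 (ht (psub_val z.1) + (1 - psub_val z.2)).
  case: z => p s; rewrite /H -[(p, s).1]/p -[(p, s).2]/s.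
  have p0 : 0 < ht (psub_val p) by exact: (psub_valP p).
  have := psub_valP s; rewrite /= in_itv /= => /andP[s0 s1].
  case: ifP => [s0'|_]; first by rewrite min_l //=; lra.
  move: p0; case: (psub_val p) => [y|[a t]] /= p0; first by rewrite min_l //; lra.
  by rewrite max_r // le_min ler01 /=; lra.
have bH z : cc_base (H z) = cc_base (psub_val z.1).
  by rewrite /H; case: ifP => // _; rewrite cc_base_move.
have cH : continuous H.
  apply: cc_cts.
  - have -> : (fun z => ht (H z)) =
        fun z => Num.min 1 (ht (psub_val z.1) + (1 - psub_val z.2)) by apply/funext.
    apply: minR_cts; first exact: cst_cts.
    apply: addR_cts; last by cts; exact: psub_val_cts.
    apply: (@comp_cts _ N0 R fst (fun p => ht (psub_val p))); first exact: fst_cts.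
    by apply: comp_cts; [exact: psub_val_cts|exact: cc_ht_cts].
  - move=> z _; rewrite (_ : (fun v => _) = fun z : N0 * unitI R => cc_base (psub_val z.1)).
      suff c : continuous (fun z : N0 * unitI R => cc_base (psub_val z.1)) by exact: c.
      by apply: (@comp_cts _ N0 Y fst (fun p => cc_base (psub_val p))); [exact: fst_cts|exact: r_cts].
    by apply/funext => x; exact: bH.
  - move=> z; rewrite hH => /andP[_ z1].
    have zp : 0 < ht (psub_val z.1) by exact: (psub_valP z.1).
    have cs2 : continuous (fun z : N0 * unitI R => psub_val z.2 : R).
      by apply: (@comp_cts _ (unitI R) R snd (fun s => psub_val s)); [exact: snd_cts|exact: psub_val_cts].
    have cp1 : continuous (fun z : N0 * unitI R => psub_val z.1).
      by apply: (@comp_cts _ N0 N fst (fun s => psub_val s)); [exact: fst_cts|exact: psub_val_cts].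
    have := psub_valP z.2; rewrite /= in_itv /= => /andP[s0 s1].
    have [z1' s1'] : ht (psub_val z.1) < 1 /\ 0 < psub_val z.2.
      by move: z1; rewrite gt_min ltxx /=; split; lra.
    apply: (@near_eq_for _ _ _ (fun z => cc_side (psub_val z.1)) [set z : N0 * unitI R | 0 < psub_val z.2]) => //.
    + apply: (@open_comp _ _ (fun z : N0 * unitI R => psub_val z.2) [set y | 0 < y]).
        by move=> x _; exact: cs2.
      exact: open_gt.
    + by move=> x /= x0; rewrite /H ifF ?cc_side_move // leNgt x0.
    + apply: (@continuous_comp _ _ _ (fun z : N0 * unitI R => psub_val z.1)).
        exact: cp1.
      by apply: cc_side_cts; rewrite zp.
have pH z : [set p : N | 0 < ht p] (H z).
  rewrite /= hH lt_min ltr01 /=.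
  have zp : 0 < ht (psub_val z.1) by exact: (psub_valP z.1).
  by have := psub_valP z.2; rewrite /= in_itv /=; lra.
exists (fun z => psub_in cc_tp (pH z)); split.
- exact: psub_cts.
- by move=> p; apply: psub_val_inj; rewrite /= /H I0E lexx.
- move=> p; apply: psub_val_inj; rewrite -[LHS]/(H (p, I1 R)) /H -[(p, I1 R).2]/(I1 R).
  by rewrite I1E ifF ?subrr ?addr0 ?cc_move_ht // leNgt ltr01.
- move=> s; apply: psub_val_inj; rewrite -[LHS]/(H (point, s)) /H.
  by case: ifP.
Qed.

Lemma cc_move_cts (V : topologicalType) (P : V -> N) (T : V -> R) :
  continuous P -> continuous T -> (forall v, ht (P v) < 1) ->
  (forall v, 0 < T v -> 0 < ht (P v)) -> continuous (fun v => cc_move (P v, T v)).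
Proof.
move=> cP cT P1 TP.
have hE v : ht (cc_move (P v, T v)) = psub_val (clamp (T v)).
  by have := P1 v; rewrite /cc_move; case: (P v) => [y|//]; rewrite /= ltxx.
apply: cc_cts.
- have -> : (fun v => ht (cc_move (P v, T v))) = fun v => psub_val (clamp (T v)).
    exact/funext.
  by cts; [exact: clamp_cts|exact: psub_val_cts].
- move=> v; rewrite hE clamp_gt0 => /TP Pv.
  rewrite (_ : (fun v => _) = fun v => cc_base (P v)).
    by apply: (@continuous_comp _ _ _ P); [exact: cP|exact: cc_base_cts].
  by apply/funext => x; rewrite cc_base_move.
- move=> v; rewrite hE clamp_gt0 => /andP[/TP Pv _].
  rewrite (_ : (fun v => _) = fun v => cc_side (P v)).
    by apply: (@continuous_comp _ _ _ P); [exact: cP|apply: cc_side_cts; rewrite Pv P1].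
  by apply/funext => x; rewrite cc_side_move.
Qed.

Definition one_pt : ptopologicalType := psub (erefl : [set x : R | x = 0] 0).

Lemma one_pt_eq (x y : one_pt) : x = y.
Proof. by apply: psub_val_inj; rewrite (psub_valP x) (psub_valP y). Qed.

Definition cc_in1 : {pmap one_pt -> N1} := pcst one_pt N1.

Lemma cc_in1_heq : homotopy_equivalence R cc_in1.
Proof.
exists (pcst N1 one_pt); split.
  rewrite (_ : _ \po _ = pidm one_pt); first exact: ph_refl.
  by apply: pmap_eqP => x; exact: one_pt_eq.
have cs2 : continuous (fun z : N1 * unitI R => psub_val z.2 : R).
  by apply: (@comp_cts _ (unitI R) R snd (fun s => psub_val s)); [exact: snd_cts|exact: psub_val_cts].
have cp1 : continuous (fun z : N1 * unitI R => psub_val z.1).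
  by apply: (@comp_cts _ N1 N fst (fun s => psub_val s)); [exact: fst_cts|exact: psub_val_cts].
pose T (z : N1 * unitI R) := ht (psub_val z.1) * psub_val z.2.
have cT : continuous T by apply: mulR_cts => //; apply: (comp_cts cp1); exact: cc_ht_cts.
have I01 (z : N1 * unitI R) : 0 <= psub_val z.2 <= 1.
  by have := psub_valP z.2; rewrite /= in_itv.
have H1 (z : N1 * unitI R) : ht (psub_val z.1) < 1 by exact: (psub_valP z.1).
pose G (z : N1 * unitI R) := cc_move (psub_val z.1, T z).
have cG : continuous G.
  apply: cc_move_cts => // z; rewrite /T => z0.
  by rewrite lt_neqAle (andP (cc_ht01 _)).1 andbT eq_sym; apply/negP => /eqP h0;
    move: z0; rewrite h0 mul0r ltxx.
have hG z : ht (G z) = T z.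
  have := H1 z; have := I01 z; have := cc_ht01 (psub_val z.1).
  rewrite /G /cc_move /T; case: (psub_val z.1) => [y|[a t]] /=; first by lra.
  by move=> ? ? ?; rewrite min_r ?max_r //; nra.
(* At time 0 the points of height 0 are replaced by the chosen apex, from which they are
   indistinguishable. *)
pose H (z : N1 * unitI R) : N := if psub_val z.2 <= 0 then cc_apex else G z.
have hH z : ht (H z) = T z.
  rewrite /H; case: ifP => z0; rewrite ?hG //= /T.
  have -> : psub_val z.2 = 0 :> R by apply/le_anti; rewrite z0 (andP (I01 z)).1.
  by rewrite mulr0.
have T0 z : 0 < T z -> 0 < psub_val z.2.
  by rewrite /T => z0; have /andP[] := cc_ht01 (psub_val z.1); have := I01 z; nra.
have oU : open [set z : N1 * unitI R | 0 < psub_val z.2].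
  apply: (@open_comp _ _ (fun z : N1 * unitI R => psub_val z.2) [set y | 0 < y]).
    by move=> x _; exact: cs2.
  exact: open_gt.
have HG x : [set z : N1 * unitI R | 0 < psub_val z.2] x -> H x = G x.
  by move=> /= x0; rewrite /H leNgt x0.
have cH : continuous H.
  apply: cc_cts.
  - by rewrite (_ : (fun z => ht (H z)) = T) //; apply/funext.
  - move=> z; rewrite hH => z0; apply: (near_eq_for oU (T0 _ z0)) => [x /HG ->//|].
    apply: (@continuous_comp _ _ _ G); first exact: cG.
    by apply: cc_base_cts; rewrite hG.
  - move=> z; rewrite hH => z01; have /andP[z0 _] := z01.
    apply: (near_eq_for oU (T0 _ z0)) => [x /HG ->//|].
    apply: (@continuous_comp _ _ _ G); first exact: cG.
    by apply: cc_side_cts; rewrite hG.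
have pH z : [set p : N | ht p < 1] (H z).
  by rewrite /= hH /T; have := H1 z; have /andP[] := cc_ht01 (psub_val z.1); have := I01 z; nra.
exists (fun z => psub_in cc_t1 (pH z)); split.
- exact: psub_cts.
- by move=> p; apply: psub_val_inj; rewrite /= /H I0E lexx.
- move=> p; apply: psub_val_inj; rewrite -[LHS]/(H (p, I1 R)) HG /= ?ltr01 //.
  by rewrite /G /T -[(p, I1 R).2]/(I1 R) I1E mulr1 cc_move_ht.
- move=> s; apply: psub_val_inj; rewrite -[LHS]/(H (point, s)) /H.
  by case: ifP => // _; rewrite /G /T /= mul0r /cc_move /= clamp0.
Qed.

Lemma cc_mid_node (a : A) : [set p : N | 0 < ht p < 1] (cc_node (a, 2^-1)).
Proof. by rewrite /= cc_node_ht clamp_gt0 clamp_lt1 /=; lra. Qed.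

Let in01_cts : continuous (fun a : A => psub_in cc_t01 (cc_mid_node a)).
Proof.
apply: psub_cts; apply: (@comp_cts _ (A * R)%type N (fun a => (a, 2^-1)) cc_node).
  by cts.
exact: cc_node_cts.
Qed.

Let in01_pt : psub_in cc_t01 (cc_mid_node point) = point.
Proof. exact: psub_val_inj. Qed.

Definition cc_in01 : {pmap A -> N01} := @PMap A N01 _ in01_cts in01_pt.

Let ret01_cts : continuous (fun p : N01 => cc_side (psub_val p)).
Proof.
move=> p; apply: (@continuous_comp _ _ _ (fun p : N01 => psub_val p) (@cc_side R A Y f) p).
  exact: psub_val_cts.
exact: (cc_side_cts (psub_valP p)).
Qed.

Let cc_half : 0 < (2^-1 : R) < 1.
Proof. by lra. Qed.

Let ret01_pt : cc_side (psub_val (point : N01)) = point.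
Proof. exact: (@cc_node_side (point, 2^-1) cc_half). Qed.

Definition cc_ret01 : {pmap N01 -> A} := @PMap N01 A _ ret01_cts ret01_pt.

Lemma cc_in01_heq : homotopy_equivalence R cc_in01.
Proof.
exists cc_ret01; split.
  rewrite (_ : _ \po _ = pidm A); first exact: ph_refl.
  by apply: pmap_eqP => a; exact: (@cc_node_side (a, 2^-1) cc_half).
have cs2 : continuous (fun z : N01 * unitI R => psub_val z.2 : R).
  by apply: (@comp_cts _ (unitI R) R snd (fun s => psub_val s)); [exact: snd_cts|exact: psub_val_cts].
have cp1 : continuous (fun z : N01 * unitI R => psub_val z.1).
  by apply: (@comp_cts _ N01 N fst (fun s => psub_val s)); [exact: fst_cts|exact: psub_val_cts].
pose T (z : N01 * unitI R) := (1 - psub_val z.2) / 2 + psub_val z.2 * ht (psub_val z.1).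
have cT : continuous T.
  apply: addR_cts; first by apply: mulR_cts; [apply: subR_cts => //; cts|cts].
  by apply: mulR_cts => //; apply: (comp_cts cp1); exact: cc_ht_cts.
have H1 (z : N01 * unitI R) : 0 < ht (psub_val z.1) < 1 by exact: (psub_valP z.1).
have T01 z : 0 < T z < 1.
  have := psub_valP z.2; rewrite /= in_itv /= /T; have := H1 z.
  by move=> /andP[? ?] /andP[? ?]; apply/andP; split; nra.
pose G (z : N01 * unitI R) := cc_move (psub_val z.1, T z).
have cG : continuous G.
  by apply: cc_move_cts => // z; have /andP[] := H1 z.
have hG z : ht (G z) = T z.
  have := H1 z; have /andP[? ?] := T01 z.
  rewrite /G /cc_move; case: (psub_val z.1) => [y|[a t]] /=; first by rewrite ltxx andbF.
  by move=> _; rewrite min_r ?max_r // ltW.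
have pG z : [set p : N | 0 < ht p < 1] (G z) by rewrite /= hG.
have node_move p : 0 < ht p < 1 -> cc_move (p, 2^-1) = cc_node (cc_side p, 2^-1) :> N.
  case: p => [y|[a t]] /=; first by rewrite ltxx andbF.
  by move=> _; rewrite /cc_move /cc_node /= ifF ?ifF //; lra.
exists (fun z => psub_in cc_t01 (pG z)); split.
- exact: psub_cts.
- move=> p; apply: psub_val_inj; rewrite -[LHS]/(G (p, I0 R)) /G /T.
  by rewrite -[(p, I0 R).2]/(I0 R) I0E mul0r addr0 subr0 mul1r node_move // H1.
- move=> p; apply: psub_val_inj; rewrite -[LHS]/(G (p, I1 R)) /G /T.
  by rewrite -[(p, I1 R).2]/(I1 R) I1E subrr mul0r add0r mul1r cc_move_ht.
- move=> s; apply: psub_val_inj; rewrite -[LHS]/(G (point, s)) /G.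
  rewrite -[psub_val (point, s).1]/(cc_node (point, 2^-1)).
  have -> : T (point, s) = ht (cc_node (point, 2^-1)).
    rewrite /T -[psub_val (point, s).1]/(cc_node (point, 2^-1)) cc_node_ht /=.
    by rewrite min_r ?max_r; lra.
  by rewrite cc_move_ht.
Qed.

End CoarseConeMaps.

Section HeqvOps.
Context (R : realType).

Definition free_htpy (X S : topologicalType) (f g : X -> S) (F : X * R -> S)
    (cF : continuous F) (F0 : forall x t, t <= 0 -> F (x, t) = f x)
    (F1 : forall x t, 1 <= t -> F (x, t) = g x) : htpy R set0 f g :=
  Htpy cF F0 F1 (fun x t => @no_set0 _ (fun x => F (x, t) = f x) x).

Lemma heqv_of_equivalence (X Y : ptopologicalType) (f : {pmap X -> Y}) :
  homotopy_equivalence R f -> inhabited (heqv R [set point] [set point] f).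
Proof.
move=> [g [/phomotopicP[G] /phomotopicP[F]]]; constructor.
apply: (@Heqv R X Y [set point] [set point] f g).
- exact: pmap_cts.
- exact: pmap_cts.
- by move=> x ->; exact: pmap_pt.
- by move=> x ->; exact: pmap_pt.
- exact: (hinv F).
- exact: G.
Qed.

Definition heqv_forget (X V : topologicalType) (DX : set X) (DV : set V) (i : X -> V)
    (E : heqv R DX DV i) : heqv R set0 set0 i :=
  @Heqv R X V set0 set0 i (hq_inv E) (hq_cts E) (hq_inv_cts E) (@no_set0 _ _) (@no_set0 _ _)
    (hforget (hq_unit E) (@no_set0 _ _)) (hforget (hq_counit E) (@no_set0 _ _)).

Definition heqv_comp (X V U : topologicalType) (DX : set X) (DV : set V) (DU : set U)
    (i : X -> V) (j : V -> U) (E : heqv R DX DV i) (F : heqv R DV DU j) :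
    heqv R DX DU (fun x => j (i x)) :=
  @Heqv R X U DX DU (fun x => j (i x)) (fun u => hq_inv E (hq_inv F u))
    (comp_cts (hq_cts E) (hq_cts F)) (comp_cts (hq_inv_cts F) (hq_inv_cts E))
    (fun x Dx => hq_D F (hq_D E Dx)) (fun u Du => hq_inv_D E (hq_inv_D F Du))
    (hcomp (hq_unit F)
      (hpost (hq_cts F) (hpre (hq_unit E) (hq_inv_cts F) (@hq_inv_D _ _ _ _ _ _ F))))
    (hcomp (hpost (hq_inv_cts E) (hpre (hq_counit F) (hq_cts E) (@hq_D _ _ _ _ _ _ E)))
      (hq_counit E)).

Definition heqv_iso (X V : topologicalType) (DX : set X) (DV : set V) (i : X -> V)
    (k : V -> X) (ci : continuous i) (ck : continuous k)
    (iD : forall x, DX x -> DV (i x)) (kD : forall v, DV v -> DX (k v))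
    (ik : forall v, i (k v) = v) (ki : forall x, k (i x) = x) : heqv R DX DV i :=
  @Heqv R X V DX DV i k ci ck iD kD
    (hcast (hid R DV (@id_cts V)) (fun v => erefl) (fun v => esym (ik v)))
    (hcast (hid R DX (@id_cts X)) (fun x => esym (ki x)) (fun x => erefl)).

End HeqvOps.

Lemma pair_for (X Y Z : topologicalType) (f : X -> Y) (g : X -> Z) x :
  {for x, continuous f} -> {for x, continuous g} ->
  {for x, continuous (fun x => (f x, g x))}.
Proof. by move=> cf cg; apply: cvg_pair; [exact: cf|exact: cg]. Qed.

(** * From the coarse cone to the reduced mapping cone *)

Section Collapse.
Context (R : realType) (A Y : ptopologicalType) (f : {pmap A -> Y}).
Local Notation N := (coarse_cone R f).
Local Notation M := (mapping_cone R f).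
Local Notation base := (mcone_base R f).
Local Notation ht := (@cc_ht R A Y f).
Local Notation cpt := (@cone_pt R A Y f).

Lemma cone_pt_cts : continuous cpt.
Proof. exact: (htpy_cts (h := cone_htpy R f)). Qed.

Lemma cone_pt_le0 a y : y <= 0 -> cpt (a, y) = point.
Proof. exact: (htpy_le0 (cone_htpy R f)). Qed.

Lemma cone_pt_ge1 a y : 1 <= y -> cpt (a, y) = base (f a).
Proof. exact: (htpy_ge1 (cone_htpy R f)). Qed.

Lemma cone_pt_pt y : cpt (point, y) = point.
Proof. exact: (htpy_D (cone_htpy R f)). Qed.

Let k0 (p : N) : M := base (cc_base p).
Let k1 (p : N) : M := point.
Let k2 (z : N * R) : M := cpt (cc_side z.1, 1 - z.2).

(* Collars of both ends are collapsed to make this map continuous for the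
   coarse topology. *)
Definition cc_collapse_fun : N -> M := glue3 ht k0 k1 k2.

Let k2_le0 p s : 0 < ht p < 1 -> s <= 0 -> k2 (p, s) = k0 p.
Proof.
move=> /andP[p0 p1] s0; rewrite /k0 cc_base_mid //.
have s1 : 1 <= 1 - s by lra.
exact: (cone_pt_ge1 (cc_side p) s1).
Qed.

Let k2_ge1 p s : 0 < ht p < 1 -> 1 <= s -> k2 (p, s) = k1 p.
Proof.
move=> _ s1; have s0 : 1 - s <= 0 by lra.
exact: (cone_pt_le0 (cc_side p) s0).
Qed.

Lemma cc_collapse_cts : continuous cc_collapse_fun.
Proof.
apply: glue3_cts.
- exact: cc_ht_cts.
- move=> p p0; apply: (@continuous_comp _ _ _ (@cc_base R A Y f) base).
    exact: cc_base_cts.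
  exact: pmap_cts.
- by move=> p p0; exact: cst_cts.
- move=> z z01.
  apply: (@continuous_comp _ _ _ (fun z : N * R => (cc_side z.1, 1 - z.2)) cpt).
    apply: pair_for.
      apply: (@continuous_comp _ _ _ fst (@cc_side R A Y f)); first exact: fst_cts.
      exact: cc_side_cts.
    suff c : continuous (fun z : N * R => 1 - z.2) by exact: c.
    by cts.
  exact: cone_pt_cts.
- exact: k2_le0.
- exact: k2_ge1.
Qed.

Lemma cc_collapse_base y : cc_collapse_fun (inl y) = base y.
Proof. exact: (@glue3_ge1 _ _ _ ht k0 k1 k2 (inl y : N) (lexx 1)). Qed.

Definition cc_collapse : {pmap N -> M} :=
  @PMap N M cc_collapse_fun cc_collapse_cts (etrans (cc_collapse_base point) (pmap_pt base)).

Lemma cc_node_ge1 a (y : R) : 1 <= y -> cc_node f (a, y) = inl (f a).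
Proof. by move=> y1; rewrite /cc_node -[(a, y).2]/y y1. Qed.

Lemma cc_node_le0 a (y : R) : y <= 0 -> cc_node f (a, y) = cc_apex R f.
Proof. by move=> y0; rewrite /cc_node -[(a, y).2]/y y0 ifF //; lra. Qed.

(** The gluing parameter 2 - 3 y at height y becomes the cone coordinate 1 - (2 - 3 y), so the
    middle third of the heights is stretched over the whole cone. *)
Lemma cc_collapse_node a y : cc_collapse (cc_node f (a, y)) = cpt (a, 3 * y - 1).
Proof.
case: (leP 1 y) => y1.
  rewrite cc_node_ge1 // cone_pt_ge1; last by lra.
  exact: cc_collapse_base.
case: (leP y 0) => y0.
  rewrite cc_node_le0 // cone_pt_le0; last by lra.
  exact: (@glue3_le0 _ _ _ ht k0 k1 k2 (cc_apex R f : N) (lexx 0)).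
have y01 : 0 < (a, y).2 < 1 by apply/andP.
have hy : ht (cc_node f (a, y)) = y.
  by rewrite cc_node_ht -[(a, y).2]/y clampE // !ltW.
have h01 : 0 < ht (cc_node f (a, y)) < 1 by rewrite hy.
apply: (etrans (glue3_mid k0 k1 k2 h01)); rewrite hy /k2.
rewrite -[(_, _).1]/(cc_node f (a, y)) (cc_node_side f y01).
by congr (cpt (_, _)) => /=; lra.
Qed.

End Collapse.

Section CollapseEquivalence.
Context (R : realType) (A Y : ptopologicalType) (f : {pmap A -> Y}).
Local Notation N := (coarse_cone R f).
Local Notation M := (mapping_cone R f).
Local Notation base := (mcone_base R f).
Local Notation ht := (@cc_ht R A Y f).
Local Notation cpt := (@cone_pt R A Y f).
Local Notation N0 := (psub (cc_tp R f)).
Local Notation N1 := (psub (cc_t1 R f)).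
Local Notation N01 := (psub (cc_t01 R f)).
Local Notation X := (one_pt R * A)%type.

Let node_gt0 (z : X * R) :
  [set p : N | 0 < ht p] (cc_node f (z.1.2, Num.max 2^-1 (2^-1 + z.2 / 2))).
Proof. by rewrite /mkset cc_node_ht clamp_gt0 -[(_, _).2]/(Num.max _ _) lt_max; lra. Qed.

Let node_lt1 (z : X * R) :
  [set p : N | ht p < 1] (cc_node f (z.1.2, Num.min 2^-1 (2^-1 - z.2 / 2))).
Proof. by rewrite /mkset cc_node_ht clamp_lt1 -[(_, _).2]/(Num.min _ _) gt_min; lra. Qed.

Let i (x : X) : N01 := cc_in01 R f x.2.

Let h0_fun (z : X * R) : N0 := psub_in (cc_tp R f) (node_gt0 z).
Let h1_fun (z : X * R) : N1 := psub_in (cc_t1 R f) (node_lt1 z).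

Let h0_cts : continuous h0_fun.
Proof.
apply: psub_cts; apply: (@comp_cts _ (A * R)%type N (fun z : X * R => (z.1.2, Num.max 2^-1 (2^-1 + z.2 / 2))) (cc_node f)).
  by cts.
exact: cc_node_cts.
Qed.

Let h1_cts : continuous h1_fun.
Proof.
apply: psub_cts; apply: (@comp_cts _ (A * R)%type N (fun z : X * R => (z.1.2, Num.min 2^-1 (2^-1 - z.2 / 2))) (cc_node f)).
  by cts.
exact: cc_node_cts.
Qed.

Let h0_le0 x s : s <= 0 -> h0_fun (x, s) = mid_in0 (cc_tp R f) (i x).
Proof.
move=> s0; apply: psub_val_inj.
rewrite -[LHS]/(cc_node f (x.2, Num.max 2^-1 (2^-1 + s / 2))) max_l //; lra.
Qed.

Let h0_ge1 x s : 1 <= s -> h0_fun (x, s) = cc_in0 R f (f x.2).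
Proof.
move=> s0; apply: psub_val_inj.
rewrite -[LHS]/(cc_node f (x.2, Num.max 2^-1 (2^-1 + s / 2))) max_r; last by lra.
by rewrite cc_node_ge1 //; lra.
Qed.

Let h1_le0 x s : s <= 0 -> h1_fun (x, s) = mid_in1 (cc_t1 R f) (i x).
Proof.
move=> s0; apply: psub_val_inj.
rewrite -[LHS]/(cc_node f (x.2, Num.min 2^-1 (2^-1 - s / 2))) min_l //; lra.
Qed.

Let h1_ge1 x s : 1 <= s -> h1_fun (x, s) = cc_in1 R f x.1.
Proof.
move=> s0; apply: psub_val_inj.
rewrite -[LHS]/(cc_node f (x.2, Num.min 2^-1 (2^-1 - s / 2))) min_r; last by lra.
by rewrite cc_node_le0 //; lra.
Qed.

Let h0 : htpy R set0 (fun x => mid_in0 (cc_tp R f) (i x)) (fun x => cc_in0 R f (f x.2)) :=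
  free_htpy h0_cts h0_le0 h0_ge1.
Let h1 : htpy R set0 (fun x => mid_in1 (cc_t1 R f) (i x)) (fun x => cc_in1 R f x.1) :=
  free_htpy h1_cts h1_le0 h1_ge1.

Let hE x s : cover_htpy h0 h1 (x, s) = cc_node f (x.2, 1 - s).
Proof.
rewrite /cover_htpy; case: (leP s 2^-1) => s2.
  rewrite hcomp_l // -[LHS]/(cc_node f (x.2, Num.max 2^-1 (2^-1 + (1 - 2 * s) / 2))).
  rewrite max_r; last by lra.
  by congr (cc_node f (_, _)); lra.
rewrite hcomp_r // -[LHS]/(cc_node f (x.2, Num.min 2^-1 (2^-1 - (2 * s - 1) / 2))).
rewrite min_r; last by lra.
by congr (cc_node f (_, _)); lra.
Qed.

(** Recognition with a one-point space as [K]: the parts of the coarse cone deform to [Y] and to a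
    point, their intersection to [A]. Well-pointedness enters because one cone is unreduced and the
    other reduced. *)
Theorem cc_collapse_heq : h_well_pointed R A -> homotopy_equivalence R (cc_collapse R f).
Proof.
move=> hA; have csnd : continuous (@snd (one_pt R) A) := @snd_cts _ _.
have cfst : continuous (@fst (one_pt R) A) := @fst_cts _ _.
have cw : continuous (fun x : X => f x.2) by cts; exact: pmap_cts.
have [E0] := heqv_of_equivalence (cc_in0_heq R f).
have [E1] := heqv_of_equivalence (cc_in1_heq R f).
have [E01] := heqv_of_equivalence (cc_in01_heq R f).
have cpr : continuous (fun a : A => ((point, a) : X)) by cts.
pose Es : heqv R set0 set0 (@snd (one_pt R) A) :=
  heqv_iso R csnd cpr (@no_set0 _ _) (@no_set0 _ _) (fun a => erefl)
   (fun x : X => injective_projections (point, x.2) x (one_pt_eq _ _) erefl).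
pose Ei : heqv R set0 set0 i := heqv_comp Es (heqv_forget E01).
have uni : hpo_uniq cw cfst (cover_htpy h0 h1).
  exact: (@cover_hpo_uniq R N ht (@cc_ht_cts R A Y f) (cc_tp R f) (lexx 1) _ (cc_t1 R f) _ (cc_t01 R f)
    Y X (one_pt R) _ cw _ cfst (cc_in0 R f) (cc_in1 R f) i E0 (heqv_forget E1) Ei h0 h1).
have sq : null_square R csnd cfst.
  apply: halfsmash_null_square => //.
  - by move=> a; exists (point, a).
  - move=> S F cF Fpt.
    exists (@PMap A S (fun a => F (point, a)) (comp_cts cpr cF) (Fpt point)) => -[c a].
    by rewrite /= (one_pt_eq c point).
have rb y : cc_collapse R f (cover_base (cc_in0 R f) y) = base y := cc_collapse_base R f y.
have rt c : cc_collapse R f (cover_top (cc_in1 R f) c) = point.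
  by apply: (@glue3_le0 R N M (@cc_ht R A Y f)); exact: lexx.
pose cb := @pmap_cts _ _ base.
pose P : htpy R [set point] _ base := hcast (hid R [set point] cb) (fun y => esym (rb y)) (fun=> erefl).
pose Q : htpy R set0 _ (fun=> point) :=
  hcast (hid R set0 (@cst_cts (one_pt R) M point)) (fun c => esym (rt c)) (fun=> erefl).
have [|e [/heq_inverse_sym he _]] := @cone_recognition R X (one_pt R) A Y N _ csnd _ cfst f cw
  _ _ (cover_htpy h0 h1) (cc_collapse R f) P Q sq uni; last by exists e.
(* Above a, the left side descends with cone coordinate 3 (1 - 2 s) - 1 and then rests; the right
   side rests first and then descends. *)
apply: (@heq_reparam R _ _ _ _ _ (hpre (cone_htpy R f) csnd (@no_set0 _ (fun x => [set point] x.2)))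
  (fun t => 2 - 6 * t) (fun t => 2 - 2 * t)).
- by cts.
- by cts.
- move=> x s; rewrite -[RHS]/(cpt (x.2, 2 - 6 * s)); case: (leP s 2^-1) => s2.
    rewrite hcomp_l // -[LHS]/(cc_collapse R f (cover_htpy h0 h1 (x, 2 * s))) hE.
    by rewrite cc_collapse_node; congr (cpt (_, _)); lra.
  by rewrite hcomp_r // cone_pt_le0 //; lra.
- move=> x s; rewrite -[RHS]/(cpt (x.2, 2 - 2 * s)); case: (leP s 2^-1) => s2.
    by rewrite hcomp_l // cone_pt_ge1 //; lra.
  rewrite hcomp_r // -[LHS]/(cpt (x.2, 1 - (2 * s - 1))).
  by congr (cpt (_, _)); lra.
- by move=> t t0; right; lra.
- by move=> t t0; left; lra.
Qed.

End CollapseEquivalence.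

(** * The fibration over the coarse mapping cone *)

Section Restriction.
Context (R : realType) (Z N : ptopologicalType) (th : {pmap N -> Z}) (U : set N).
Context (n0 : N) (Un0 : U n0) (th0 : th n0 = point).
Local Notation W := (pfib R th).
Context (w0 : W) (Uw0 : [set w : W | U (pfib_proj R th w)] w0).

Definition th_on : {pmap psub Un0 -> Z} :=
  @PMap (psub Un0) Z (fun x => th (psub_val x))
    (comp_cts (@psub_val_cts _ _ _ Un0) (@pmap_cts _ _ th)) th0.

Lemma restr_in_cts_aux :
  continuous (fun e : pfib R th_on => psub_val (pfib_proj R th_on e)).
Proof.
apply: (@comp_cts _ (psub Un0) _ (pfib_proj R th_on)); first exact: pmap_cts.
exact: psub_val_cts.
Qed.

Definition restr_in_val (e : pfib R th_on) : W :=
  pfam (m := fun e => psub_val (pfib_proj R th_on e)) (@pev_cts R Z _ th_on)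
    (fun e => pev0 e (lexx 0)) (fun e => pev1 e (lexx 1)) e.

Lemma restr_in_valP e : [set w : W | U (pfib_proj R th w)] (restr_in_val e).
Proof. exact: (psub_valP (pfib_proj R th_on e)). Qed.

Definition restr_in (e : pfib R th_on) : psub Uw0 := psub_in Uw0 (restr_in_valP e).

Lemma restr_in_cts : continuous restr_in.
Proof. by apply: psub_cts; apply: pfam_cts; exact: restr_in_cts_aux. Qed.

Definition restr_base (w : psub Uw0) : psub Un0 := psub_in Un0 (psub_valP w).

Lemma restr_out_cts_aux : continuous (fun z : psub Uw0 * R => pev (psub_val z.1, z.2)).
Proof.
apply: (@comp_cts _ (W * R)%type _ (fun z : psub Uw0 * R => (psub_val z.1, z.2)) (@pev R Z N th)).
  by cts; exact: psub_val_cts.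
exact: pev_cts.
Qed.

Definition restr_out (w : psub Uw0) : pfib R th_on :=
  pfam (th := th_on) (m := restr_base) restr_out_cts_aux
    (fun w => pev0 (psub_val w) (lexx 0)) (fun w => pev1 (psub_val w) (lexx 1)) w.

Lemma restr_out_cts : continuous restr_out.
Proof.
apply: pfam_cts; apply: psub_cts.
apply: (@comp_cts _ W _ (fun w : psub Uw0 => psub_val w) (pfib_proj R th)).
  exact: psub_val_cts.
exact: pmap_cts.
Qed.

Lemma restr_in_pev e s : 0 <= s <= 1 -> pev (psub_val (restr_in e), s) = pev (e, s).
Proof. by move=> s01; rewrite -[psub_val _]/(restr_in_val e) pfam_pev. Qed.

Lemma restr_out_pev w s : 0 <= s <= 1 -> pev (restr_out w, s) = pev (psub_val w, s).
Proof. by move=> s01; rewrite pfam_pev. Qed.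

Lemma restr_inK e : restr_out (restr_in e) = e.
Proof.
apply: pfib_eq; first exact: psub_val_inj.
by move=> s s01; rewrite restr_out_pev // restr_in_pev.
Qed.

Lemma restr_outK w : restr_in (restr_out w) = w.
Proof.
apply: psub_val_inj; apply: pfib_eq => // s s01.
by rewrite restr_in_pev // restr_out_pev.
Qed.

(** The part of a homotopy fibre over a subspace is homeomorphic to the homotopy fibre of the
    restriction. The base points [n0] and [w0] may be unrelated, so the equivalence is free; it is
    pointed once [w0] is the constant path at [n0]. *)
Definition restr_heqv : heqv R set0 set0 restr_in :=
  heqv_iso R restr_in_cts restr_out_cts (@no_set0 _ _) (@no_set0 _ _) restr_outK restr_inK.

Hypothesis w0_proj : pfib_proj R th w0 = n0.
Hypothesis w0_pev : forall s, pev (w0, s) = point.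

Lemma restr_in_pt : restr_in point = point.
Proof.
apply: psub_val_inj; apply: pfib_eq; first exact: esym.
by move=> s s01; rewrite restr_in_pev // pev_pt -[RHS]w0_pev.
Qed.

Lemma restr_out_pt : restr_out point = point.
Proof. by rewrite -restr_in_pt restr_inK. Qed.

Definition restr_heqv_pt : heqv R [set point] [set point] restr_in :=
  heqv_iso R restr_in_cts restr_out_cts
    (fun x (e : [set point] x) => etrans (congr1 restr_in e) restr_in_pt)
    (fun x (e : [set point] x) => etrans (congr1 restr_out e) restr_out_pt) restr_outK restr_inK.

End Restriction.

Section TrivialFibration.
Context (R : realType) (Z A : ptopologicalType).
Local Notation T := (loop R Z).
Local Notation P := (pfib R (pcst A Z)).

Let F (z : (T * A) * R) : Z := psub_val z.1.1 (clamp z.2).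

Let cF : continuous F.
Proof.
apply: (@path_app_cts R _ Z (fun z : (T * A) * R => psub_val z.1.1) (fun z => clamp z.2)).
  by cts; exact: psub_val_cts.
by cts; exact: clamp_cts.
Qed.

Let F0 x : F (x, 0) = point.
Proof. by rewrite /F clamp0 loop0. Qed.

Let F1 x : F (x, 1) = pcst A Z x.2.
Proof. by rewrite /F clamp1 loop1. Qed.

Definition triv_in : T * A -> P := pfam (m := snd) cF F0 F1.

Lemma triv_in_cts : continuous triv_in.
Proof. by apply: pfam_cts; exact: snd_cts. Qed.

Lemma triv_in_pev c a s : 0 <= s <= 1 -> pev (triv_in (c, a), s) = psub_val c (clamp s).
Proof. by move=> s01; rewrite pfam_pev. Qed.

Lemma triv_out_subproof (e : P) :
  [set w : free_path R Z | w (I0 R) = point /\ w (I1 R) = point] (psub_val (psub_val e).2).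
Proof. by split; [exact: (psub_valP (psub_val e).2)|exact: pfibP]. Qed.

Definition triv_out (e : P) : T * A :=
  (psub_in (@loop_set_cst R Z) (triv_out_subproof e), pfib_proj R (pcst A Z) e).

Lemma triv_out_cts : continuous triv_out.
Proof.
apply: pair_cts; last exact: pmap_cts.
apply: psub_cts.
apply: (@comp_cts P (A * path_space R Z)%type _ (fun e => psub_val e) (fun x => psub_val x.2)).
  exact: psub_val_cts.
apply: (@comp_cts _ (path_space R Z) _ snd); [exact: snd_cts|exact: psub_val_cts].
Qed.

Lemma triv_inK x : triv_out (triv_in x) = x.
Proof.
case: x => c a; congr (_, _); apply: psub_val_inj; apply: free_path_eq => s.
by rewrite -[LHS]/(psub_val c (clamp (psub_val s))) clampK.
Qed.

Lemma triv_outK e : triv_in (triv_out e) = e.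
Proof. by apply: pfib_eq => // s s01; rewrite triv_in_pev. Qed.

Definition triv_heqv : heqv R set0 set0 triv_in :=
  heqv_iso R triv_in_cts triv_out_cts (@no_set0 _ _) (@no_set0 _ _) triv_outK triv_inK.

End TrivialFibration.

Section ActionCofibration.
Context (R : realType) (A Y Z : ptopologicalType) (f : {pmap A -> Y}).
Context (phi : {pmap mapping_cone R f -> Z}).
Local Notation N := (coarse_cone R f).
Local Notation M := (mapping_cone R f).
Local Notation base := (mcone_base R f).
Local Notation ht := (@cc_ht R A Y f).
Local Notation cpt := (@cone_pt R A Y f).
Local Notation N0 := (psub (cc_tp R f)).
Local Notation N1 := (psub (cc_t1 R f)).
Local Notation N01 := (psub (cc_t01 R f)).
Local Notation T := (loop R Z).
Local Notation X := (T * A)%type.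
Local Notation kap := (cc_collapse R f).
Local Notation th := (phi \po kap).
Local Notation h := (phi \po base).
Local Notation E := (pfib R h).
Local Notation W := (pfib R th).

(** The values of [th] on the segment of the coarse cone above a; the coordinate 3 y - 1 comes from
    the collars collapsed by [cc_collapse]. *)
Definition edge (z : A * R) : Z := phi (cpt (z.1, 3 * z.2 - 1)).

Lemma edge_cts : continuous edge.
Proof.
apply: (@comp_cts _ (A * R)%type Z (fun z : A * R => (z.1, 3 * z.2 - 1)) (fun z => phi (cpt z))).
  by cts.
by apply: (@comp_cts _ M); [exact: cone_pt_cts|exact: pmap_cts].
Qed.

Lemma edge_le0 a y : y <= 0 -> edge (a, y) = point.
Proof. move=> y0; rewrite /edge -[(a, y).1]/a -[(a, y).2]/y cone_pt_le0; last by lra.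
exact: pmap_pt. Qed.

Lemma edge_ge1 a y : 1 <= y -> edge (a, y) = h (f a).
Proof. by move=> y1; rewrite /edge -[(a, y).1]/a -[(a, y).2]/y cone_pt_ge1 //; lra. Qed.

Lemma edge_pt y : edge (point, y) = point.
Proof. by rewrite /edge cone_pt_pt pmap_pt. Qed.

Lemma th_node a y : th (cc_node f (a, y)) = edge (a, y).
Proof. by rewrite -[LHS]/(phi (kap (cc_node f (a, y)))) cc_collapse_node. Qed.

Definition edge_lift (a : A) : E :=
  pfam (th := h) (m := f) edge_cts (fun a => edge_le0 a (lexx 0)) (fun a => edge_ge1 a (lexx 1)) a.

(* The loop [c], followed by the part of the edge over [a] below height [y]. *)
Definition ladder_path (z : (X * R) * R) : Z :=
  if z.2 <= 2^-1 then psub_val z.1.1.1 (clamp (2 * z.2))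
  else edge (z.1.1.2, z.1.2 * (2 * z.2 - 1)).

Lemma ladder_path_cts : continuous ladder_path.
Proof.
apply: glue_le.
- by cts.
- by cts.
- apply: (@path_app_cts R _ Z (fun z : (X * R) * R => psub_val z.1.1.1) (fun z => clamp (2 * z.2))).
    by cts; exact: psub_val_cts.
  by cts; exact: clamp_cts.
- apply: (@comp_cts _ (A * R)%type Z (fun z : (X * R) * R => (z.1.1.2, z.1.2 * (2 * z.2 - 1))) edge).
    by cts.
  exact: edge_cts.
- move=> [[[c a] y] s] /= ->; rewrite divff // clamp1 loop1 subrr mulr0 edge_le0 //.
Qed.

Lemma ladder_path0 z : ladder_path (z, 0) = point.
Proof. by rewrite /ladder_path ifT /= ?mulr0 ?clamp0 ?loop0 //; lra. Qed.

Lemma ladder_path1 (z : X * R) : ladder_path (z, 1) = th (cc_node f (z.1.2, z.2)).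
Proof.
rewrite th_node /ladder_path -[(z, 1).2]/1 ifF; last by lra.
by congr (edge (_, _)); rewrite -[(z, 1).1]/z; lra.
Qed.

Lemma ladder_base_cts : continuous (fun z : X * R => cc_node f (z.1.2, z.2)).
Proof.
apply: (@comp_cts _ (A * R)%type N (fun z : X * R => (z.1.2, z.2)) (cc_node f)).
  by cts.
exact: cc_node_cts.
Qed.

(** The heights 1, 1/2 and 0 yield the maps from T x A into the two parts of [W] and their
    intersection; moving along the ladder is the homotopy that compares them. *)
Definition ladder (z : X * R) : W :=
  pfam (th := th) (m := fun z : X * R => cc_node f (z.1.2, z.2)) ladder_path_cts
    ladder_path0 ladder_path1 z.

Lemma ladder_cts : continuous ladder.
Proof. exact: (pfam_cts ladder_base_cts). Qed.

Lemma ladder_ht z : ht (pfib_proj R th (ladder z)) = psub_val (clamp z.2).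
Proof. exact: cc_node_ht. Qed.

Local Notation t := (fun w : W => ht (pfib_proj R th w)).

Lemma t_cts : continuous t.
Proof. by apply: (@comp_cts W N R (pfib_proj R th) ht); [exact: pmap_cts|exact: cc_ht_cts]. Qed.

Let tp : [set w : W | 0 < t w] point := ltr01.

Let w1 : W := ladder (point, 0).
Let tw1 : [set w : W | t w < 1] w1.
Proof. by rewrite /mkset ladder_ht clamp_lt1 -[(_, _).2]/0 ltr01. Qed.

Let w01 : W := ladder (point, 2^-1).
Let tw01 : [set w : W | 0 < t w < 1] w01.
Proof. by rewrite /mkset ladder_ht clamp_gt0 clamp_lt1 -[(_, _).2]/(2^-1); lra. Qed.

Local Notation W0 := (psub tp).
Local Notation W1 := (psub tw1).
Local Notation W01 := (psub tw01).

Let th_apex : th (cc_apex R f) = point.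
Proof. by rewrite -(@cc_node_le0 R A Y f point 0) ?lexx // th_node edge_pt. Qed.

Let th_mid : th (cc_node f (point, 2^-1)) = point.
Proof. by rewrite th_node edge_pt. Qed.

Let th0 := th_on (cc_tp R f) (pmap_pt th).
Let th1 := th_on (cc_t1 R f) th_apex.
Let th01 := th_on (cc_t01 R f) th_mid.

Let vE y : h y = th0 (cc_in0 R f y).
Proof. exact: (congr1 phi (esym (cc_collapse_base R f y))). Qed.

Let r0 := @restr_in R Z N th [set p | 0 < ht p] point (cc_tp R f) (pmap_pt th) point tp.

Let v : {pmap E -> W0} :=
  @PMap E W0 (fun e => r0 (pf_map R vE e))
    (comp_cts (@pmap_cts _ _ (pf_map R vE)) (@restr_in_cts _ _ _ _ _ _ _ _ _ _))
    (etrans (congr1 r0 (pmap_pt (pf_map R vE)))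
       (@restr_in_pt R Z N th _ point (cc_tp R f) (pmap_pt th) point tp erefl (@pev_pt R Z N th))).

Let v_heqv : inhabited (heqv R [set point] [set point] v).
Proof.
have [e] := heqv_of_equivalence (pf_map_heq vE (cc_in0_heq R f)); constructor.
exact: (heqv_comp e (@restr_heqv_pt R Z N th [set p | 0 < ht p] point (cc_tp R f) (pmap_pt th)
  point tp erefl (@pev_pt R Z N th))).
Qed.

Let v_pev e s : 0 <= s <= 1 -> pev (psub_val (v e), s) = pev (e, s).
Proof.
by move=> s01; rewrite -[psub_val (v e)]/(psub_val (r0 (pf_map R vE e))) restr_in_pev // pf_map_pev.
Qed.

(** Transport along the constant homotopy only rescales: the loop takes the first half of the time
    and then rests, exactly as in the ladder at height 0. *)
Let cst_htpy : htpy R [set point] (pcst (one_pt R) Z) (pcst (one_pt R) Z) :=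
  hid R [set point] (@cst_cts (one_pt R) Z point).

Let kE x : pcst (one_pt R) Z x = th1 (cc_in1 R f x).
Proof. exact: (esym th_apex). Qed.

Let r1 := @restr_in R Z N th [set p | ht p < 1] (cc_apex R f) (cc_t1 R f) th_apex w1 tw1.

Let k (c : T) : W1 := r1 (pf_map R kE (transport cst_htpy (triv_in (c, point)))).

Let k_heqv : inhabited (heqv R set0 set0 k).
Proof.
have [e1] := heqv_of_equivalence (transport_heq cst_htpy).
have [e2] := heqv_of_equivalence (pf_map_heq kE (cc_in1_heq R f)).
have cin : continuous (fun c : T => (c, point : one_pt R)) by cts.
pose e0 : heqv R set0 set0 (fun c : T => (c, point : one_pt R)) :=
  heqv_iso R cin (@fst_cts T (one_pt R)) (@no_set0 _ _) (@no_set0 _ _)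
   (fun x : T * one_pt R => injective_projections (x.1, point) x erefl (one_pt_eq _ _))
   (fun c => erefl).
constructor.
exact: (heqv_comp (heqv_comp (heqv_comp (heqv_comp e0 (triv_heqv R Z (one_pt R)))
  (heqv_forget e1)) (heqv_forget e2)) (@restr_heqv R Z N th _ _ (cc_t1 R f) th_apex w1 tw1)).
Qed.

Let k_pev c s : 0 <= s <= 1 -> pev (psub_val (k c), s) = ladder_path (((c, point), 0), s).
Proof.
move=> s01; rewrite -[psub_val (k c)]/(psub_val (r1 _)) restr_in_pev // pf_map_pev //.
rewrite transport_pev // /ladder_path -[(_, s).2]/s; case: (leP s 2^-1) => s2.
  rewrite pext_path_le; last by lra.
  by rewrite triv_in_pev //; lra.
rewrite pext_path_ge; last by lra.
by rewrite edge_pt.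
Qed.

(** The lower half of the edge joins the constant map to [th] on the middle nodes; transport along
    it trivialises the fibration over the intersection. *)
Let half_edge (z : A * R) : Z := edge (z.1, psub_val (clamp z.2) / 2).

Let half_edge_cts : continuous half_edge.
Proof.
apply: (@comp_cts _ (A * R)%type Z (fun z : A * R => (z.1, psub_val (clamp z.2) / 2)) edge).
  by cts; [exact: clamp_cts|exact: psub_val_cts].
exact: edge_cts.
Qed.

Let half_le0 a s : s <= 0 -> half_edge (a, s) = pcst A Z a.
Proof. by move=> s0; rewrite /half_edge -[(a, s).2]/s clamp_le0 // I0E mul0r edge_le0. Qed.

Let half_ge1 a s : 1 <= s -> half_edge (a, s) = (th01 \po cc_in01 R f) a.
Proof.
move=> s0; rewrite /half_edge -[(a, s).2]/s clamp_ge1 // I1E mul1r.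
exact: (esym (th_node a 2^-1)).
Qed.

Let half_pt a s : [set point] a -> half_edge (a, s) = pcst A Z a.
Proof. by move=> ->; exact: edge_pt. Qed.

Let half_htpy : htpy R [set point] (pcst A Z) (th01 \po cc_in01 R f) :=
  Htpy half_edge_cts half_le0 half_ge1 half_pt.

Let iE a : (th01 \po cc_in01 R f) a = th01 (cc_in01 R f a).
Proof. by []. Qed.

Let r01 := @restr_in R Z N th [set p | 0 < ht p < 1] _ (cc_t01 R f) th_mid w01 tw01.

Let i (x : X) : W01 := r01 (pf_map R iE (transport half_htpy (triv_in x))).

Let i_heqv : inhabited (heqv R set0 set0 i).
Proof.
have [e1] := heqv_of_equivalence (transport_heq half_htpy).
have [e2] := heqv_of_equivalence (pf_map_heq iE (cc_in01_heq R f)).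
constructor.
exact: (heqv_comp (heqv_comp (heqv_comp (triv_heqv R Z A)
  (heqv_forget e1)) (heqv_forget e2)) (@restr_heqv R Z N th _ _ (cc_t01 R f) th_mid w01 tw01)).
Qed.

Let iW x : psub_val (i x) = ladder (x, 2^-1).
Proof.
apply: pfib_eq => // s s01; rewrite -[psub_val (i x)]/(psub_val (r01 _)) restr_in_pev //.
rewrite pf_map_pev // transport_pev // pfam_pev // /ladder_path -[(_, s).2]/s; case: (leP s 2^-1) => s2.
  rewrite pext_path_le; last by lra.
  by case: x => c a; rewrite triv_in_pev //; lra.
rewrite pext_path_ge; last by lra.
rewrite -[LHS]/(edge (x.2, psub_val (clamp (2 * s - 1)) / 2)) clampE; last by lra.
by congr (edge (_, _)) => /=; lra.
Qed.

Let kW x : psub_val (k x.1) = ladder (x, 0).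
Proof.
apply: pfib_eq; first exact: (esym (cc_node_le0 f x.2 (lexx 0))).
move=> s s01; rewrite k_pev // pfam_pev // /ladder_path -[(_, s).2]/s; case: leP => // s2.
by rewrite !mul0r !edge_le0.
Qed.

(** Concatenation enters here: at full height the ladder is, strictly, the action of the loop on the
    canonical lift of the point of [A]. *)
Let vW (x : X) : psub_val (v (concat_action R h (x.1, edge_lift x.2))) = ladder (x, 1).
Proof.
apply: pfib_eq.
  exact: (esym (cc_node_ge1 f x.2 (lexx 1))).
move=> s s01; rewrite v_pev // pfam_pev // /ladder_path -[(_, s).2]/s mul1r.
rewrite -[LHS]/(concat_fun (x.1, (psub_val (edge_lift x.2)).2) (clamp s)).
rewrite /concat_fun clampE //; case: (leP s 2^-1) => s2 //.
rewrite -[LHS]/(edge (x.2, psub_val (clamp (2 * s - 1)))) clampE //; lra.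
Qed.

Let up (s : R) : R := 2^-1 + psub_val (clamp s) / 2.
Let down (s : R) : R := 2^-1 - psub_val (clamp s) / 2.

Let clamp01 (s : R) : 0 <= psub_val (clamp s) <= 1.
Proof. by have := psub_valP (clamp s); rewrite /= in_itv. Qed.

Let up_gt0 (z : X * R) : [set w : W | 0 < t w] (ladder (z.1, up z.2)).
Proof. by rewrite /mkset ladder_ht clamp_gt0 -[(_, _).2]/(up z.2) /up; have := clamp01 z.2; lra. Qed.

Let down_lt1 (z : X * R) : [set w : W | t w < 1] (ladder (z.1, down z.2)).
Proof. by rewrite /mkset ladder_ht clamp_lt1 -[(_, _).2]/(down z.2) /down; have := clamp01 z.2; lra. Qed.

Let up_fun (z : X * R) : W0 := psub_in tp (up_gt0 z).
Let down_fun (z : X * R) : W1 := psub_in tw1 (down_lt1 z).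

Let up_cts : continuous up_fun.
Proof.
apply: psub_cts; apply: (@comp_cts _ (X * R)%type W (fun z : X * R => (z.1, up z.2)) ladder).
  by rewrite /up; cts; [exact: clamp_cts|exact: psub_val_cts].
exact: ladder_cts.
Qed.

Let down_cts : continuous down_fun.
Proof.
apply: psub_cts; apply: (@comp_cts _ (X * R)%type W (fun z : X * R => (z.1, down z.2)) ladder).
  by rewrite /down; cts; [exact: clamp_cts|exact: psub_val_cts].
exact: ladder_cts.
Qed.

Let up_le0 x s : s <= 0 -> up_fun (x, s) = mid_in0 tp (i x).
Proof.
move=> s0; apply: psub_val_inj; rewrite -[LHS]/(ladder (x, up s)) /up clamp_le0 // I0E mul0r addr0.
exact: (esym (iW x)).
Qed.

Let up_ge1 x s : 1 <= s -> up_fun (x, s) = v (concat_action R h (x.1, edge_lift x.2)).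
Proof.
move=> s0; apply: psub_val_inj; rewrite -[LHS]/(ladder (x, up s)) /up clamp_ge1 // I1E vW.
by congr (ladder (_, _)); lra.
Qed.

Let down_le0 x s : s <= 0 -> down_fun (x, s) = mid_in1 tw1 (i x).
Proof.
move=> s0; apply: psub_val_inj; rewrite -[LHS]/(ladder (x, down s)) /down clamp_le0 // I0E mul0r subr0.
exact: (esym (iW x)).
Qed.

Let down_ge1 x s : 1 <= s -> down_fun (x, s) = k x.1.
Proof.
move=> s0; apply: psub_val_inj; rewrite -[LHS]/(ladder (x, down s)) /down clamp_ge1 // I1E kW.
by congr (ladder (_, _)); lra.
Qed.

Context (u : {pmap hsmash T A -> E}).
Local Notation pi := (ppi (@hsmash_rel T A)).

Lemma hsmash_pi_pt c : pi (c, point) = point.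
Proof. by rewrite -[RHS](pmap_pt pi); apply: ppi_eq; split. Qed.

Lemma hsmash_pi_lift (S : ptopologicalType) (F : X -> S) :
  continuous F -> (forall c, F (c, point) = point) ->
  exists G : {pmap hsmash T A -> S}, forall z, G (pi z) = F z.
Proof.
move=> cF Fpt; pose F' : {pmap X -> S} := @PMap X S F cF (Fpt point).
have F'r (x y : X) : hsmash_rel x y -> F' x = F' y.
  by case: x => c a [/= -> ->]; rewrite (Fpt c); exact: (esym (Fpt point)).
by exists (plift F'r) => z; exact: (pliftE F'r z).
Qed.

(* Both the mapping cone of [u] and the fibration over the coarse mapping cone
   are homotopy pushouts of [E <- T * A -> T]. *)
Theorem action_cofibration
    (Q : htpy R set0 (fun x : X => concat_action R h (x.1, edge_lift x.2)) (fun x => u (pi x))) :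
  h_well_pointed R A -> homotopy_cofibration R u (pfib_pull R phi base).
Proof.
move=> hA; have cpi := @pmap_cts _ _ pi.
have cfst : continuous (@fst T A) := @fst_cts _ _.
have cw : continuous (fun x : X => u (pi x)) by apply: comp_cts cpi _; exact: pmap_cts.
have [Ev] := v_heqv; have [Ek] := k_heqv; have [Ei] := i_heqv.
(* Climbing the ladder ends at the action on the canonical lift, which [Q] then replaces by [u]
   after the projection to the half-smash. *)
pose h0 : htpy R set0 (fun x => mid_in0 tp (i x)) (fun x => v (u (pi x))) :=
  hcomp (free_htpy up_cts up_le0 up_ge1) (hpost (@pmap_cts _ _ v) Q).
pose h1 : htpy R set0 (fun x => mid_in1 tw1 (i x)) (fun x => k x.1) :=
  free_htpy down_cts down_le0 down_ge1.
have t_pt : 1 <= t point by exact: lexx.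
have sq : null_square R cpi cfst.
  apply: halfsmash_null_square => //; [exact: hsmash_pi_pt|exact: ppi_surj|exact: hsmash_pi_lift].
pose H : htpy R set0 (fun x => mcone_base R u (u (pi x))) (fun x : X => point) :=
  hinv (hpre (cone_htpy R u) cpi (@no_set0 _ (fun x => [set point] (pi x)))).
(* The null homotopy built into the mapping cone of [u] makes it a receiver of the pushout data,
   constant on [T]; this produces the map from [W] to the cone. *)
have [rho [P [Q1 rel]]] := @cover_hpo_exist R W t t_cts tp t_pt w1 tw1 w01 tw01 E X T _ cw _ cfst
  v k i Ev Ek Ei h0 h1 (mapping_cone R u) (mcone_base R u) (fun=> point) H (@cst_cts _ _ _).
have uni : hpo_uniq cw cfst (cover_htpy h0 h1).
  exact: (@cover_hpo_uniq R W t t_cts tp t_pt w1 tw1 w01 tw01 E X T _ cw _ cfst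
    v k i Ev Ek Ei h0 h1).
have [e [he eb]] := @cone_recognition R X T (hsmash T A) E W _ cpi _ cfst u cw
  _ _ (cover_htpy h0 h1) rho P Q1 sq uni rel.
have kapE x : th x = phi (kap x) by [].
exists (pf_map R kapE \po e); split.
  apply: heq_comp; first by exists rho.
  exact: (pf_map_heq kapE (cc_collapse_heq f hA)).
rewrite (_ : _ \po _ = pfib_pull R phi base); first exact: ph_refl.
apply: pmap_eqP => y; rewrite -[LHS]/(pf_map R kapE (e (mcone_base R u y))) eb.
apply: pfib_eq.
  exact: (cc_collapse_base R f (pfib_proj R h y)).
move=> s s01; rewrite pf_map_pev // -[cover_base _ _]/(psub_val (v y)).
by rewrite v_pev.
Qed.

End ActionCofibration.

Lemma ph_prod (R : realType) (X X' Y Y' : ptopologicalType) (f f' : {pmap X -> Y})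
    (g g' : {pmap X' -> Y'}) :
  phomotopic R f f' -> phomotopic R g g' -> phomotopic R (f \px g) (f' \px g').
Proof.
move=> /phomotopicP[F] /phomotopicP[G]; apply/phomotopicP; constructor.
exists (fun z => (F (z.1.1, z.2), G (z.1.2, z.2))).
- by cts; exact: htpy_cts.
- by move=> x t t0; rewrite (htpy_le0 F) // (htpy_le0 G).
- by move=> x t t1; rewrite (htpy_ge1 F) // (htpy_ge1 G).
- by move=> x t ->; rewrite (htpy_D F) // (htpy_D G).
Qed.

(** * Lifts of the cone pair to the fibration *)

Section ConeLifts.
Context (R : realType) (A Y Z : ptopologicalType) (f : {pmap A -> Y}).
Context (phi : {pmap mapping_cone R f -> Z}).
Local Notation M := (mapping_cone R f).
Local Notation base := (mcone_base R f).
Local Notation cpt := (@cone_pt R A Y f).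
Local Notation h := (phi \po base).
Local Notation E := (pfib R h).
Local Notation E' := (pfib R phi).
Local Notation cpi := (ppi (@cone_rel R A)).

Lemma edge_lift_pt : edge_lift phi point = point.
Proof.
apply: pfib_eq => [|s s01]; first exact: pmap_pt.
by rewrite pfam_pev // pev_pt; exact: edge_pt.
Qed.

Lemma edge_lift_cts : continuous (edge_lift phi).
Proof. by apply: pfam_cts; exact: pmap_cts. Qed.

Definition edge_lift_map : {pmap A -> E} := PMap edge_lift_cts edge_lift_pt.

Section Compare.
Context (G : {pmap cone R A -> E'}) (g : {pmap A -> E}) (Gg : cone_pair_lift G g).

Let S (z : A * (R * R)) : Z := pev (G (cpi (z.1, clamp z.2.1)), z.2.2).

Let S_cts : continuous S.
Proof.
apply: (@comp_cts _ (E' * R)%type Z (fun z : A * (R * R) => (G (cpi (z.1, clamp z.2.1)), z.2.2))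
  (@pev R Z M phi)); last exact: pev_cts.
apply: pair_cts; last by cts.
apply: (@comp_cts _ (A * unitI R)%type _ (fun z : A * (R * R) => (z.1, clamp z.2.1)) (fun x => G (cpi x))).
  by cts; exact: clamp_cts.
by apply: (@comp_cts _ (cone R A)); exact: pmap_cts.
Qed.

Let S_x0 a x y : x <= 0 -> S (a, (x, y)) = point.
Proof.
move=> x0; rewrite /S -[(a, (x, y)).2.1]/x clamp_le0 // cone_rel_pt; last by left.
by rewrite pmap_pt pev_pt.
Qed.

Let S_y0 a x y : y <= 0 -> S (a, (x, y)) = point.
Proof. exact: pev0. Qed.

Let S_x1 a x y : 1 <= x -> S (a, (x, y)) = pev (g a, y).
Proof.
move=> x1; rewrite /S -[(a, (x, y)).2.1]/x clamp_ge1 //.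
by have [-> _ _] := Gg.
Qed.

Let S_y1 a x y : 1 <= y -> S (a, (x, y)) = phi (cpt (a, x)).
Proof. by move=> y1; have [_ Gc _] := Gg; rewrite /S pev1 // Gc. Qed.

Let S_pt x y : S (point, (x, y)) = point.
Proof. by rewrite /S cone_rel_pt ?pmap_pt ?pev_pt //; right. Qed.

(* [S (a, -)] is trivial on the sides [x = 0] and [y = 0] of the square and
   restricts to [g a] on [x = 1] and to the canonical path on [y = 1]; the path
   (max (3 x - 1, 1 - 2 s), max (x, 2 s - 1)) from these trivial sides to (1, 1)
   moves from the first to the second. *)
Lemma cone_pair_lift_unique : phomotopic R g edge_lift_map.
Proof.
have [_ _ gf] := Gg.
apply: (@pfam_htpy _ _ _ _ _ _ _ (fun z => f z.1)
  (fun z => S (z.1.1, (Num.max (3 * z.2 - 1) (1 - 2 * z.1.2), Num.max z.2 (2 * z.1.2 - 1))))).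
- by cts.
- apply: (@comp_cts _ (A * (R * R))%type Z _ S); last exact: S_cts.
  by cts.
- move=> a s s01; rewrite -[(a, s, 0).2]/0 -[(a, s, 0).1.2]/s; case: (leP s 2^-1) => s2.
    by rewrite S_y0 // ge_max; lra.
  by rewrite S_x0 // ge_max; lra.
- move=> a s s01; rewrite -[(a, s, 1).2]/1 -[(a, s, 1).1.2]/s -[(a, s, 1).1.1]/a.
  rewrite S_y1; last by rewrite le_max lexx.
  by rewrite cone_pt_ge1 // le_max; lra.
- by move=> a; exact: (esym (gf a)).
- by [].
- move=> a x x01; rewrite -[(a, 0, x).2]/x -[(a, 0, x).1.2]/0 -[(a, 0, x).1.1]/a.
  rewrite S_x1; last by rewrite le_max; lra.
  by congr (pev (g a, _)); rewrite max_l //; lra.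
- move=> a x x01; rewrite -[(a, 1, x).2]/x -[(a, 1, x).1.2]/1 -[(a, 1, x).1.1]/a.
  rewrite S_y1; last by rewrite le_max; lra.
  rewrite pfam_pev // -[RHS]/(phi (cpt (a, 3 * x - 1))) max_l //; lra.
- by move=> s _; exact: pmap_pt.
- by move=> s x _ _; exact: S_pt.
Qed.

End Compare.

(** Over the point (a, t) of the cone lies the path from the apex straight up to height t, that is,
    the contraction of the cone run backwards. *)
Let cyl_path (z : (A * unitI R) * R) : Z := phi (cpt (z.1.1, psub_val z.1.2 * z.2)).

Let cyl_path_cts : continuous cyl_path.
Proof.
apply: (@comp_cts _ (A * R)%type Z (fun z : (A * unitI R) * R => (z.1.1, psub_val z.1.2 * z.2))
  (fun z => phi (cpt z))).
  by cts; exact: psub_val_cts.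
by apply: (@comp_cts _ M); [exact: cone_pt_cts|exact: pmap_cts].
Qed.

Let cyl_path0 z : cyl_path (z, 0) = point.
Proof. by rewrite /cyl_path mulr0 cone_pt_le0 // pmap_pt. Qed.

Let cyl_path1 z : cyl_path (z, 1) = phi (mcone_cone R f (cpi z)).
Proof. by case: z => a t; rewrite /cyl_path mulr1 /cone_pt clampK. Qed.

Let cyl_lift_fun (z : A * unitI R) : E' :=
  pfam (th := phi) (m := fun z => mcone_cone R f (cpi z)) cyl_path_cts cyl_path0 cyl_path1 z.

Let cyl_lift_cts : continuous cyl_lift_fun.
Proof. by apply: pfam_cts; apply: (@comp_cts _ (cone R A)); exact: pmap_cts. Qed.

Let cyl_lift_rel (z : A * unitI R) : z.2 = I0 R \/ z.1 = point -> cyl_lift_fun z = point.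
Proof.
move=> zr; apply: pfib_eq.
  by rewrite pfam_proj cone_rel_pt // !pmap_pt.
move=> s s01; rewrite pfam_pev // pev_pt /cyl_path -[(z, s).1]/z -[(z, s).2]/s.
case: zr => ->; last by rewrite cone_pt_pt pmap_pt.
by rewrite I0E mul0r cone_pt_le0 // pmap_pt.
Qed.

Let cyl_lift : {pmap (A * unitI R)%type -> E'} :=
  @PMap (A * unitI R)%type E' cyl_lift_fun cyl_lift_cts (@cyl_lift_rel point (or_introl erefl)).

Let cyl_lift_compat x y : @cone_rel R A x y -> cyl_lift x = cyl_lift y.
Proof. by move=> [x0 ->]; rewrite (pmap_pt cyl_lift); exact: cyl_lift_rel. Qed.

Let end_path (z : A * R) : Z := phi (cpt z).

Let end_path_cts : continuous end_path.
Proof. by apply: (@comp_cts _ M); [exact: cone_pt_cts|exact: pmap_cts]. Qed.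

Let end_path0 a : end_path (a, 0) = point.
Proof. by rewrite /end_path cone_pt_le0 // pmap_pt. Qed.

Let end_path1 a : end_path (a, 1) = h (f a).
Proof. by rewrite /end_path cone_pt_ge1. Qed.

Let end_lift_fun (a : A) : E := pfam (th := h) (m := f) end_path_cts end_path0 end_path1 a.

Let end_lift_cts : continuous end_lift_fun.
Proof. by apply: pfam_cts; exact: pmap_cts. Qed.

Let end_lift_pt : end_lift_fun point = point.
Proof.
apply: pfib_eq => [|s s01]; first exact: pmap_pt.
by rewrite pfam_pev // pev_pt /end_path cone_pt_pt pmap_pt.
Qed.

Lemma cone_pair_lift_exists :
  exists (G : {pmap cone R A -> E'}) (g : {pmap A -> E}), cone_pair_lift G g.
Proof.
exists (plift cyl_lift_compat), (PMap end_lift_cts end_lift_pt); split.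
- move=> a; rewrite [LHS](pliftE cyl_lift_compat (a, I1 R)).
  apply: pfib_eq; first exact: (esym (po_glue f (cone_in R A) a)).
  move=> s s01; rewrite [LHS](pfam_pev cyl_path_cts) // /cyl_path -[(_, s).2]/s I1E mul1r.
  rewrite -[RHS]/(pev (end_lift_fun a, s)).
  by rewrite [RHS](pfam_pev end_path_cts).
- by move=> c; have [z <-] := ppi_surj c; rewrite [X in pfib_proj _ _ X](pliftE cyl_lift_compat).
- by [].
Qed.

End ConeLifts.

(** * The action of the loop space *)

Section GammaBar.
Context (R : realType) (A Y Z : ptopologicalType) (h : {pmap Y -> Z}).
Local Notation T := (loop R Z).
Local Notation E := (pfib R h).
Context (g g' : {pmap A -> E}) (s : {pmap T -> loop R Y}) (a : principal_action R h).
Context (eps : {pmap hsmash (loop R Y) E -> Gamma_dom R h}).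
Local Notation "f ~h f'" := (phomotopic R f f') (at level 70).

(** The inclusion [j] of the product into the domain of [Gamma] satisfies [collapse j = pi] and
    [Gamma j = theta]; as [eps collapse] is homotopic to the identity, [eps pi] is homotopic to
    [j]. *)
Lemma Gamma_bar_action :
  homotopy_inverse R (collapse R h) eps ->
  a \po (loop_map R h \px pidm E) ~h Gamma_bar a eps \po ppi (@hsmash_rel (loop R Y) E).
Proof.
move=> [ec _]; pose j := po_r (cone_in R (loop R Y)) (pinl (loop R Y) E).
have cj : collapse R h \po j = ppi (@hsmash_rel (loop R Y) E).
  by apply: pmap_eqP => x; exact: (po_lift_r (@collapse_compat R Y Z h)).
have Gj : Gamma a \po j = a \po (loop_map R h \px pidm E).
  by apply: pmap_eqP => x; exact: (po_lift_r (Gamma_compat a)).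
rewrite -cj -Gj /Gamma_bar !pcompA; apply: ph_precomp.
rewrite -pcompA -[X in X ~h _]pcomp_idr; apply: ph_postcomp; exact: ph_sym.
Qed.

Lemma Gamma_bar_homotopy :
  phomotopic R (loop_map R h \po s) (pidm T) -> homotopy_inverse R (collapse R h) eps ->
  g ~h g' ->
  concat_action R h \po (pidm T \px g') ~h
  Gamma_bar a eps \po hsmash_map s g \po ppi (@hsmash_rel T A).
Proof.
move=> hs ie gg.
have -> : Gamma_bar a eps \po hsmash_map s g \po ppi (@hsmash_rel T A) =
    Gamma_bar a eps \po ppi (@hsmash_rel (loop R Y) E) \po (s \px g).
  apply: pmap_eqP => x; rewrite -[LHS]/(Gamma_bar a eps (hsmash_map s g (ppi _ x))).
  by rewrite [hsmash_map _ _ _](pliftE (@hsmash_map_compat _ _ _ _ s g)).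
apply: (ph_trans (g := a \po (loop_map R h \px pidm E) \po (s \px g))); last first.
  by apply: ph_precomp; exact: Gamma_bar_action.
apply: ph_sym; apply: (ph_trans (g := a \po (pidm T \px g))).
  have -> : a \po (loop_map R h \px pidm E) \po (s \px g) = a \po ((loop_map R h \po s) \px g).
    exact: pmap_eqP.
  by apply: ph_postcomp; apply: ph_prod => //; exact: ph_refl.
apply: (ph_trans (g := concat_action R h \po (pidm T \px g))).
  by apply: ph_precomp; exact: paction_homotopic.
by apply: ph_postcomp; apply: ph_prod => //; exact: ph_refl.
Qed.

End GammaBar.

Theorem cofibration_of_well_pointed (R : realType) (A Y Z : ptopologicalType)
    (f : {pmap A -> Y}) (phi : {pmap mapping_cone R f -> Z})
    (G : {pmap cone R A -> pfib R phi}) (g : {pmap A -> pfib R (phi \po mcone_base R f)})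
    (s : {pmap loop R Z -> loop R Y}) (a : principal_action R (phi \po mcone_base R f))
    (eps : {pmap hsmash (loop R Y) (pfib R (phi \po mcone_base R f)) ->
      Gamma_dom R (phi \po mcone_base R f)}) :
  h_well_pointed R A -> cone_pair_lift G g ->
  phomotopic R (loop_map R (phi \po mcone_base R f) \po s) (pidm (loop R Z)) ->
  homotopy_inverse R (collapse R (phi \po mcone_base R f)) eps ->
  homotopy_cofibration R (Gamma_bar a eps \po hsmash_map s g)
    (pfib_pull R phi (mcone_base R f)).
Proof.
move=> hA Gg hs ie.
have := Gamma_bar_homotopy a hs ie (cone_pair_lift_unique Gg).
move=> /phomotopicP[Q].
by apply: (action_cofibration (hforget Q (@no_set0 _ _)) hA).
Qed.

(** * CW complexes *)

Section Disks.
Context (R : realType).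
Local Notation I := (unitI R).

Lemma invR_cts (T : topologicalType) (F : T -> R) :
  continuous F -> (forall x, F x != 0) -> continuous (fun x => (F x)^-1).
Proof. by move=> cF F0 x; apply: cvgV; [exact: F0|exact: cF]. Qed.

Lemma rV_cts (T : topologicalType) (n : nat) (F : T -> 'rV[R]_n) :
  (forall i, continuous (fun x => F x 0 i)) -> continuous F.
Proof.
move=> cF x U /nbhs_ballP[e /= e0 eU].
have xb : nbhs x [set y | forall i, ball (F x 0 i) e (F y 0 i)].
  apply: filter_forall => i; apply: (cF i x); exact: nbhsx_ballx.
apply: (@filterS T (nbhs x) _ _ (F @^-1` U) _ xb) => y yb.
apply: eU.
by split; [exact: e0|move=> i j; rewrite ord1; exact: yb].
Qed.

Lemma sumR_cts (T : topologicalType) (J : Type) (r : seq J) (F : J -> T -> R) :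
  (forall i, continuous (F i)) -> continuous (fun x => \sum_(i <- r) F i x).
Proof.
move=> cF; elim: r => [|i r IH].
  by rewrite (_ : (fun x => _) = cst 0); [exact: cst_cts|apply/funext => x; rewrite big_nil].
rewrite (_ : (fun x => _) = fun x => F i x + \sum_(i <- r) F i x).
  by apply: addR_cts.
by apply/funext => x; rewrite big_cons.
Qed.

Context (n : nat).
Local Notation disk := (@disk R n).

Definition rV_norm (y : 'rV[R]_n) : R := Num.sqrt (\sum_i y 0 i ^+ 2).

Lemma rV_norm_cts : continuous rV_norm.
Proof.
apply: (@comp_cts _ R R _ Num.sqrt); last exact: sqrt_continuous.
apply: (@sumR_cts _ _ _ (fun i (y : 'rV[R]_n) => y 0 i ^+ 2)) => i.
have c : continuous (fun y : 'rV[R]_n => y 0 i) := @coord_continuous _ _ _ _ _.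
by apply: (@mulR_cts _ _ (fun y : 'rV[R]_n => y 0 i) (fun y => y 0 i)).
Qed.

Lemma rV_normZ (c : R) y : 0 <= c -> rV_norm (c *: y) = c * rV_norm y.
Proof.
move=> c0; rewrite /rV_norm (_ : \sum_i _ = c ^+ 2 * \sum_i y 0 i ^+ 2).
  by rewrite sqrtrM ?sqr_ge0 // sqrtr_sqr ger0_norm.
by rewrite mulr_sumr; apply: eq_bigr => i _; rewrite mxE exprMn.
Qed.

Lemma rV_norm_le1 (y : 'rV[R]_n) : disk y <-> rV_norm y <= 1.
Proof. by rewrite /disk /mkset /rV_norm -[X in _ <-> _ <= X]sqrtr1 ler_sqrt. Qed.

Lemma rV_norm_lt1 (y : 'rV[R]_n) : (\sum_i y 0 i ^+ 2 < 1) = (rV_norm y < 1).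
Proof. by rewrite /rV_norm -[X in _ = (_ < X)]sqrtr1 ltr_sqrt. Qed.

Lemma rV_norm_ge0 (y : 'rV[R]_n) : 0 <= rV_norm y.
Proof. exact: sqrtr_ge0. Qed.

Let big (y : 'rV[R]_n) : R := Num.max 1 (rV_norm y).

Let big_gt0 y : 0 < big y.
Proof. by rewrite /big lt_max ltr01. Qed.

Lemma disk_proj_subproof y : disk ((big y)^-1 *: y).
Proof.
apply/rV_norm_le1; rewrite rV_normZ; last by rewrite invr_ge0 ltW.
rewrite ler_pdivrMl // mulr1.
by rewrite /big le_max lexx orbT.
Qed.

Definition to_disk (y : 'rV[R]_n) (dy : disk y) : disk := exist _ y (mem_set dy).

Definition disk_proj (y : 'rV[R]_n) : disk := to_disk (disk_proj_subproof y).

Lemma disk_proj_val y : set_val (disk_proj y) = (big y)^-1 *: y.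
Proof. by []. Qed.

Lemma disk_val_cts : continuous (fun x : disk => set_val x : 'rV[R]_n).
Proof. exact: (@initial_continuous (set_type disk) _ set_val). Qed.

Lemma disk_valP (x : disk) : disk (set_val x).
Proof. exact: (set_mem (svalP x)). Qed.

Lemma disk_proj_cts : continuous disk_proj.
Proof.
apply: (@continuous_comp_initial (set_type disk) _ _ set_val).
apply: rV_cts => i; rewrite (_ : (fun y => _) = fun y : 'rV[R]_n => (big y)^-1 * y 0 i); last first.
  by apply/funext => y; rewrite mxE.
have c : continuous (fun y : 'rV[R]_n => y 0 i) := @coord_continuous _ _ _ _ _.
apply: mulR_cts => //; apply: invR_cts => [|y]; last by rewrite gt_eqF.
by rewrite /big; apply: maxR_cts; [exact: cst_cts|exact: rV_norm_cts].
Qed.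

Lemma disk_proj_small y : rV_norm y <= 1 -> set_val (disk_proj y) = y.
Proof. by move=> y1; rewrite disk_proj_val /big max_l // invr1 scale1r. Qed.

Lemma disk_projK (x : disk) : disk_proj (set_val x) = x.
Proof.
by apply: eq_sig_hprop => //; rewrite -[LHS]/(set_val _) disk_proj_small //; apply/rV_norm_le1/disk_valP.
Qed.

Lemma disk_proj_large y : 1 <= rV_norm y -> rV_norm (set_val (disk_proj y)) = 1.
Proof.
move=> y1; rewrite disk_proj_val rV_normZ; last by rewrite invr_ge0 ltW.
rewrite /big max_r // mulVf // gt_eqF //.
exact: lt_le_trans y1.
Qed.

Lemma disk_compact : compact [set: disk].
Proof.
have -> : [set: disk] = disk_proj @` [set y : 'rV[R]_n | forall i, `[-1, 1]%classic (y ord0 i)].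
  rewrite eqEsubset; split=> // x _; exists (set_val x); last exact: disk_projK.
  move=> i; have := disk_valP x; rewrite /disk /mkset (bigD1 i) //= => x1.
  have : set_val x 0 i ^+ 2 <= 1.
    by apply: le_trans x1; rewrite lerDl; apply: sumr_ge0 => j _; exact: sqr_ge0.
  by move=> /ler_wsqrtr; rewrite sqrtr_sqr sqrtr1 ler_norml /= in_itv.
apply: continuous_compact; first exact/continuous_subspaceT/disk_proj_cts.
by apply: (@rV_compact R n (fun=> `[-1, 1]%classic)) => i; exact: segment_compact.
Qed.

(* The radial projection of the cylinder over the disk from the point at height
   2 above its centre, onto the bottom and the side. *)
Definition cyl_disk (z : disk * I) : disk :=
  disk_proj ((2 / (2 - psub_val z.2)) *: set_val z.1).

(** The ray meets the side at height 2 - (2 - s) / |x|. The floor 1/2 keeps the denominator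
    positive; where it is attained the unclamped height is 2 s - 2 <= 0, so the clamp gives the
    bottom. *)
Definition cyl_height (z : disk * I) : I :=
  clamp (2 - (2 - psub_val z.2) / Num.max (rV_norm (set_val z.1)) 2^-1).

Let I01 (s : I) : 0 <= psub_val s <= 1.
Proof. by have := psub_valP s; rewrite /= in_itv. Qed.

Lemma cyl_disk_cts : continuous cyl_disk.
Proof.
apply: (@comp_cts _ 'rV[R]_n _ (fun z : disk * I => (2 / (2 - psub_val z.2)) *: set_val z.1) disk_proj);
  last exact: disk_proj_cts.
apply: rV_cts => i.
rewrite (_ : (fun y => _) = fun z : disk * I => (2 / (2 - psub_val z.2)) * set_val z.1 0 i); last first.
  by apply/funext => y; rewrite mxE.
have c : continuous (fun y : 'rV[R]_n => y 0 i) := @coord_continuous _ _ _ _ _.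
apply: mulR_cts.
  apply: mulR_cts; first exact: cst_cts.
  apply: invR_cts; first by cts; exact: psub_val_cts.
  by move=> z; rewrite lt0r_neq0 // subr_gt0; have /andP[_ z1] := I01 z.2; apply: le_lt_trans z1 _; rewrite ltr1n.
apply: (@comp_cts _ disk _ fst (fun x : disk => set_val x 0 i)); first exact: fst_cts.
by apply: (@comp_cts _ 'rV[R]_n _ _ (fun y => y 0 i)); first exact: disk_val_cts.
Qed.

Lemma cyl_height_cts : continuous cyl_height.
Proof.
apply: (@comp_cts _ R _ (fun z : disk * I => 2 - (2 - psub_val z.2) / Num.max (rV_norm (set_val z.1)) 2^-1)
  (@clamp R)); last exact: clamp_cts.
have c : continuous (fun z : disk * I => (Num.max (rV_norm (set_val z.1)) 2^-1)^-1).
  apply: invR_cts; last by move=> z; rewrite lt0r_neq0 // lt_max; lra.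
  apply: maxR_cts; last exact: cst_cts.
  apply: (@comp_cts _ disk _ fst (fun x : disk => rV_norm (set_val x))); first exact: fst_cts.
  by apply: (@comp_cts _ 'rV[R]_n _ _ rV_norm); [exact: disk_val_cts|exact: rV_norm_cts].
apply: addR_cts; first exact: cst_cts.
apply: oppR_cts; apply: mulR_cts => //.
by cts; exact: psub_val_cts.
Qed.

Let norm01 (x : disk) : 0 <= rV_norm (set_val x) <= 1.
Proof. by rewrite rV_norm_ge0 /=; apply/rV_norm_le1/disk_valP. Qed.

Lemma not_open_disk (x : disk) : ~ open_disk x <-> rV_norm (set_val x) = 1.
Proof.
rewrite /open_disk rV_norm_lt1; have := norm01 x; split.
  by move=> /negP; rewrite -leNgt => x1; apply/le_anti; rewrite x1 andbT; case/andP: H.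
by move=> ->; rewrite ltxx.
Qed.

Lemma cyl_side (x : disk) s : ~ open_disk x -> cyl_disk (x, s) = x /\ cyl_height (x, s) = s.
Proof.
move=> /not_open_disk x1; have s01 := I01 s.
have c0 : 0 < 2 / (2 - psub_val s) by rewrite divr_gt0 //; lra.
split.
  apply: eq_sig_hprop => //; rewrite -[LHS]/(set_val _) disk_proj_val /big.
  rewrite -[(x, s).2]/s -[(x, s).1]/x rV_normZ; last exact: ltW.
  rewrite x1 mulr1 max_r.
    by rewrite scalerA mulVf ?scale1r // gt_eqF.
  by rewrite ler_pdivlMr; lra.
rewrite /cyl_height -[(x, s).2]/s -[(x, s).1]/x x1 max_l; last by lra.
by rewrite divr1 opprB addrCA subrr addr0 clampK.
Qed.

Lemma cyl_bottom (x : disk) : cyl_disk (x, I0 R) = x /\ cyl_height (x, I0 R) = I0 R.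
Proof.
have x01 := norm01 x; split.
  rewrite /cyl_disk -[psub_val _]/(0 : R) subr0 divff // scale1r; exact: disk_projK.
rewrite /cyl_height -[psub_val _]/(0 : R) -[(x, _).1]/x.
have m0 : 0 < Num.max (rV_norm (set_val x)) 2^-1 by rewrite lt_max; lra.
have m1 : Num.max (rV_norm (set_val x)) 2^-1 <= 1 by rewrite ge_max; lra.
by apply: clamp_le0; rewrite subr0 subr_le0 ler_pdivlMr //; lra.
Qed.

Lemma cyl_proj (z : disk * I) : cyl_height z = I0 R \/ ~ open_disk (cyl_disk z).
Proof.
case: z => x s; have x01 := norm01 x; have s01 := I01 s.
have c0 : 0 < 2 / (2 - psub_val s) by rewrite divr_gt0 //; lra.
case: (leP 1 (2 / (2 - psub_val s) * rV_norm (set_val x))) => cx.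
  by right; apply/not_open_disk; apply: disk_proj_large; rewrite rV_normZ // ltW.
left; apply: clamp_le0; rewrite -[(x, s).2]/s -[(x, s).1]/x.
have m0 : 0 < Num.max (rV_norm (set_val x)) 2^-1 by rewrite lt_max; lra.
rewrite subr_le0 ler_pdivlMr // -ler_pdivlMl // ge_max.
have : 2 * rV_norm (set_val x) < 2 - psub_val s.
  by move: cx; rewrite mulrAC ltr_pdivrMr; lra.
lra.
Qed.

End Disks.

(** * Retraction of the cylinder on a CW complex *)

Lemma prod_hausdorff (S T : topologicalType) :
  hausdorff_space S -> hausdorff_space T -> hausdorff_space (S * T)%type.
Proof.
rewrite !open_hausdorff => hS hT [x y] [x' y']; have [->|xx'] := eqVneq x x'; last first.
  move=> _; have [[U V] /= [Ux Vx] [oU oV UV]] := hS _ _ xx'.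
  exists (fst @^-1` U, fst @^-1` V); first by rewrite !inE in Ux Vx *.
  have /continuousP cf := @fst_cts S T.
  split; [exact: cf|exact: cf|].
  by apply/eqP; rewrite -preimage_setI (eqP UV) preimage_set0.
have [->|yy' _] := eqVneq y y'; first by rewrite eqxx.
have [[U V] /= [Uy Vy] [oU oV UV]] := hT _ _ yy'.
exists (snd @^-1` U, snd @^-1` V); first by rewrite !inE in Uy Vy *.
have /continuousP cs := @snd_cts S T.
split; [exact: cs|exact: cs|].
by apply/eqP; rewrite -preimage_setI (eqP UV) preimage_set0.
Qed.

Section CWRetraction.
Context (R : realType) (W : ptopologicalType) (c : finite_type_CW R W).
Local Notation I := (unitI R).
Local Notation disk n := (@disk R n).
Local Notation ch := (@cw_char R W c _).
Local Notation cell_type := {n & ('I_(ncell c n) * disk n)%type}.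

Let cell_ex (w : W) : exists p : cell_type,
  open_disk (projT2 p).2 /\ cw_char (projT2 p).1 (projT2 p).2 = w.
Proof. by have [n [i [x xw]]] := cw_cover c w; exists (existT _ n (i, x)). Qed.

Let cell (w : W) : cell_type := projT1 (cid (cell_ex w)).

Let cell_open w : open_disk (projT2 (cell w)).2.
Proof. by rewrite /cell; case: cid => p []. Qed.

Let cell_char w : cw_char (projT2 (cell w)).1 (projT2 (cell w)).2 = w.
Proof. by rewrite /cell; case: cid => p []. Qed.

Let cellE n (i : 'I_(ncell c n)) (x : disk n) :
  open_disk x -> cell (cw_char i x) = existT _ n (i, x).
Proof.
move=> ox; have := cell_open (cw_char i x); have := cell_char (cw_char i x).
case: (cell _) => m [j y] /= jy oy; exact: (cw_inj oy ox jy).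
Qed.

Let dim (w : W) : nat := projT1 (cell w).

(* On each open cell other than the base vertex, project its cylinder onto the
   bottom and the side. *)
Definition cyl_step (p : W * I) : W * I :=
  if pselect (p.1 = point) then p else
  (cw_char (projT2 (cell p.1)).1 (cyl_disk ((projT2 (cell p.1)).2, p.2)),
   cyl_height ((projT2 (cell p.1)).2, p.2)).

Let step_open n (i : 'I_(ncell c n)) (x : disk n) s :
  open_disk x -> cw_char i x <> point ->
  cyl_step (cw_char i x, s) = (cw_char i (cyl_disk (x, s)), cyl_height (x, s)).
Proof. by move=> ox xp; rewrite /cyl_step; case: pselect => //= _; rewrite cellE. Qed.

Let final (p : W * I) : Prop := p.1 = point \/ p.2 = I0 R.

Let step_final p : final p -> cyl_step p = p.
Proof.
rewrite /cyl_step; case: pselect => // p1 [//|p2]; rewrite p2.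
have [-> ->] := cyl_bottom (projT2 (cell p.1)).2.
by rewrite cell_char -p2 -surjective_pairing.
Qed.

Let iter_final n p : final p -> iter n cyl_step p = p.
Proof. by move=> fp; elim: n => //= n ->; exact: step_final. Qed.

(** A step either reaches the bottom or lands over the boundary of the cell, which lies in cells of
    smaller dimension; so one step more than the dimension is enough. *)
Let iter_dim n p : (dim p.1 < n)%N -> final (iter n cyl_step p).
Proof.
elim: n p => // n IH [w s] dn; rewrite iterSr.
case: (pselect (w = point)) => [wp|wp].
  by rewrite step_final ?iter_final //; left.
pose q := projT2 (cell w).
have -> : cyl_step (w, s) = (cw_char q.1 (cyl_disk (q.2, s)), cyl_height (q.2, s)).
  by rewrite /cyl_step; case: pselect.
case: (cyl_proj (q.2, s)) => [b0|ao]; first by rewrite iter_final; right.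
apply: IH; have [m [j [y [mn oy ->]]]] := cw_boundary q.1 ao.
by rewrite /dim /= cellE //=; apply: leq_trans mn _.
Qed.

Definition cyl_retract (p : W * I) : W * I := iter (dim p.1).+1 cyl_step p.

Let retract_final p : final (cyl_retract p).
Proof. exact: iter_dim. Qed.

Let retract_id p : final p -> cyl_retract p = p.
Proof. exact: iter_final. Qed.

Let retractE n p : (dim p.1 < n)%N -> iter n cyl_step p = cyl_retract p.
Proof.
by move=> dn; rewrite -(subnK dn) iterD iter_final //; exact: retract_final.
Qed.

Let retract_step p : cyl_retract (cyl_step p) = cyl_retract p.
Proof.
pose n := (maxn (dim p.1) (dim (cyl_step p).1)).+1.
rewrite -(@retractE n) ?ltnS ?leq_maxr // -iterSr (retractE (n := n.+1)) //.
by rewrite ltnS ltnW // ltnS leq_maxl.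
Qed.

(** Disjointness of open cells identifies this cell with the 0-cell of the base vertex, and the disk
    of dimension 0 is a point. *)
Let base_cell n (i : 'I_(ncell c n)) (x : disk n) : open_disk x -> cw_char i x = point ->
  forall y : disk n, cw_char i y = point.
Proof.
move=> ox xp y; have [i0 [x0 x0p]] := cw_vertex c.
have o0 : open_disk x0 by rewrite /open_disk big_ord0.
have /(congr1 (@projT1 _ _)) /= n0 := cw_inj ox o0 (etrans xp (esym x0p)).
subst n; rewrite (_ : y = x) //; apply: eq_sig_hprop => //.
by apply/rowP => -[].
Qed.

Let retract_char n (i : 'I_(ncell c n)) :
  (forall x : disk n, open_disk x -> cw_char i x <> point) -> forall (x : disk n) s,
  cyl_retract (cw_char i x, s) = cyl_retract (cw_char i (cyl_disk (x, s)), cyl_height (x, s)).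
Proof.
move=> ip x s; case: (pselect (open_disk x)) => ox; last by have [-> ->] := cyl_side s ox.
by rewrite -retract_step step_open //; exact: ip.
Qed.

Let char_prod_cts n (i : 'I_(ncell c n)) :
  continuous (fun z : disk n * I => (cw_char i z.1, z.2)).
Proof. by cts; exact: cw_char_cts. Qed.

Let prodH : hausdorff_space (W * I)%type.
Proof. by apply: prod_hausdorff; [exact: cw_hausdorff c|exact: unitI_hausdorff]. Qed.

Let lower n : set W := [set w | exists m (j : 'I_(ncell c m)) (y : disk m), (m < n)%N /\ cw_char j y = w].

(** There are finitely many cells below dimension n and their cylinders are compact, so the set is a
    finite union of compact sets in a Hausdorff space. *)
Let closed_lower n (C : set (W * I)) :
  (forall m (j : 'I_(ncell c m)), (m < n)%N ->
     closed [set z : disk m * I | C (cyl_retract (cw_char j z.1, z.2))]) ->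
  closed [set p : W * I | lower n p.1 /\ C (cyl_retract p)].
Proof.
move=> cC.
have -> : [set p : W * I | lower n p.1 /\ C (cyl_retract p)] =
    \bigcup_(m in `I_n) \bigcup_(j in [set: 'I_(ncell c m)])
      ((fun z : disk m * I => (cw_char j z.1, z.2)) @`
        [set z : disk m * I | C (cyl_retract (cw_char j z.1, z.2))]).
  rewrite eqEsubset; split=> [[w s] [[m [j [y [mn jy]]]] Cp]|p [m mn [j _ [[y s] Cp <-]]]].
    by exists m => //; exists j => //; exists (y, s) => //=; rewrite jy.
  by split=> //; exists m, j, y.
apply: closed_bigcup => [|m mn]; first exact: finite_II.
apply: closed_bigcup => [|j _]; first exact: finite_finset.
apply: compact_closed => //; apply: continuous_compact.
  exact/continuous_subspaceT/char_prod_cts.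
apply: (@subclosed_compact _ _ [set: disk m * I]) => //; first exact: cC.
rewrite -setXTT; apply: compact_setX; [exact: disk_compact|exact: unitI_compact].
Qed.

(** Induction on the dimension: projecting the cylinder over the cell leads either to the bottom,
    where the retraction is the identity, or over the lower skeleton, where the preimage of [C] is
    closed by [closed_lower]. *)
Let closed_cell n (i : 'I_(ncell c n)) (C : set (W * I)) : closed C ->
  closed [set z : disk n * I | C (cyl_retract (cw_char i z.1, z.2))].
Proof.
move=> cC; elim/ltn_ind: n i => n IH i.
case: (pselect (exists x : disk n, open_disk x /\ cw_char i x = point)) => [[x [ox xp]]|ip].
  have ip := base_cell ox xp.
  rewrite (_ : [set z | _] = (fun z : disk n * I => (cw_char i z.1, z.2)) @^-1` C).
    have /continuous_closedP cl := @char_prod_cts n i; exact: cl.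
  by apply/seteqP; split=> -[y s] /=; rewrite retract_id //; left; exact: ip.
have {}ip x : open_disk x -> cw_char i x <> point by move=> ox xp; apply: ip; exists x.
pose F (z : disk n * I) := (cw_char i (cyl_disk z), cyl_height z).
have cF : continuous F.
  apply: pair_cts; last exact: cyl_height_cts.
  apply: (@comp_cts _ (disk n) W); [exact: cyl_disk_cts|exact: cw_char_cts].
have /continuous_closedP clF := cF.
pose P := [set z : disk n * I | psub_val (cyl_height z) <= 0 :> R].
have cP : closed P.
  apply: (@preimage_closed _ _ (fun z : disk n * I => psub_val (cyl_height z) : R) [set x | x <= 0]).
    move=> x _; apply: (@comp_cts _ I R); [exact: cyl_height_cts|exact: psub_val_cts].
  exact: closed_le.
rewrite (_ : [set z | _] = (P `&` F @^-1` C) `|`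
    F @^-1` [set p : W * I | lower n p.1 /\ C (cyl_retract p)]).
  apply: closedU; first by apply: closedI => //; exact: clF.
  by apply: clF; apply: closed_lower => m j mn; exact: IH.
apply/seteqP; split=> -[x s]; rewrite /setU /setI /preimage /mkset -[(x, s).1]/x -[(x, s).2]/s.
  rewrite retract_char // => Cr; case: (cyl_proj (x, s)) => [b0|ao].
    left; split; first by rewrite /P /mkset b0; exact: lexx.
    by move: Cr; rewrite retract_id //; right.
  right; split=> //; have [m [j [y [mn oy jy]]]] := cw_boundary i ao.
  by exists m, j, y.
rewrite retract_char //; case=> [[b0 CF]|[_ CF]] //.
rewrite retract_id //; right; apply: psub_val_inj; apply/le_anti.
have := psub_valP (cyl_height (x, s)); rewrite /mkset in_itv => /andP[h0 _].
by apply/andP; split.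
Qed.

Let retract_cell_cts n (i : 'I_(ncell c n)) :
  continuous (fun z : disk n * I => cyl_retract (cw_char i z.1, z.2)).
Proof. by apply/continuous_closedP => C; exact: closed_cell. Qed.

Let retract_path_cts w : continuous (fun s => cyl_retract (w, s)).
Proof.
rewrite -(cell_char w).
apply: (@comp_cts _ _ _ (fun s => ((projT2 (cell w)).2, s))
  (fun z => cyl_retract (cw_char (projT2 (cell w)).1 z.1, z.2))); last exact: retract_cell_cts.
by cts.
Qed.

(** The weak topology is available on W and not on W x I. The retraction is therefore curried to a
    map from W into a path space, whose continuity is tested on cells. *)
Lemma cyl_retract_cts : continuous cyl_retract.
Proof.
pose WI : ptopologicalType := (W * I)%type.
pose r (w : W) : free_path R WI := @mkpath R WI _ (@retract_path_cts w).
have cr : continuous r.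
  apply/continuous_closedP => C cC; apply: (@cw_weak R W c) => n i.
  pose k : disk n -> free_path R WI :=
    @curry_path R (disk n) WI (fun x s => cyl_retract (cw_char i x, s)) (@retract_cell_cts n i).
  have ck : continuous k by exact: curry_pathP.
  have rk x : r (cw_char i x) = k x by exact: free_path_eq.
  rewrite (_ : _ @^-1` _ = k @^-1` C).
    by have /continuous_closedP cl := ck; exact: cl.
  by apply/seteqP; split=> x; rewrite /preimage /mkset rk.
rewrite (_ : cyl_retract = fun p : W * I => r p.1 p.2); last by apply/funext => -[].
apply: (@path_app_cts R (W * I)%type WI (fun p => r p.1) snd); last exact: snd_cts.
by apply: (@comp_cts _ W); [exact: fst_cts|exact: cr].
Qed.

Lemma CW_well_pointed : h_well_pointed R W.
Proof.
pose H (z : W * R) := (cyl_retract (z.1, clamp (1 - z.2))).1.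
have cH : continuous H.
  apply: (@comp_cts _ (W * I)%type W _ fst); last exact: fst_cts.
  apply: (@comp_cts _ (W * I)%type _ (fun z : W * R => (z.1, clamp (1 - z.2)))); last exact: cyl_retract_cts.
  by cts; exact: clamp_cts.
pose d w := (cyl_retract (w, I1 R)).1.
have H0 w s : s <= 0 -> H (w, s) = d w.
  by move=> s0; rewrite /H /= clamp_ge1 //; lra.
have H1 w s : 1 <= s -> H (w, s) = w.
  by move=> s1; rewrite /H /= clamp_le0 ?retract_id //; [right|lra].
have HD w s : [set point] w -> H (w, s) = d w.
  by move=> ->; rewrite /H /d !retract_id //; left.
(* Where this function is at most 1 the retracted height is at least 1/2, so the retracted point is
   off the bottom and hence lies over the base vertex. *)
exists (fun w => 2 * (1 - psub_val (cyl_retract (w, I1 R)).2)), d, (Htpy cH H0 H1 HD); split.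
- apply: (@comp_cts W (W * I)%type R (fun w => cyl_retract (w, I1 R)) (fun p => 2 * (1 - psub_val p.2))).
    by apply: (@comp_cts W (W * I)%type _ (fun w => (w, I1 R))); [cts|exact: cyl_retract_cts].
  by cts; exact: psub_val_cts.
- by rewrite retract_id /= ?I1E ?subrr ?mulr0 //; left.
- move=> w uw; case: (retract_final (w, I1 R)) => [e|e]; first exact: e.
  by exfalso; move: uw; rewrite e I0E subr0 mulr1 leNgt ltr1n.
Qed.

End CWRetraction.

(** [g d e] sends to the base point whatever [d e] does, and it is deformed to [g e] and on to the
    identity. *)
Lemma h_well_pointed_heq (R : realType) (A W : ptopologicalType) (e : {pmap A -> W}) :
  homotopy_equivalence R e -> h_well_pointed R W -> h_well_pointed R A.
Proof.
move=> [g [/phomotopicP[F] _]] [u [d [D [cu u_pt ud]]]].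
have ept a : [set point] a -> [set point] (e a) by move=> ->; exact: pmap_pt.
exists (fun a => u (e a)), (fun a => g (d (e a))),
  (hcomp (hpost (@pmap_cts _ _ g) (hpre D (@pmap_cts _ _ e) ept)) F); split.
- by apply: comp_cts; first exact: pmap_cts.
- by rewrite pmap_pt.
- by move=> a /ud ->; exact: pmap_pt.
Qed.

Lemma finite_CW_type_well_pointed (R : realType) (A : ptopologicalType) :
  has_finite_CW_type R A -> h_well_pointed R A.
Proof. by move=> [W [c [e /h_well_pointed_heq]]]; apply; exact: CW_well_pointed. Qed.

Theorem theorem3p3 (R : realType) (A Y Z : ptopologicalType)
    (A_conn : path_connected R A) (A_cw : has_finite_CW_type R A)
    (Y_conn : path_connected R Y) (Y_cw : has_finite_CW_type R Y)
    (Z_conn : path_connected R Z) (Z_cw : has_finite_CW_type R Z)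
    (f : {pmap A -> Y}) (phi : {pmap mapping_cone R f -> Z}) :
  let h : {pmap Y -> Z} := phi \po mcone_base R f in
  let E : ptopologicalType := pfib R h in
  let E' : ptopologicalType := pfib R phi in
  (exists (G : {pmap cone R A -> E'}) (g : {pmap A -> E}),
     cone_pair_lift G g) /\
  (forall (G : {pmap cone R A -> E'}) (g : {pmap A -> E})
          (s : {pmap loop R Z -> loop R Y})
          (a : principal_action R h)
          (eps : {pmap hsmash (loop R Y) E -> Gamma_dom R h}),
     cone_pair_lift G g ->
     phomotopic R (loop_map R h \po s) (pidm (loop R Z)) ->
     homotopy_inverse R (collapse R h) eps ->
     homotopy_cofibration R
       (Gamma_bar a eps \po hsmash_map s g)
       (pfib_pull R phi (mcone_base R f))).
Proof.
move=> h E E'; split; first exact: cone_pair_lift_exists.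
move=> G g s a eps Gg hs ie.
exact: (cofibration_of_well_pointed a (finite_CW_type_well_pointed A_cw) Gg hs ie).
Qed.
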